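(* An edge-to-edge unit-area tiling of the plane by non-convex pentagons and pentagons all of whose angles are strictly between $\pi/2$ and $2\pi/3$ has perimeter ratio more than half the perimeter of a unit-area Prismatic pentagon, i.e. more than $\sqrt{2+\sqrt3}$.
   Context: Edge-to-edge means adjacent tiles meet only along entire edges or at vertices. The perimeter ratio of a planar tiling is the limit supremum, as $R\to\infty$, of the perimeter (total edge length of the tiling) inside the disk of radius $R$ about the origin, divided by $\pi R^2$. A Prismatic pentagon is a pentagon with three angles of $2\pi/3$ and two adjacent right angles, circumscribed about a circle; at unit area it has perimeter $2\sqrt{2+\sqrt3}\approx 3.86$. *)

(* Defs.v *)
From HB Require Import structures.
From mathcomp Require Import all_boot all_order all_algebra.
From mathcomp Require Import all_classical all_reals all_analysis.

Set Implicit Arguments.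
Unset Strict Implicit.
Unset Printing Implicit Defensive.

Import Order.TTheory GRing.Theory Num.Theory.
Import numFieldNormedType.Exports.

Local Open Scope classical_set_scope.
Local Open Scope ring_scope.

Section Plane.
Context {R : realType}.
Implicit Types p q : (R * R)%type.

Definition dot p q : R := p.1 * q.1 + p.2 * q.2.

(* The library's norm on a product is the sup norm, hence these Euclidean
   versions. *)
Definition eucl_norm p : R := Num.sqrt (dot p p).

Definition eucl_dist p q : R := eucl_norm (q - p).

Definition disk (c : R * R) (r : R) : set (R * R) :=
  [set p | eucl_dist c p <= r].

Definition segment p q : set (R * R) := [set p + t *: (q - p) | t in `[0, 1]].

Definition area (A : set (R * R)) : \bar R :=
  (lebesgue_measure \x lebesgue_measure)%E A.

(* Length of the part of [segment p q] lying in A: the proportion of parameters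
   falling in A, times the length of the segment. *)
Definition length_in p q (A : set (R * R)) : \bar R :=
  let I := [set t : R | 0 <= t <= 1 /\ A (p + t *: (q - p))] in
  ((eucl_dist p q)%:E * lebesgue_measure I)%E.

(* angle in [0, pi] between two nonzero vectors *)
Definition vangle p q : R := acos (dot p q / (eucl_norm p * eucl_norm q)).

End Plane.

(* A pentagon is given by its vertices in cyclic order, in either direction;
   ordS and ord_pred are the successor and predecessor modulo 5. *)
Definition pentagon (R : realType) := 'I_5 -> (R * R)%type.

Section Pentagon.
Context {R : realType}.
Implicit Types P : pentagon R.

Definition side P (k : 'I_5) : set (R * R) := segment (P k) (P (ordS k)).

Definition outline P : set (R * R) := [set p | exists k, side P k p].

Definition simple_pentagon P : Prop :=
  [/\ injective P,
      forall k, side P k `&` side P (ordS k) = [set P (ordS k)]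
    & forall k l, l != k -> l != ordS k -> l != ord_pred k ->
        side P k `&` side P l = set0].

(* The closed region enclosed by the outline: by the Jordan curve theorem the
   complement of the outline of a simple pentagon has exactly one bounded
   component. *)
Definition region P : set (R * R) :=
  outline P `|`
  [set p | ~ outline P p /\ bounded_set (connected_component (~` outline P) p)].

(* The angle inside the region. The sum of the two edge vectors at a vertex
   points strictly inside the sector of angle < pi which they span, so this sum
   tells whether the region lies locally in that sector or in the complementary
   one; when vangle is pi, both branches give pi. *)
Definition interior_angle P (k : 'I_5) : R :=
  let u := P (ordS k) - P k in
  let w := P (ord_pred k) - P k in
  if `[< \forall t \near 0^'+, region P (P k + t *: (u + w)) >]
  then vangle u w else 2 * pi - vangle u w.

Definition perimeter P : R := \sum_(k < 5) eucl_dist (P k) (P (ordS k)).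

(* The inscribed disk lies in the region and its boundary circle meets, hence
   is tangent to, every side. *)
Definition circumscribed P : Prop :=
  exists c r, [/\ 0 < r, disk c r `<=` region P
    & forall k, exists2 p, side P k p & eucl_dist c p = r].

Definition prismatic P : Prop :=
  [/\ simple_pentagon P,
      exists k, [/\ interior_angle P k = pi / 2,
        interior_angle P (ordS k) = pi / 2
      & forall l, l != k -> l != ordS k -> interior_angle P l = 2 * pi / 3]
    & circumscribed P].

End Pentagon.

Section Tiling.
Context {R : realType}.
Implicit Types T : nat -> pentagon R.

(* A plane tiling has countably many tiles, here indexed by nat. *)
Definition tiling T : Prop :=
  [/\ forall i, simple_pentagon (T i),
      \bigcup_i region (T i) = [set: R * R]
    & forall i j, i <> j -> (region (T i))° `&` (region (T j))° = set0].

(* Two tiles may share several edges and vertices if one is not convex, so the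
   condition is put on each common point: it lies on an edge of both tiles or
   is a vertex of both. *)
Definition edge_to_edge T : Prop :=
  forall i j, i <> j -> forall p, region (T i) p -> region (T j) p ->
    (exists k l, side (T i) k = side (T j) l /\ side (T i) k p) \/
    (exists k l, T i k = p /\ T j l = p).

(* Every edge of the tiling occurs here with both orientations. *)
Definition oriented_edges T : set ((R * R) * (R * R)) :=
  [set e | exists i k, e = (T i k, T i (ordS k)) \/ e = (T i (ordS k), T i k)].

(* Total length of the tiling inside the disk of radius r about the origin, an
   edge common to two tiles being counted once. *)
Definition perimeter_in T (r : R) : \bar R :=
  ((2^-1)%:E *
   \esum_(e in oriented_edges T) length_in e.1 e.2 (disk (0, 0)%R r))%E.

Definition perimeter_ratio T : \bar R :=
  limf_esup (fun r : R => (perimeter_in T r * ((pi * r ^+ 2)^-1)%:E)%E)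
    (pinfty_nbhs R).

End Tiling.

(* Main.v *)
(* Call a tile sharp if all its angles lie in ]pi/2, 2pi/3[, and blunt otherwise;
   blunt tiles are not convex. By the isoperimetric inequality for pentagons, a
   sharp tile has perimeter at least 324/85 (the regular pentagon has 3.8119). A
   blunt tile has perimeter at least 4: it has a reflex vertex, which lies in the
   hull of the other four, so that its region is covered twice by the triangles
   spanned by these four points, whose total area is at most an eighth of the
   squared perimeter.
   At most three sharp corners meet at a point, since each contains a closed
   right-angled cone, but three angles less than 2pi/3 do not fill the plane; so
   every vertex of a sharp tile is a vertex of a blunt tile. At a reflex vertex of
   a blunt tile there is at most one sharp corner. Hence the vertices of a blunt
   tile carry at most 4 * 3 + 1 = 13 sharp corners, and the numbers C and E of
   sharp and blunt tiles in a large disk satisfy 5 C <= 13 E up to boundary terms.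
   The mean perimeter is then at least (13 * 324/85 + 5 * 4) / 18 = 2956/765,
   which exceeds 2 sqrt (2 + sqrt 3). *)
Require Import Defs.
From HB Require Import structures.
From mathcomp Require Import all_boot all_order all_algebra.
From mathcomp Require Import all_classical all_reals all_analysis.
From mathcomp Require Import measurable_realfun.
From mathcomp Require Import ring lra.
Set Implicit Arguments.
Unset Strict Implicit.
Unset Printing Implicit Defensive.
Import Order.TTheory GRing.Theory Num.Theory.
Import numFieldNormedType.Exports.
Local Open Scope classical_set_scope.
Local Open Scope ring_scope.

(** * Regions of pentagons *)

Section Plane.
Context {R : realType}.
Implicit Types (p q a : (R * R)%type) (t : R).

(** Two obstacles shape the proof. First, a region is defined by bounded components of the
    complement of the outline, which does not tell on which side of each edge it lies. A sign [s]
    settles this: near every vertex and edge, the side of the outline selected by [s] is wholly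
    inside or wholly outside; the answer propagates around the outline, and a point of the region
    off the outline, supplied by the unit area, leaves exactly one sign for the inside. Second,
    tiles have no common bound on their diameters, and local finiteness is not assumed. Both are
    handled by the very bound to be refuted: if the ratio is eventually at most [c], a tile
    stretching across an annulus spends there a length of at least the width of the annulus up to a
    constant, so that few tiles do. The margin is thin, [2956 / 765 = 3.86405...] against
    [3.86370...], so the isoperimetric constant of the regular pentagon is needed almost exactly. *)

Definition cross p q : R := p.1 * q.2 - p.2 * q.1.

Lemma fstD p q : (p + q).1 = p.1 + q.1. Proof. by []. Qed.
Lemma sndD p q : (p + q).2 = p.2 + q.2. Proof. by []. Qed.
Lemma fstN p : (- p).1 = - p.1. Proof. by []. Qed.
Lemma sndN p : (- p).2 = - p.2. Proof. by []. Qed.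
Lemma fstZ t p : (t *: p).1 = t * p.1. Proof. by []. Qed.
Lemma sndZ t p : (t *: p).2 = t * p.2. Proof. by []. Qed.

Definition coordE := (fstD, sndD, fstN, sndN, fstZ, sndZ).

Lemma eq_pair p q : p.1 = q.1 -> p.2 = q.2 -> p = q.
Proof. by case: p q => ? ? [? ?] /= -> ->. Qed.

Lemma segment_point t p q : 0 <= t <= 1 -> segment p q (p + t *: (q - p)).
Proof. by move=> t01; exists t => //=; rewrite in_itv. Qed.

Lemma segmentP p q x :
  segment p q x <-> exists2 t, 0 <= t <= 1 & x = p + t *: (q - p).
Proof.
split => [[t /= +] <-|[t t01 ->]]; last exact: segment_point.
by rewrite in_itv/= => t01; exists t.
Qed.

Lemma segment_start p q : segment p q p.
Proof. by apply/segmentP; exists 0; rewrite ?scale0r ?addr0 ?lexx ?ler01. Qed.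

Lemma segment_end p q : segment p q q.
Proof.
apply/segmentP; exists 1; rewrite ?lexx ?ler01//.
by rewrite scale1r addrC subrK.
Qed.

Lemma segment_sub p q x y :
  segment p q x -> segment p q y -> segment x y `<=` segment p q.
Proof.
move=> /segmentP[s /andP[s0 s1] ->] /segmentP[t /andP[t0 t1] ->] z.
move=> /segmentP[u /andP[u0 u1] ->].
apply/segmentP; exists (s + u * (t - s)); first by nra.
by apply: eq_pair; rewrite !coordE; ring.
Qed.

Lemma continuous_line p q : continuous (fun t : R => p + t *: q).
Proof.
by move=> t; apply: cvgD; [exact: cvg_cst|apply: cvgZr_tmp; exact: cvg_id].
Qed.

Lemma plane_segment_compact p q : compact (segment p q).
Proof.
apply: continuous_compact; last exact: segment_compact.
by apply: continuous_subspaceT; exact: continuous_line.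
Qed.

Lemma plane_segment_closed p q : closed (segment p q).
Proof. by apply: compact_closed; [exact: norm_hausdorff|exact: plane_segment_compact]. Qed.

Lemma plane_segment_connected p q : connected (segment p q).
Proof.
apply: connected_continuous_connected; first exact: segment_connected.
by apply: continuous_subspaceT; exact: continuous_line.
Qed.

Lemma ball_plane p (e : R) q :
  ball p e q <-> `|p.1 - q.1| < e /\ `|p.2 - q.2| < e.
Proof. by []. Qed.

Lemma conv_norm_lt (a b e t : R) : `|a| < e -> `|b| < e -> 0 <= t <= 1 ->
  `|a + t * (b - a)| < e.
Proof.
move=> ae be /andP[t0 t1].
have -> : a + t * (b - a) = (1 - t) * a + t * b by ring.
rewrite (le_lt_trans (ler_normD _ _))// !normrM ger0_norm ?subr_ge0//.
rewrite [`|t|]ger0_norm//.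
have [->|tn0] := eqVneq t 0; first by rewrite subr0 mul1r mul0r addr0.
have : t * `|b| < t * e by rewrite ltr_pM2l// lt_neqAle eq_sym tn0.
have : (1 - t) * `|a| <= (1 - t) * e by rewrite ler_wpM2l ?subr_ge0// ltW.
lra.
Qed.

Lemma ball_segment p (e : R) x y :
  ball p e x -> ball p e y -> segment x y `<=` ball p e.
Proof.
move=> /ball_plane[x1 x2] /ball_plane[y1 y2] z /segmentP[t /andP[t0 t1] ->].
have t01 : 0 <= t <= 1 by apply/andP.
have h1 := conv_norm_lt x1 y1 t01; have h2 := conv_norm_lt x2 y2 t01.
apply/ball_plane; rewrite !coordE; split.
  by move: h1; congr (`|_| < _); ring.
by move: h2; congr (`|_| < _); ring.
Qed.

Lemma nbhs_plane_ballP p (A : set (R * R)) :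
  nbhs p A <-> exists2 e : R, 0 < e & forall q, ball p e q -> A q.
Proof. by rewrite -nbhs_ballE; split=> [[e e0 h]|[e e0 h]]; exists e. Qed.

Lemma openP_ball (A : set (R * R)) :
  (forall p, A p -> exists2 e : R, 0 < e & forall q, ball p e q -> A q) -> open A.
Proof. by move=> h; rewrite openE => p /h /nbhs_plane_ballP. Qed.

End Plane.

Section Region.
Context {R : realType}.
Implicit Types (P : pentagon R) (p q a : (R * R)%type).

Lemma outline_closed P : closed (outline P).
Proof.
have -> : outline P = \bigcup_(k in [set: 'I_5]) side P k.
  by apply/seteqP; split => [x [k kx]|x [k _ kx]]; exists k.
by apply: closed_bigcup => [|k _]; [exact: finite_finset|exact: plane_segment_closed].
Qed.

Lemma outline_vertex P k : outline P (P k).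
Proof. by exists k; exact: segment_start. Qed.

Lemma outline_region P : outline P `<=` region P.
Proof. by move=> p; left. Qed.

(** A connected set that avoids the outline lies in one component of its complement. *)
Lemma region_connected P (C : set (R * R)) p q : connected C ->
  C `<=` ~` outline P -> C p -> C q -> region P p -> region P q.
Proof.
move=> Cc CP Cp Cq [/(CP p Cp)//|[np bp]]; right; split; first exact: CP.
suff -> : connected_component (~` outline P) q =
  connected_component (~` outline P) p by [].
by apply: same_connected_component; exists C.
Qed.

Lemma region_segment P p q : segment p q `<=` ~` outline P ->
  region P p <-> region P q.
Proof.
move=> pqP; have c := @plane_segment_connected _ p q.
have := segment_start p q; have := segment_end p q.
by split; exact: (region_connected c pqP).
Qed.

Lemma outlineC_ball P p : ~ outline P p ->
  exists2 e : R, 0 < e & ball p e `<=` ~` outline P.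
Proof.
move=> pP; have : nbhs p (~` outline P).
  by apply: open_nbhs_nbhs; split => //; exact/closed_openC/outline_closed.
by move=> /nbhs_plane_ballP.
Qed.

Lemma region_near P p : ~ outline P p -> exists2 e : R, 0 < e &
  forall q, ball p e q -> ~ outline P q /\ (region P p <-> region P q).
Proof.
move=> /outlineC_ball[e e0 eP]; exists e => // q peq; split; first exact: eP.
apply: region_segment => x pqx; apply: eP.
by move: x pqx; apply: ball_segment => //; exact: ballxx.
Qed.

Lemma region_closed P : closed (region P).
Proof.
rewrite -(setCK (region P)); apply: open_closedC; apply: openP_ball => p pP.
have /region_near[e e0 eP] : ~ outline P p by move=> /outline_region.
by exists e => // q /eP[_ [_ qp]] /qp.
Qed.

Lemma region_inner_open P : open (region P `\` outline P).
Proof.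
apply: openP_ball => p [rp /region_near[e e0 eP]].
by exists e => // q /eP[oq [rq _]]; split => //; exact: rq.
Qed.

Lemma dot_outline P a (c : R) : (forall k, dot a (P k) <= c) ->
  forall p, outline P p -> dot a p <= c.
Proof.
move=> h p [k /segmentP[t /andP[t0 t1] ->]].
have := h k; have := h (ordS k); rewrite /dot !coordE; nra.
Qed.

(** Beyond the half-plane, the ray from [p] in the direction [a] avoids the outline, so the
    component of [p] is unbounded. *)
Lemma region_halfplane P a (c : R) : (forall k, dot a (P k) <= c) ->
  forall p, region P p -> dot a p <= c.
Proof.
move=> h p rp; rewrite leNgt; apply/negP => cp.
case: (rp) => [/(dot_outline h)|[_ [M [Mr Mb]]]]; first by rewrite leNgt cp.
have a0 : 0 < dot a a.
  have: a != 0.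
    apply/eqP => a0; move: cp (h ord0).
    by rewrite a0 /dot/= !mul0r addr0 leNgt => ->.
  rewrite /dot -!expr2; move: a {h cp} => [x y]/= xy.
  rewrite lt_neqAle addr_ge0 ?sqr_ge0// andbT eq_sym paddr_eq0 ?sqr_ge0//.
  by rewrite !sqrf_eq0; apply: contra xy => /andP[/eqP-> /eqP->].
have comp t : 0 <= t -> connected_component (~` outline P) p (p + t *: a).
  move=> t0; exists (segment p (p + t *: a)); last exact: segment_end.
  split; [exact: segment_start| |exact: plane_segment_connected].
  move=> x /segmentP[s /andP[s0 s1] ->] /(dot_outline h); apply/negP.
  rewrite -ltNge (lt_le_trans cp)//.
  have -> : dot a (p + s *: (p + t *: a - p)) = dot a p + s * t * dot a a.
    by rewrite /dot !coordE; ring.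
  by rewrite lerDl !mulr_ge0 ?(ltW a0).
(* [bounded_set] provides a bound for numbers strictly greater than [M] only. *)
pose M' := `|M| + 1.
have MM' : M < M' by rewrite /M' (le_lt_trans (ler_norm _))// ltrDl.
have bd t : 0 <= t -> dot a (p + t *: a) <= (`|a.1| + `|a.2|) * M'.
  move=> /comp /(Mb _ MM') /=; rewrite /Num.norm/= ge_max => /andP[h1 h2].
  rewrite /dot mulrDl; apply: lerD.
    by rewrite (le_trans (ler_norm _))// normrM ler_wpM2l.
  by rewrite (le_trans (ler_norm _))// normrM ler_wpM2l.
have bdE t : dot a (p + t *: a) = dot a p + t * dot a a.
  by rewrite /dot !coordE; ring.
set B := _ * M' in bd.
have := bd (`|B - dot a p| / dot a a + 1); rewrite bdE mulrDl mul1r mulfVK ?gt_eqF//.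
have /[swap]/[apply] : 0 <= `|B - dot a p| / dot a a + 1.
  by rewrite addr_ge0// divr_ge0// ltW.
have := ler_norm (B - dot a p); lra.
Qed.

End Region.

(** * Local structure of a simple pentagon *)

Section Cyclic.

Lemma val_iter_ordS n m (k : 'I_n) : iter m (@ordS n) k = ((k + m) %% n)%N :> nat.
Proof.
elim: m => [|m IH] /=; first by rewrite addn0 modn_small.
by rewrite IH -[in LHS]addn1 modnDml addn1 addnS.
Qed.

Lemma ordS_ind n (Q : 'I_n -> Prop) :
  (forall k, Q k -> Q (ordS k)) -> forall k l, Q k -> Q l.
Proof.
move=> QS k l Qk; have -> : l = iter (l + (n - k))%N (@ordS n) k.
  apply: ord_inj; rewrite val_iter_ordS addnCA subnKC ?(ltnW (ltn_ord k))//.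
  by rewrite modnDr modn_small.
by elim: (_ + _)%N => //= m; exact: QS.
Qed.

Lemma ordS_neq (k : 'I_5) : ordS k != k.
Proof. by case: k => [[|[|[|[|[|k]]]]] hk]. Qed.

Lemma ordSS_neq (k : 'I_5) : ordS (ordS k) != k.
Proof. by case: k => [[|[|[|[|[|k]]]]] hk]. Qed.

End Cyclic.

Section Interval.
Context {R : realType}.

(** On the interval, [A] coincides with the closed complement of [B], hence is both open and closed
    there, and the interval is connected. *)
Lemma interval_open_cover (A B : set R) (a b : R) : open A -> open B ->
  a <= b -> (forall t, a <= t <= b -> A t \/ B t) -> (forall t, A t -> ~ B t) ->
  (A a <-> A b).
Proof.
move=> oA oB ab cov dis.
have E : A a \/ A b -> `[a, b]%classic `&` A = `[a, b]%classic.
  move=> Aab; apply: (@segment_connected _ a b).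
  - by case: Aab => ?; [exists a|exists b]; split=> //=; rewrite in_itv/= lexx ab.
  - by exists A.
  - exists (~` B); first exact: open_closedC.
    apply/seteqP; split=> [t [tab At]|t [tab Bt]]; first by split=> //; exact: dis.
    split=> //; move: tab; rewrite /= in_itv/= => /cov[]//.
have h x : a <= x <= b -> A a \/ A b -> A x.
  move=> abx /E /seteqP[_ /(_ x)]/=; rewrite in_itv/= => /(_ abx)[]//.
by split=> ?; apply: h; rewrite ?lexx ?ab; auto.
Qed.

End Interval.

Section Local.
Context {R : realType}.
Implicit Types (P : pentagon R) (p q v x y : (R * R)%type) (s t : R) (k l : 'I_5).

Lemma ball_small v (e : R) : 0 < e ->
  exists2 d : R, 0 < d & forall t p, `|t| < d -> ball p e (p + t *: v).
Proof.
move=> e0; pose M := `|v.1| + `|v.2| + 1.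
have M0 : 0 < M by rewrite /M ltr_wpDl ?addr_ge0.
exists (e / M) => [|t p]; first exact: divr_gt0.
rewrite ltr_pdivlMr// => tM; apply/ball_plane; rewrite !coordE !opprD !addrA.
rewrite !subrr !sub0r !normrN !normrM.
by split; rewrite (le_lt_trans _ tM)// ler_wpM2l// /M;
  have := normr_ge0 v.1; have := normr_ge0 v.2; lra.
Qed.

(** Converse of [ball_small]: a point near [p] on a line through [p] has a small parameter. This
    keeps points found on the line of an edge within the edge itself. *)
Lemma ball_scale_lt v (c : R) : v != 0 -> 0 < c -> exists2 e : R, 0 < e &
  forall p q t, ball p e q -> q - p = t *: v -> `|t| < c.
Proof.
move=> v0 c0; pose n := Num.max `|v.1| `|v.2|.
have n0 : 0 < n.
  rewrite /n lt_max !normr_gt0 -negb_and; apply: contra v0.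
  by move=> /andP[/eqP v1 /eqP v2]; apply/eqP/eq_pair.
exists (c * n) => [|p q t /ball_sym /ball_plane[h1 h2] E]; first exact: mulr_gt0.
have q1 : q.1 - p.1 = t * v.1 by have := congr1 fst E.
have q2 : q.2 - p.2 = t * v.2 by have := congr1 snd E.
rewrite -(ltr_pM2r n0) {1}/n maxr_pMr// gt_max -!normrM -q1 -q2.
by apply/andP.
Qed.

Lemma dot_gt0 v : v != 0 -> 0 < dot v v.
Proof.
move: v => [x y] xy; rewrite /dot/= -!expr2.
rewrite lt_neqAle addr_ge0 ?sqr_ge0// andbT eq_sym paddr_eq0 ?sqr_ge0//.
by rewrite !sqrf_eq0; apply: contra xy => /andP[/eqP-> /eqP->].
Qed.

Lemma cross_eq0 v p : v != 0 -> cross v p = 0 ->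
  p = (dot v p / dot v v) *: v.
Proof.
move=> /dot_gt0 v0 c; have vv : dot v v != 0 by rewrite gt_eqF.
have e1 : dot v p * v.1 = p.1 * dot v v + v.2 * cross v p.
  by rewrite /dot /cross; ring.
have e2 : dot v p * v.2 = p.2 * dot v v - v.1 * cross v p.
  by rewrite /dot /cross; ring.
rewrite c mulr0 addr0 in e1; rewrite c mulr0 subr0 in e2.
by apply: eq_pair; rewrite !coordE mulrAC ?e1 ?e2 mulfK.
Qed.

(** The cross products of [v] and of [p] with [p - v] both equal [cross v p], so [p - v] or its
    opposite will do when the vectors are not parallel. Parallel vectors point the same way, and a
    common normal will do. *)
Lemma both_left s v p : s * s = 1 -> v != 0 -> p != 0 ->
  (cross v p = 0 -> 0 < dot v p) ->
  exists d, 0 < s * cross v d /\ 0 < s * cross p d.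
Proof.
move=> ss v0 p0 h; have [c|c|c] := ltrgt0P (s * cross v p).
- exists (p - v); suff [-> ->] : s * cross v (p - v) = s * cross v p /\
    s * cross p (p - v) = s * cross v p by [].
  by split; rewrite /cross !coordE; ring.
- exists (v - p); suff [-> ->] : s * cross v (v - p) = - (s * cross v p) /\
    s * cross p (v - p) = - (s * cross v p) by rewrite oppr_gt0.
  by split; rewrite /cross !coordE; ring.
- have {}c : cross v p = 0.
    by move/eqP: c; rewrite mulf_eq0 => /orP[/eqP s0|/eqP//]; move: ss; rewrite s0; lra.
  exists (- (s * v.2), s * v.1).
  have -> : s * cross v (- (s * v.2), s * v.1) = s * s * dot v v.
    by rewrite /cross /dot/=; ring.
  have -> : s * cross p (- (s * v.2), s * v.1) = s * s * dot v p.
    by rewrite /cross /dot/=; ring.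
  by rewrite ss !mul1r; split; [exact: dot_gt0|exact: h].
Qed.

Section Simple.
Variable P : pentagon R.
Hypothesis simpleP : simple_pentagon P.

Definition edge k := P (ordS k) - P k.

Lemma edge_pred k : edge (ord_pred k) = P k - P (ord_pred k).
Proof. by rewrite /edge ord_predK. Qed.

Lemma edge_neq0 k : edge k != 0.
Proof.
case: simpleP => inj _ _; rewrite subr_eq0; apply/eqP => /inj /eqP.
by rewrite (negbTE (ordS_neq k)).
Qed.

Lemma vertex_side k l : side P l (P k) -> l = k \/ ordS l = k.
Proof.
case: simpleP => inj _ dis lk; have [->|lk1] := eqVneq l k; first by left.
have [->|lk2] := eqVneq (ordS l) k; first by right.
have kp : l != ord_pred k by apply: contra lk2 => /eqP->; rewrite ord_predK.
exfalso; have [lS|lS] := eqVneq l (ordS k).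
  have : (side P (ord_pred k) `&` side P l) (P k).
    by split => //; rewrite /side ord_predK; exact: segment_end.
  by rewrite dis ?lS ?ordSS_neq// ?ord_predK ?ordS_neq//;
     case: (k) => [[|[|[|[|[|?]]]]] ?].
have : (side P k `&` side P l) (P k) by split => //; exact: segment_start.
by rewrite dis.
Qed.

(** If the second edge folded back over the first, the two sides would overlap beyond their common
    vertex. Straight corners, however, may occur. *)
Lemma no_fold k : cross (edge (ord_pred k)) (edge k) = 0 ->
  0 < dot (edge (ord_pred k)) (edge k).
Proof.
move=> c; rewrite ltNge; apply/negP => d.
have e0 := edge_neq0 (ord_pred k); have ee := dot_gt0 e0.
have := cross_eq0 e0 c; set m := _ / _ => E.
have m0 : m <= 0 by rewrite /m pmulr_lle0 ?invr_gt0.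
have m1 : 0 < 1 - m by lra.
case: simpleP => _ /(_ (ord_pred k)) + _; rewrite ord_predK => adj.
(* As [m <= 0], both [1 / (1 - m)] and [- m / (1 - m)] are at most 1, which keeps the point within
   both sides. *)
have : (side P (ord_pred k) `&` side P k) (P k + (1 - m)^-1 *: edge k).
  split; apply/segmentP.
    exists (1 + m / (1 - m)).
      have : 0 <= - m / (1 - m) <= 1.
        by rewrite divr_ge0 ?oppr_ge0 ?(ltW m1)//= ler_pdivrMr ?mul1r; lra.
      by rewrite mulNr; lra.
    rewrite E edge_pred ord_predK.
    by apply: eq_pair; rewrite !coordE; field; lra.
  by exists (1 - m)^-1; rewrite ?invr_ge0 ?(ltW m1)//= invf_le1//; lra.
rewrite adj /= -[X in _ = X]addr0 => /addrI /eqP; rewrite scaler_eq0.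
by rewrite invr_eq0 gt_eqF//= (negbTE (edge_neq0 k)).
Qed.

(** When the region is on the [s] side of the edges (left for 1, right for -1), this is positive at
    convex corners, negative at reflex ones and zero at straight ones. *)
Definition corner s k := s * cross (edge (ord_pred k)) (edge k).

(** The [s] side of the outline around [P k]: the half-planes of the two edges intersect at a convex
    corner and unite at a reflex one; at a straight corner they coincide. *)
Definition sector s k q :=
  if 0 < corner s k
  then (0 < s * cross (edge (ord_pred k)) (q - P k)) &&
       (0 < s * cross (edge k) (q - P k))
  else (0 < s * cross (edge (ord_pred k)) (q - P k)) ||
       (0 < s * cross (edge k) (q - P k)).

(** [D] is the region or its complement, so that one propagation argument serves both. *)
Definition corner_side (D : set (R * R)) s k := exists2 e : R, 0 < e &
  forall q, ball (P k) e q -> sector s k q -> ~ outline P q /\ D q.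
Definition edge_side (D : set (R * R)) s k x := exists2 e : R, 0 < e &
  forall q, ball x e q -> 0 < s * cross (edge k) (q - P k) ->
    ~ outline P q /\ D q.

Notation corner_in := (corner_side (region P)).
Notation corner_out := (corner_side (~` region P)).
Notation edge_in := (edge_side (region P)).
Notation edge_out := (edge_side (~` region P)).

Lemma sides_near x : exists2 e : R, 0 < e &
  forall q l, ball x e q -> side P l q -> side P l x.
Proof.
suff : nbhs x [set q | forall l, side P l q -> side P l x].
  by move=> /nbhs_ballP[e e0 h]; exists e => // q l /h; exact.
apply: (@filter_forall _ _ (fun l => [set q | side P l q -> side P l x]) _
  (nbhs_filter x)) => l.
have [lx|lx] := pselect (side P l x).
  by apply: filterS filterT => q _ _.
have : nbhs x (~` side P l).
  by apply: open_nbhs_nbhs; split => //; exact/closed_openC/plane_segment_closed.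
by apply: filterS => q lq /lq.
Qed.

Lemma halfball_region x e v y p q :
  (forall q, ball x e q -> 0 < cross v (q - y) -> ~ outline P q) ->
  ball x e p -> 0 < cross v (p - y) -> ball x e q -> 0 < cross v (q - y) ->
  region P p <-> region P q.
Proof.
move=> h xp p0 xq q0; apply: region_segment => z pqz; apply: h.
  by move: z pqz; exact: ball_segment.
case/segmentP: pqz => t /andP[t0 t1] ->.
have -> : cross v (p + t *: (q - p) - y) =
  (1 - t) * cross v (p - y) + t * cross v (q - y).
  by rewrite /cross !coordE; ring.
have [->|tn0] := eqVneq t 0; first by rewrite subr0 mul1r mul0r addr0.
have h1 : 0 <= (1 - t) * cross v (p - y) by apply: mulr_ge0; [lra|exact: ltW].
have h2 : 0 < t * cross v (q - y) by rewrite mulr_gt0// lt_neqAle eq_sym tn0.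
lra.
Qed.

Lemma crossZl s v p : cross (s *: v) p = s * cross v p.
Proof. by rewrite /cross !coordE; ring. Qed.

Lemma side_cross k q : side P k q -> cross (edge k) (q - P k) = 0.
Proof.
by move=> /segmentP[t _ ->]; rewrite /cross /edge !coordE; ring.
Qed.

Lemma edge_param_side k t l : 0 < t < 1 -> side P l (P k + t *: edge k) -> l = k.
Proof.
case: simpleP => inj adj dis /andP[t0 t1] lx; apply/eqP; apply/negPn/negP => lk.
have kx : side P k (P k + t *: edge k) by apply: segment_point; rewrite !ltW.
have e0 := edge_neq0 k.
have [lS|lS] := eqVneq l (ordS k).
  have : (side P k `&` side P (ordS k)) (P k + t *: edge k) by rewrite -lS.
  rewrite adj /= => /eqP; rewrite -subr_eq0.
  have -> : P k + t *: edge k - P (ordS k) = (t - 1) *: edge k.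
    by apply: eq_pair; rewrite /edge !coordE; ring.
  by rewrite scaler_eq0 (negbTE e0) orbF subr_eq0 lt_eqF.
have [lp|lp] := eqVneq l (ord_pred k).
  have : (side P l `&` side P (ordS l)) (P k + t *: edge k).
    by rewrite lp ord_predK -lp.
  rewrite adj lp ord_predK /= -[X in _ = X]addr0 => /addrI /eqP.
  by rewrite scaler_eq0 (negbTE e0) orbF gt_eqF.
have : (side P k `&` side P l) (P k + t *: edge k) by split.
by rewrite dis.
Qed.

(** A small half-ball at an inner point of an edge is convex and misses the outline. *)
Lemma edge_in_or_out s k t : 0 < t < 1 ->
  edge_in s k (P k + t *: edge k) \/ edge_out s k (P k + t *: edge k).
Proof.
move=> t01; set x := P k + _; have [e e0 h] := sides_near x.
have no q : ball x e q -> 0 < s * cross (edge k) (q - P k) -> ~ outline P q.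
  move=> xq sq [l lq]; have /(edge_param_side t01) lk := h _ _ xq lq.
  by move: sq; rewrite side_cross ?mulr0 ?ltxx// -lk.
have same p q : ball x e p -> 0 < s * cross (edge k) (p - P k) ->
    ball x e q -> 0 < s * cross (edge k) (q - P k) -> region P p <-> region P q.
  rewrite -!crossZl; apply: halfball_region => z xz; rewrite crossZl; exact: no.
have [[p [xp sp rp]]|np] := pselect (exists p,
    [/\ ball x e p, 0 < s * cross (edge k) (p - P k) & region P p]).
  by left; exists e => // q xq sq; split; [exact: no|apply/(same p q)].
right; exists e => // q xq sq; split; first exact: no.
by move=> rq; apply: np; exists q.
Qed.

Lemma edge_side_point s k t (e : R) : s * s = 1 -> 0 < e -> exists2 q,
  ball (P k + t *: edge k) e q & 0 < s * cross (edge k) (q - P k).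
Proof.
move=> ss e0; have k0 := edge_neq0 k.
have [d0 h0] := ball_small (- (s * (edge k).2), s * (edge k).1) e0.
set v := (_, _) in h0 * => h.
exists (P k + t *: edge k + (d0 / 2) *: v).
  by apply: h; rewrite ger0_norm; lra.
have -> : s * cross (edge k) (P k + t *: edge k + (d0 / 2) *: v - P k) =
   s * s * (d0 / 2 * dot (edge k) (edge k)).
  by rewrite /cross /dot /v !coordE /=; ring.
by rewrite ss mul1r mulr_gt0 ?dot_gt0//; lra.
Qed.

Lemma edge_in_out s k t : s * s = 1 ->
  edge_in s k (P k + t *: edge k) -> ~ edge_out s k (P k + t *: edge k).
Proof.
move=> ss [e e0 h] [e' e'0 h'].
have m0 : 0 < Num.min e e' by rewrite lt_min e0.
have [q xq sq] := edge_side_point k t ss m0.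
have [_ rq] : ~ outline P q /\ region P q.
  by apply: h => //; apply: le_ball xq; rewrite ge_min lexx.
have [_ /(_ rq)//] : ~ outline P q /\ ~ region P q.
by apply: h' => //; apply: le_ball xq; rewrite ge_min lexx orbT.
Qed.

(** Being inside and being outside are open conditions on the parameter along the open edge, which
    exclude each other and leave nothing out; the open edge is connected. *)
Lemma edge_in_const s k t t' : s * s = 1 -> 0 < t < 1 -> 0 < t' < 1 ->
  edge_in s k (P k + t *: edge k) -> edge_in s k (P k + t' *: edge k).
Proof.
move=> ss.
have op D : open [set u | 0 < u < 1 /\ edge_side D s k (P k + u *: edge k)].
  rewrite openE => u /= [/andP[u0 u1] [e e0 h]].
  have e20 : 0 < e / 2 by lra.
  have [d d0 hd] := ball_small (edge k) e20.
  apply/nbhs_ballP; exists (Num.min d (Num.min u (1 - u))).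
    by rewrite /= !lt_min d0 u0 subr_gt0.
  move=> w /=; rewrite /ball/= !lt_min !ltr_norml => /and3P[wd wu w1].
  split; first by lra.
  exists (e / 2) => // q wq; apply: h; rewrite (splitr e).
  apply: ball_triangle wq.
  have -> : P k + w *: edge k = P k + u *: edge k + (w - u) *: edge k.
    by apply: eq_pair; rewrite !coordE; ring.
  by apply: hd; rewrite distrC ltr_norml.
have main a b : 0 < a -> b < 1 -> a <= b ->
    edge_in s k (P k + a *: edge k) <-> edge_in s k (P k + b *: edge k).
  move=> a0 b1 ab.
  have h : [set u | 0 < u < 1 /\ edge_in s k (P k + u *: edge k)] a <->
      [set u | 0 < u < 1 /\ edge_in s k (P k + u *: edge k)] b.
    apply: (interval_open_cover (op _) (op (~` region P)) ab).
    - move=> u /andP[au ub]; have u01 : 0 < u < 1 by lra.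
      by have [] := edge_in_or_out s k u01; [left|right].
    - by move=> u [_ ui] [_]; apply: edge_in_out.
  case: h => h1 h2; split => h; [have [//|_] := h1 _|have [//|_] := h2 _] => //;
    by split=> //; lra.
move=> /andP[t0 t1] /andP[t'0 t'1].
by have [tt|/ltW tt] := leP t t'; [have [] := main t t'|have [] := main t' t];
  rewrite ?tt//; auto.
Qed.

Lemma left_dir s k : s * s = 1 -> exists d,
  0 < s * cross (edge (ord_pred k)) d /\ 0 < s * cross (edge k) d.
Proof.
by move=> ss; apply: both_left => //; [exact: edge_neq0|exact: edge_neq0|exact: no_fold].
Qed.

(** Within the ball, the sector is convex at a convex corner; otherwise it is the union of two
    half-balls that share the point [m]. *)
Lemma corner_region s k e p q : s * s = 1 ->
  (forall q, ball (P k) e q -> sector s k q -> ~ outline P q) ->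
  ball (P k) e p -> sector s k p -> ball (P k) e q -> sector s k q ->
  region P p <-> region P q.
Proof.
move=> ss no.
have hb v : (forall q, 0 < cross v (q - P k) -> sector s k q) ->
    forall p q, ball (P k) e p -> 0 < cross v (p - P k) ->
    ball (P k) e q -> 0 < cross v (q - P k) -> region P p <-> region P q.
  move=> h p' q' xp hp xq hq; apply: (halfball_region _ xp hp xq hq).
  by move=> z xz hz; apply: no => //; exact: h.
rewrite /sector; case: ifPn => c.
  move=> xp /andP[p1 p2] xq /andP[q1 q2]; apply: region_segment => z pqz.
  apply: no; first by move: z pqz; exact: ball_segment.
  rewrite /sector c; case/segmentP: pqz => t t01 ->.
  have cv v : cross v (p + t *: (q - p) - P k) =
    (1 - t) * cross v (p - P k) + t * cross v (q - P k).
    by rewrite /cross !coordE; ring.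
  have pos (a b : R) : 0 < s * a -> 0 < s * b ->
      0 < s * ((1 - t) * a + t * b).
    move=> a0 b0; case/andP: t01 => t0 t1.
    have -> : s * ((1 - t) * a + t * b) = (1 - t) * (s * a) + t * (s * b) by ring.
    have [->|tn0] := eqVneq t 0; first by rewrite subr0 mul1r mul0r addr0.
    have h1 : 0 <= (1 - t) * (s * a) by rewrite mulr_ge0 ?subr_ge0// ltW.
    have h2 : 0 < t * (s * b) by rewrite mulr_gt0// lt_neqAle eq_sym tn0.
    lra.
  by rewrite !cv !pos.
have [d [d1 d2]] := left_dir k ss.
move=> xp hp xq hq.
have e0 : 0 < e.
  by case/ball_plane: xp => h _; apply: le_lt_trans h.
have [u u0 hu] := ball_small d e0.
pose m := P k + (u / 2) *: d.
have xm : ball (P k) e m by apply: hu; rewrite ger0_norm; lra.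
have cm v : s * cross v (m - P k) = (u / 2) * (s * cross v d).
  by rewrite /cross /m !coordE; ring.
have u20 : 0 < u / 2 by lra.
have m1 : 0 < cross (s *: edge (ord_pred k)) (m - P k).
  by rewrite crossZl cm mulr_gt0.
have m2 : 0 < cross (s *: edge k) (m - P k) by rewrite crossZl cm mulr_gt0.
have h1 := hb (s *: edge (ord_pred k)); have h2 := hb (s *: edge k).
have {}h1 := h1 _; have {}h2 := h2 _.
suff st z : ball (P k) e z -> (0 < s * cross (edge (ord_pred k)) (z - P k)) ||
    (0 < s * cross (edge k) (z - P k)) -> region P z <-> region P m.
  by apply: (iff_trans (st _ xp hp)); apply: iff_sym; exact: st.
move=> xz /orP[z1|z2].
- apply: h1 => //; last by rewrite crossZl.
  by move=> z' z1'; rewrite /sector (negbTE c) -crossZl z1'.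
- apply: h2 => //; last by rewrite crossZl.
  by move=> z' z1'; rewrite /sector (negbTE c) -(crossZl _ (edge k)) z1' orbT.
Qed.

Lemma sector_side s k q l : s * s = 1 -> l = k \/ ordS l = k -> side P l q ->
  ~ sector s k q.
Proof.
move=> ss lk lq.
have {lk lq} : (exists2 t, 0 <= t & q - P k = t *: edge k) \/
    (exists2 t, 0 <= t & q - P k = - t *: edge (ord_pred k)).
  case: lk lq => [-> /segmentP[t /andP[t0 t1] ->]|lk /segmentP[t /andP[t0 t1] ->]].
    by left; exists t => //; rewrite addrC addKr.
  right; exists (1 - t); first by rewrite subr_ge0.
  have -> : l = ord_pred k by rewrite -lk ordSK.
  by rewrite edge_pred ord_predK; apply: eq_pair; rewrite !coordE; ring.
have cE : corner s k = s * cross (edge (ord_pred k)) (edge k) by [].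
have c0 v : cross v v = 0 :> R by rewrite /cross; ring.
have cr v t w : s * cross v (t *: w) = t * (s * cross v w).
  by rewrite /cross !coordE; ring.
rewrite /sector; case=> -[t t0 ->]; rewrite !cr !c0 !mulr0 ltxx.
  rewrite -cE; case: ifPn; rewrite ?andbF ?orbF// -leNgt => c.
  by apply/negP; rewrite -leNgt mulr_ge0_le0.
have -> : s * cross (edge k) (edge (ord_pred k)) = - corner s k.
  by rewrite /corner /cross; ring.
case: ifPn => //=; rewrite -leNgt => c; apply/negP.
by rewrite -leNgt mulNr mulrN opprK mulr_ge0_le0.
Qed.

Lemma corner_in_or_out s k : s * s = 1 -> corner_in s k \/ corner_out s k.
Proof.
move=> ss; have [e e0 h] := sides_near (P k).
have no q : ball (P k) e q -> sector s k q -> ~ outline P q.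
  move=> xq sq [l lq]; have /vertex_side lk := h _ _ xq lq.
  exact: (sector_side ss lk lq).
have [[p [xp sp rp]]|np] := pselect (exists p,
    [/\ ball (P k) e p, sector s k p & region P p]).
  left; exists e => // q xq sq; split; [exact: no|].
  by rewrite -(corner_region ss no xp sp xq sq).
right; exists e => // q xq sq; split; first exact: no.
by move=> rq; apply: np; exists q.
Qed.

(* A point [P k + t (edge k) + u d] with [d] to the left of both edges at [P k]
   lies both in the sector at [P k] and on the left of the edge. *)
Lemma corner_edge D s k : s * s = 1 -> corner_side D s k ->
  (exists2 t, 0 < t < 1 & forall e : R, 0 < e -> exists q,
     [/\ ball (P k + t *: edge k) e q, 0 < s * cross (edge k) (q - P k) & D q]) /\
  (exists2 t, 0 < t < 1 & forall e : R, 0 < e -> exists q,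
     [/\ ball (P (ord_pred k) + t *: edge (ord_pred k)) e q,
         0 < s * cross (edge (ord_pred k)) (q - P (ord_pred k)) & D q]).
Proof.
move=> ss [e e0 h]; have [d [d1 d2]] := left_dir k ss.
have e20 : 0 < e / 2 by lra.
split.
  have [u u0 hu] := ball_small (edge k) e20.
  pose t := Num.min (u / 2) 2^-1.
  have tu : t <= u / 2 by rewrite /t ge_min lexx.
  have th : t <= 2^-1 by rewrite /t ge_min lexx orbT.
  have t0 : 0 < t by rewrite /t lt_min; apply/andP; split; lra.
  exists t; first by lra.
  move=> e' e'0.
  have m0 : 0 < Num.min (e / 2) e' by rewrite lt_min e20.
  have [w w0 hw] := ball_small d m0.
  have wd : `|w / 2| < w by rewrite ger0_norm; lra.
  have w20 : 0 < w / 2 by lra.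
  pose q := P k + t *: edge k + (w / 2) *: d.
  have c2 : s * cross (edge k) (q - P k) = w / 2 * (s * cross (edge k) d).
    by rewrite /cross /q !coordE; ring.
  have c1 : s * cross (edge (ord_pred k)) (q - P k) =
      t * corner s k + w / 2 * (s * cross (edge (ord_pred k)) d).
    by rewrite /corner /cross /q !coordE; ring.
  exists q; split.
  - by apply: le_ball (hw _ _ wd); rewrite ge_min lexx orbT.
  - by rewrite c2 mulr_gt0.
  - suff : ~ outline P q /\ D q by case.
    apply: h.
      rewrite (splitr e); apply: ball_triangle (hu t _ _) _.
        by rewrite ger0_norm ?(ltW t0)//; lra.
      by apply: le_ball (hw _ _ wd); rewrite ge_min lexx.
    rewrite /sector c1 c2; case: ifPn => c; last by rewrite (mulr_gt0 w20 d2) orbT.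
    rewrite (mulr_gt0 w20 d2) andbT.
    by apply: addr_gt0; apply: mulr_gt0.
have [u u0 hu] := ball_small (edge (ord_pred k)) e20.
pose t := Num.min (u / 2) 2^-1.
have tu : t <= u / 2 by rewrite /t ge_min lexx.
have th : t <= 2^-1 by rewrite /t ge_min lexx orbT.
have t0 : 0 < t by rewrite /t lt_min; apply/andP; split; lra.
exists (1 - t); first by lra.
move=> e' e'0.
have -> : P (ord_pred k) + (1 - t) *: edge (ord_pred k) =
    P k + (- t) *: edge (ord_pred k).
  by rewrite edge_pred; apply: eq_pair; rewrite !coordE; ring.
have m0 : 0 < Num.min (e / 2) e' by rewrite lt_min e20.
have [w w0 hw] := ball_small d m0.
have wd : `|w / 2| < w by rewrite ger0_norm; lra.
have w20 : 0 < w / 2 by lra.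
pose q := P k + (- t) *: edge (ord_pred k) + (w / 2) *: d.
have c1 : s * cross (edge (ord_pred k)) (q - P k) =
    w / 2 * (s * cross (edge (ord_pred k)) d).
  by rewrite /cross /q !coordE; ring.
have c2 : s * cross (edge k) (q - P k) =
    t * corner s k + w / 2 * (s * cross (edge k) d).
  by rewrite /corner /cross /q !coordE; ring.
exists q; split.
- by apply: le_ball (hw _ _ wd); rewrite ge_min lexx orbT.
- have -> : s * cross (edge (ord_pred k)) (q - P (ord_pred k)) =
      s * cross (edge (ord_pred k)) (q - P k).
    by rewrite edge_pred /cross !coordE; ring.
  by rewrite c1 mulr_gt0.
- suff : ~ outline P q /\ D q by case.
  apply: h.
    rewrite (splitr e); apply: ball_triangle (hu (- t) _ _) _.
      by rewrite normrN ger0_norm ?(ltW t0)//; lra.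
    by apply: le_ball (hw _ _ wd); rewrite ge_min lexx.
  rewrite /sector c1 c2; case: ifPn => c; last by rewrite (mulr_gt0 w20 d1).
  rewrite (mulr_gt0 w20 d1) /=.
  by apply: addr_gt0; apply: mulr_gt0.
Qed.

Lemma half01 : 0 < (2^-1 : R) < 1. Proof. lra. Qed.

Lemma corner_in_edge s k t : s * s = 1 -> 0 < t < 1 ->
  (corner_in s k -> edge_in s k (P k + t *: edge k)) /\
  (corner_out s k -> ~ edge_in s k (P k + t *: edge k)).
Proof.
move=> ss t01; split=> hin.
  have [[u u01 hu] _] := corner_edge ss hin.
  apply: (edge_in_const ss u01 t01).
  have [//|[e e0 he]] := edge_in_or_out s k u01.
  by have [q [q1 q2 q3]] := hu e e0; have [_ /(_ q3)] := he q q1 q2.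
move=> ein; have [[u u01 hu] _] := corner_edge ss hin.
have [e e0 he] := edge_in_const ss t01 u01 ein.
by have [q [q1 q2 q3]] := hu e e0; have [_ /q3] := he q q1 q2.
Qed.

Lemma edge_in_next s k t : s * s = 1 -> 0 < t < 1 ->
  edge_in s k (P k + t *: edge k) -> corner_in s (ordS k).
Proof.
move=> ss t01 ein; have [//|hout] := corner_in_or_out (ordS k) ss.
have [_ [u u01]] := corner_edge ss hout; rewrite ordSK => hu.
have [e e0 he] := edge_in_const ss t01 u01 ein.
by have [q [q1 q2 q3]] := hu e e0; have [_ /q3] := he q q1 q2.
Qed.

Lemma corner_in_next s k : s * s = 1 -> corner_in s k -> corner_in s (ordS k).
Proof.
move=> ss hin; apply: (edge_in_next ss half01).
by have [+ _] := corner_in_edge k ss half01; exact.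
Qed.

(** Lying in the region is passed on from the sector at a vertex to the next edge, then to the next
    vertex, hence all around. *)
Lemma corner_in_all s : s * s = 1 ->
  (forall k, corner_in s k) \/ (forall k, corner_out s k).
Proof.
move=> ss; have [h|h] := pselect (exists k, corner_in s k).
  left=> k; case: h => l; apply: ordS_ind => i; exact: corner_in_next.
right=> k; have [hin|//] := corner_in_or_out k ss.
by exfalso; apply: h; exists k.
Qed.

(** A point in neither sector lies on one of the two rays from [P k] that carry its edges; close to
    [P k], it lies on the edge itself. *)
Lemma sector_cover k : exists2 e : R, 0 < e & forall q, ball (P k) e q ->
  ~ outline P q -> sector 1 k q \/ sector (-1) k q.
Proof.
have e10 := edge_neq0 k; have e20 := edge_neq0 (ord_pred k).
have [n1 n10 small1] := ball_scale_lt e10 ltr01.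
have [n2 n20 small2] := ball_scale_lt e20 ltr01.
exists (Num.min n1 n2) => [|q xq oq]; first by rewrite lt_min n10.
have b1 : ball (P k) n1 q by apply: le_ball xq; rewrite ge_min lexx.
have b2 : ball (P k) n2 q by apply: le_ball xq; rewrite ge_min lexx orbT.
have on1 t : 0 <= t -> q - P k = t *: edge k -> False.
  move=> t0 E; apply: oq; exists k; apply/segmentP; exists t.
    by rewrite t0 /=; have := small1 _ _ _ b1 E; rewrite ger0_norm// => /ltW.
  by rewrite -/(edge k) -E addrC subrK.
have on2 t : t <= 0 -> q - P k = t *: edge (ord_pred k) -> False.
  move=> t0 E; apply: oq; exists (ord_pred k); apply/segmentP; exists (1 + t).
    by have := small2 _ _ _ b2 E; rewrite ler0_norm//; lra.
  rewrite -/(edge (ord_pred k)) scalerDl scale1r -E edge_pred.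
  by apply: eq_pair; rewrite !coordE; ring.
have z1 : cross (edge k) (q - P k) = 0 ->
    q - P k = (dot (edge k) (q - P k) / dot (edge k) (edge k)) *: edge k.
  exact: cross_eq0.
have z2 : cross (edge (ord_pred k)) (q - P k) = 0 -> q - P k =
    (dot (edge (ord_pred k)) (q - P k) /
     dot (edge (ord_pred k)) (edge (ord_pred k))) *: edge (ord_pred k).
  exact: cross_eq0.
rewrite /sector /corner.
set c := cross (edge (ord_pred k)) (edge k).
set x := cross (edge (ord_pred k)) (q - P k).
set y := cross (edge k) (q - P k).
rewrite !mul1r !mulN1r !oppr_gt0.
(* Here [x = t * c], so [t > 0] and [q] lies on the next edge. *)
have ny : y = 0 -> 0 < c * x -> False.
  move=> y0 cx; have E := z1 y0; apply: on1 E.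
  set t := _ / _ in cx *.
  have : x = t * c.
    by rewrite /x (z1 y0) -/t /c /cross !coordE; ring.
  move=> xt; rewrite xt in cx; rewrite leNgt; apply/negP => t0.
  have : 0 <= c * c by rewrite -expr2 sqr_ge0.
  have : t * (c * c) <= 0 by rewrite mulr_le0_ge0// ?(ltW t0)// -expr2 sqr_ge0.
  by move: cx; rewrite mulrCA => cx; lra.
(* Here [y = - t * c], so [t < 0] and [q] lies on the previous edge. *)
have nx : x = 0 -> 0 < c * y -> False.
  move=> x0 cy; have E := z2 x0; apply: on2 E.
  set t := _ / _ in cy *.
  have yt : y = - t * c.
    by rewrite /y (z2 x0) -/t /c /cross !coordE; ring.
  rewrite yt in cy; rewrite leNgt; apply/negP => t0.
  have : 0 <= c * c by rewrite -expr2 sqr_ge0.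
  have : 0 <= t * (c * c) by rewrite mulr_ge0 ?(ltW t0)// -expr2 sqr_ge0.
  have -> : t * (c * c) = - (c * (- t * c)) by ring.
  by lra.
(* If [q] were on neither edge, the two edges would be parallel and opposite, against [no_fold]. *)
have nxy : x = 0 -> y = 0 -> False.
  move=> x0 y0; have E1 := z1 y0; have E2 := z2 x0.
  have [t0|t0] := leP 0 (dot (edge k) (q - P k) / dot (edge k) (edge k)).
    exact: on1 E1.
  have [u0|u0] := leP (dot (edge (ord_pred k)) (q - P k) /
     dot (edge (ord_pred k)) (edge (ord_pred k))) 0.
    exact: on2 E2.
  have c0 : cross (edge (ord_pred k)) (edge k) = 0.
    move: x0; rewrite /x E1.
    have -> (t : R) : cross (edge (ord_pred k)) (t *: edge k) = t * c.
      by rewrite /c /cross !coordE; ring.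
    by move=> /eqP; rewrite mulf_eq0 lt_eqF//= => /eqP.
  have := no_fold c0.
  move: t0 u0; set t := _ / _ in E1 *; set u := _ / _ in E2 * => t0 u0 dd.
  have : t *: edge k = u *: edge (ord_pred k) by rewrite -E1 -E2.
  move=> /(congr1 (fun v => dot v (edge k))).
  have -> : dot (t *: edge k) (edge k) = t * dot (edge k) (edge k).
    by rewrite /dot !coordE; ring.
  have -> : dot (u *: edge (ord_pred k)) (edge k) =
      u * dot (edge (ord_pred k)) (edge k).
    by rewrite /dot !coordE; ring.
  have : t * dot (edge k) (edge k) < 0 by rewrite nmulr_rlt0 ?dot_gt0.
  have : 0 < u * dot (edge (ord_pred k)) (edge k) by rewrite mulr_gt0.
  lra.
case: (ltrgt0P c) => c0.
- have [x0|x0|x0] := ltrgt0P x; have [y0|y0|y0] := ltrgt0P y => //=; auto;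
    exfalso; first [exact: nxy | by apply: ny => //; rewrite mulr_gt0
                    | by apply: nx => //; rewrite mulr_gt0].
- have [x0|x0|x0] := ltrgt0P x; have [y0|y0|y0] := ltrgt0P y => //=; auto;
    exfalso; first [exact: nxy | by apply: ny => //; rewrite nmulr_rgt0
                    | by apply: nx => //; rewrite nmulr_rgt0].
- have [x0|x0|x0] := ltrgt0P x; have [y0|y0|y0] := ltrgt0P y => //=; auto;
    exfalso; exact: nxy.
Qed.

End Simple.
End Local.

(** * The side of the outline on which the region lies *)

Section Orientation.
Context {R : realType}.
Implicit Types (p q v x y : (R * R)%type) (s t : R) (k l : 'I_5).
Variable P : pentagon R.
Hypothesis simpleP : simple_pentagon P.

Lemma edge_cover k t : 0 < t < 1 -> exists2 e : R, 0 < e &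
  forall q, ball (P k + t *: edge P k) e q -> ~ outline P q ->
  0 < 1 * cross (edge P k) (q - P k) \/ 0 < (-1) * cross (edge P k) (q - P k).
Proof.
move=> /andP[t0 t1]; have k0 := edge_neq0 simpleP k.
have c0 : 0 < Num.min t (1 - t) by rewrite lt_min t0 subr_gt0.
have [e e0 he] := ball_scale_lt k0 c0.
exists e => // q xq oq; rewrite mul1r mulN1r oppr_gt0.
have [h|h|h] := ltrgt0P (cross (edge P k) (q - P k)); auto.
exfalso; apply: oq; have := cross_eq0 k0 h; set u := _ / _ => E.
exists k; apply/segmentP; exists u; last first.
  by rewrite -/(edge P k) -E addrC subrK.
have : `|u - t| < Num.min t (1 - t).
  apply: he xq _; rewrite scalerBl -E.
  by apply: eq_pair; rewrite !coordE; ring.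
by rewrite lt_min !ltr_norml => /andP[/andP[? ?] /andP[? ?]]; lra.
Qed.

Lemma edge_out_of_corner s k t : s * s = 1 -> 0 < t < 1 ->
  corner_side P (~` region P) s k ->
  edge_side P (~` region P) s k (P k + t *: edge P k).
Proof.
move=> ss t01 ko; have [|//] := edge_in_or_out simpleP s k t01.
by have [_ /(_ ko)] := corner_in_edge simpleP k ss t01.
Qed.

(** A point just to the right of the rightmost vertex is outside a half-plane that contains the
    region, yet lies in one of the two sectors at that vertex. *)
Lemma not_both_in : ~ ((forall k, corner_side P (region P) 1 k) /\
  (forall k, corner_side P (region P) (-1) k)).
Proof.
move=> [in1 in2].
pose m : 'I_5 := [arg max_(i > ord0) (P i).1]%O.
have mmax k : (P k).1 <= (P m).1 by rewrite /m; case: arg_maxP => // i _ /(_ k); exact.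
have [e e0 he] := sector_cover simpleP m.
have [e1 e10 he1] := in1 m; have [e2 e20 he2] := in2 m.
pose d := Num.min e (Num.min e1 e2) / 2.
have d0 : 0 < d by rewrite divr_gt0// !lt_min e0 e10.
have md (f : R) : Num.min e (Num.min e1 e2) <= f -> ball (P m) f (P m + (d, 0)).
  move=> ef; apply/ball_plane; rewrite !coordE /= addr0 subrr normr0.
  rewrite opprD addrA subrr sub0r normrN ger0_norm ?(ltW d0)//.
  by rewrite /d; have := d0; rewrite /d; split; lra.
have f1 : forall k, dot (1, 0) (P k) <= (P m).1.
  by move=> k; rewrite /dot /= mul1r mul0r addr0.
have nr : ~ region P (P m + (d, 0)).
  move=> /(region_halfplane f1); rewrite /dot /= mul1r mul0r addr0.
  by rewrite gerDl leNgt d0.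
have no : ~ outline P (P m + (d, 0)) by move=> /outline_region.
have be : ball (P m) e (P m + (d, 0)) by apply: md; rewrite ge_min lexx.
have be1 : ball (P m) e1 (P m + (d, 0)) by apply: md; rewrite !ge_min lexx orbT.
have be2 : ball (P m) e2 (P m + (d, 0)) by apply: md; rewrite !ge_min lexx !orbT.
by have [/(he1 _ be1)[]|/(he2 _ be2)[]] := he _ be no.
Qed.

(** Otherwise the region without its outline would be open and closed, against the connectedness of
    a segment from [p] to a vertex. *)
Lemma not_both_out p : region P p -> ~ outline P p ->
  ~ ((forall k, corner_side P (~` region P) 1 k) /\
  (forall k, corner_side P (~` region P) (-1) k)).
Proof.
move=> rp op [out1 out2].
pose U := region P `\` outline P.
have oU : open U by exact: region_inner_open.
have ocU : open (~` U).
  apply: openP_ball => q nU.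
  have [[k /segmentP[t t01 qE]]|oq] := pselect (outline P q); last first.
    have rq : ~ region P q by move=> rq; apply: nU.
    have [e e0 he] := region_near oq.
    by exists e => // z /he[_ [_ zq]] [/zq].
  have vtx l : exists2 e : R, 0 < e & forall z, ball (P l) e z -> (~` U) z.
    have [e e0 he] := sector_cover simpleP l.
    have [e1 e10 he1] := out1 l; have [e2 e20 he2] := out2 l.
    exists (Num.min e (Num.min e1 e2)); first by rewrite !lt_min e0 e10.
    move=> z bz [rz oz].
    have be : ball (P l) e z by apply: le_ball bz; rewrite ge_min lexx.
    have be1 : ball (P l) e1 z by apply: le_ball bz; rewrite !ge_min lexx orbT.
    have be2 : ball (P l) e2 z by apply: le_ball bz; rewrite !ge_min lexx !orbT.
    by have [/(he1 _ be1)[]|/(he2 _ be2)[]] := he _ be oz.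
  have [t0|t0] := eqVneq t 0; first by rewrite qE t0 scale0r addr0.
  have [t1|t1] := eqVneq t 1.
    by rewrite qE t1 scale1r addrC subrK; exact: vtx.
  have {}t01 : 0 < t < 1.
    by case/andP: t01 => h0 h1; rewrite !lt_neqAle h0 h1 t1 eq_sym t0.
  have [e e0 he] := edge_cover k t01.
  have s1 : 1 * 1 = 1 :> R by rewrite mulr1.
  have s2 : -1 * -1 = 1 :> R by rewrite mulrNN mulr1.
  have [e1 e10 he1] := edge_out_of_corner s1 t01 (out1 k).
  have [e2 e20 he2] := edge_out_of_corner s2 t01 (out2 k).
  exists (Num.min e (Num.min e1 e2)); first by rewrite !lt_min e0 e10.
  rewrite qE => z bz [rz oz].
  have be : ball (P k + t *: edge P k) e z by apply: le_ball bz; rewrite ge_min lexx.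
  have be1 : ball (P k + t *: edge P k) e1 z.
    by apply: le_ball bz; rewrite !ge_min lexx orbT.
  have be2 : ball (P k + t *: edge P k) e2 z.
    by apply: le_ball bz; rewrite !ge_min lexx !orbT.
  by have [/(he1 _ be1)[]|/(he2 _ be2)[]] := he _ be oz.
pose f (t : R) := p + t *: (P ord0 - p).
have cf : continuous f by exact: continuous_line.
have := @interval_open_cover R (f @^-1` U) (f @^-1` (~` U)) 0 1.
have o1 : open (f @^-1` U) by apply: open_comp.
have o2 : open (f @^-1` (~` U)) by apply: open_comp.
move=> /(_ o1 o2 ler01) [].
- by move=> t _; have [] := pselect (U (f t)); [left|right].
- by move=> t Ut; apply.
rewrite /= /f scale0r addr0 scale1r addrC subrK => h _.
by have [] := h (conj rp op) => _; apply; exact: outline_vertex.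
Qed.

(** [s] is 1 when the vertices run counterclockwise, with the region on the left, and -1 when they
    run clockwise. *)
Definition oriented s := [/\ s * s = 1,
  forall k, corner_side P (region P) s k &
  forall k, corner_side P (~` region P) (- s) k].

(** This is the part of the Jordan curve theorem on which the proof relies: of the two sides of the
    outline, exactly one is in the region, and it is the same at all corners. *)
Lemma orientation p : region P p -> ~ outline P p -> exists s, oriented s.
Proof.
move=> rp op.
have s1 : 1 * 1 = 1 :> R by rewrite mulr1.
have s2 : -1 * -1 = 1 :> R by rewrite mulrNN mulr1.
have [i1|o1] := corner_in_all simpleP s1; have [i2|o2] := corner_in_all simpleP s2.
- by case: not_both_in.
- by exists 1.
- by exists (-1); split => //; rewrite opprK.
- by case: (not_both_out rp op).
Qed.

Lemma oriented_edge s k t : oriented s -> 0 < t < 1 ->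
  edge_side P (region P) s k (P k + t *: edge P k).
Proof.
by move=> [ss h _] t01; have [+ _] := corner_in_edge simpleP k ss t01; apply.
Qed.

End Orientation.

(** * Convex pentagons *)

Section Convex.
Context {R : realType}.
Implicit Types (p q v a b c d : (R * R)%type) (s t : R) (k l : 'I_5).

(** Twice the signed area of the triangle. *)
Definition tri a b c : R := cross (b - a) (c - a).

Lemma tri_rot a b c : tri b c a = tri a b c.
Proof. by rewrite /tri /cross !coordE; ring. Qed.

Lemma tri_swap a b c : tri b a c = - tri a b c.
Proof. by rewrite /tri /cross !coordE; ring. Qed.

Lemma segmentC a b : segment a b = segment b a.
Proof.
apply/seteqP; split => x /segmentP[t /andP[t0 t1] ->]; apply/segmentP;
  exists (1 - t); rewrite ?subr_ge0 ?gerBl ?t0 ?t1//;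
  by apply: eq_pair; rewrite !coordE; ring.
Qed.

(** The parameters [t] and [u] come from Cramer's rule for the two lines; the strict first
    inequality makes the determinant [D] positive. *)
Lemma segments_meet s a b c d : 0 < s * tri a b c -> s * tri a b d <= 0 ->
  s * tri c d a <= 0 -> 0 <= s * tri c d b ->
  segment a b `&` segment c d !=set0.
Proof.
move=> h1 h2 h3 h4.
have E : s * tri c d b - s * tri c d a = s * tri a b c - s * tri a b d.
  by rewrite /tri /cross !coordE; ring.
pose D := s * tri a b c - s * tri a b d.
have D0 : 0 < D by rewrite /D; lra.
pose t := s * tri a b c / D; pose u := - (s * tri c d a) / D.
have t01 : 0 <= t <= 1.
  by rewrite /t divr_ge0 ?(ltW h1) ?(ltW D0)//= ler_pdivrMr ?mul1r /D//; lra.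
have u01 : 0 <= u <= 1.
  rewrite /u divr_ge0 ?oppr_ge0 ?(ltW D0)//= ler_pdivrMr// mul1r /D -E.
  by rewrite lerDr.
exists (a + u *: (b - a)); split; apply/segmentP; first by exists u.
exists t => //.
have Dn : D != 0 by rewrite gt_eqF.
have tD : t * D = s * tri a b c by rewrite /t divfK.
have uD : u * D = - (s * tri c d a) by rewrite /u divfK.
have lin (x y z w : R) : x * D + (u * D) * y = z * D + (t * D) * w ->
    x + u * y = z + t * w.
  by move=> h; apply: (mulIf Dn); rewrite !mulrDl -!mulrA !(mulrC _ D) !mulrA in h *;
     rewrite h.
by apply: eq_pair; rewrite !coordE; apply: lin; rewrite tD uD /D /tri /cross !coordE;
  ring.
Qed.

(** Five convex corners alone do not suffice: a pentagram has them too. If [p3] were on the wrong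
    side of [p0 p1], the signs of further triangles would be forced until two non-adjacent sides
    cross. *)
Lemma pentagon_convexity s p0 p1 p2 p3 p4 :
  0 < s * tri p0 p1 p2 -> 0 < s * tri p1 p2 p3 -> 0 < s * tri p2 p3 p4 ->
  0 < s * tri p3 p4 p0 -> 0 < s * tri p4 p0 p1 ->
  segment p0 p1 `&` segment p2 p3 = set0 ->
  segment p0 p1 `&` segment p3 p4 = set0 ->
  segment p1 p2 `&` segment p4 p0 = set0 ->
  0 < s * tri p0 p1 p3.
Proof.
move=> h012 h123 h234 h340 h401 d02 d03 d14; rewrite ltNge; apply/negP => h013.
have meet a b c d : segment a b `&` segment c d = set0 ->
   ~ ((segment a b `&` segment c d) !=set0) by move=> -> [].
have h230 : 0 < s * tri p2 p3 p0.
  rewrite ltNge; apply/negP => h; apply: (meet _ _ _ _ d02).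
  apply: (segments_meet h012 h013 h); rewrite tri_rot ltW//.
have h341 : 0 < s * tri p3 p4 p1.
  rewrite ltNge; apply/negP => h; apply: (meet _ _ _ _ d03).
  rewrite (segmentC p3); apply: (@segments_meet s) => //.
  - by rewrite tri_rot.
  - by rewrite tri_swap mulrN oppr_le0 ltW.
  - by rewrite tri_swap mulrN oppr_ge0.
(* Three-term Grassmann-Plucker relations, at [p0] here and at [p1] in [e2]. *)
have e1 : (s * tri p0 p1 p3) * (s * tri p0 p2 p4) =
    (s * tri p0 p1 p2) * (s * tri p3 p4 p0) + (s * tri p4 p0 p1) * (s * tri p2 p3 p0).
  by rewrite /tri /cross !coordE; ring.
have e2 : (s * tri p0 p1 p3) * (s * tri p1 p2 p4) =
    (s * tri p0 p1 p2) * (s * tri p3 p4 p1) + (s * tri p4 p0 p1) * (s * tri p1 p2 p3).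
  by rewrite /tri /cross !coordE; ring.
have neg x y : x <= 0 -> 0 < x * y -> y < 0 :> R.
  by move=> x0 xy; rewrite ltNge; apply/negP => y0; move: xy;
     rewrite ltNge mulr_le0_ge0.
have h024 : s * tri p0 p2 p4 < 0.
  by apply: (neg _ _ h013); rewrite e1; apply: addr_gt0; exact: mulr_gt0.
have h124 : s * tri p1 p2 p4 < 0.
  by apply: (neg _ _ h013); rewrite e2; apply: addr_gt0; exact: mulr_gt0.
apply: (meet _ _ _ _ d14); rewrite (segmentC p4).
apply: (@segments_meet s); rewrite ?(ltW h124)//.
- by rewrite tri_rot.
- by rewrite tri_swap mulrN oppr_le0 ltW.
- have -> : tri p0 p4 p2 = - tri p0 p2 p4 by rewrite /tri /cross !coordE; ring.
  by rewrite mulrN oppr_ge0 ltW.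
Qed.

Definition hull3 a b c : set (R * R) := [set q | exists x y z : R,
  [/\ 0 <= x, 0 <= y, 0 <= z, x + y + z = 1 & q = x *: a + y *: b + z *: c]].

Lemma hull3P s a b c q : 0 < s * tri a b c -> 0 <= s * tri a b q ->
  0 <= s * tri b c q -> 0 <= s * tri c a q -> hull3 a b c q.
Proof.
set D := s * _ => D0 h1 h2 h3; have Dn : D != 0 by rewrite gt_eqF.
have lin (x y z w : R) : w * D = x + y + z -> w = x / D + y / D + z / D.
  by move=> h; rewrite -!mulrDl -h mulfK.
exists (s * tri b c q / D), (s * tri c a q / D), (s * tri a b q / D).
rewrite !divr_ge0 ?(ltW D0)//; split => //.
  by apply/esym/lin; rewrite /D /tri /cross !coordE; ring.
apply: eq_pair; rewrite !coordE !(mulrAC _ D^-1); apply: lin;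
  by rewrite /D /tri /cross !coordE; ring.
Qed.

Section Pent.
Variable P : pentagon R.

Definition convex_position s := forall k,
  [/\ 0 < s * tri (P k) (P (ordS k)) (P (ordS (ordS k))),
      0 < s * tri (P k) (P (ordS k)) (P (ordS (ordS (ordS k)))) &
      0 < s * tri (P k) (P (ordS k)) (P (ordS (ordS (ordS (ordS k)))))].

Lemma ordS5 k : ordS (ordS (ordS (ordS (ordS k)))) = k.
Proof. by apply: ord_inj; move: k => [[|[|[|[|[|k]]]]] hk]. Qed.

Lemma ord_predE k : ord_pred k = ordS (ordS (ordS (ordS k))).
Proof. by apply: ord_inj; move: k => [[|[|[|[|[|k]]]]] hk]. Qed.

Lemma cornerE s k : corner P s k = s * tri (P (ord_pred k)) (P k) (P (ordS k)).
Proof. by rewrite /corner edge_pred /edge /tri /cross !coordE; ring. Qed.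

Lemma corners_convex s : simple_pentagon P -> (forall k, 0 < corner P s k) ->
  convex_position s.
Proof.
move=> [_ _ dis] h.
have {}h k : 0 < s * tri (P k) (P (ordS k)) (P (ordS (ordS k))).
  by have := h (ordS k); rewrite cornerE ordSK.
have hp k : 0 < s * tri (P (ord_pred k)) (P k) (P (ordS k)).
  by have := h (ord_pred k); rewrite ord_predK.
move=> k; split => //; last by rewrite -ord_predE tri_rot; exact: hp.
set k1 := ordS k; set k2 := ordS k1; set k3 := ordS k2; set k4 := ordS k3.
have d02 : side P k `&` side P k2 = set0.
  by apply: dis; rewrite /k2 /k1; case: (k) => [[|[|[|[|[|?]]]]] ?].
have d03 : side P k `&` side P k3 = set0.
  by apply: dis; rewrite /k3 /k2 /k1; case: (k) => [[|[|[|[|[|?]]]]] ?].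
have d14 : side P k1 `&` side P k4 = set0.
  by apply: dis; rewrite /k4 /k3 /k2 /k1; case: (k) => [[|[|[|[|[|?]]]]] ?].
apply: (@pentagon_convexity _ _ _ (P k2) _ (P k4)) => //.
- by have := h k3; rewrite -/k4 /k4 /k3 /k2 /k1 ordS5.
- by have := h k4; rewrite /k4 /k3 /k2 /k1 ordS5.
- by move: d14; rewrite /side -/k2 /k4 /k3 /k2 /k1 ordS5.
Qed.

Definition cell s : set (R * R) :=
  [set q | forall k, 0 <= s * tri (P k) (P (ordS k)) q].

Lemma convex_position_ge0 s k l : convex_position s ->
  0 <= s * tri (P k) (P (ordS k)) (P l).
Proof.
move=> /(_ k)[h2 h3 h4].
have z a b : tri a b a = 0 /\ tri a b b = 0.
  by rewrite /tri /cross !coordE; split; ring.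
have [->|n0] := eqVneq l k; first by rewrite (z _ _).1 mulr0.
have [->|n1] := eqVneq l (ordS k); first by rewrite (z _ _).2 mulr0.
have [->|n2] := eqVneq l (ordS (ordS k)); first exact: ltW.
have [->|n3] := eqVneq l (ordS (ordS (ordS k))); first exact: ltW.
have -> : l = ordS (ordS (ordS (ordS k))); last exact: ltW.
apply/eqP; move: n0 n1 n2 n3.
by case: k {h2 h3 h4} => [[|[|[|[|[|?]]]]] ?] //;
   case: l => [[|[|[|[|[|?]]]]] ?].
Qed.

Lemma region_cell s : convex_position s -> region P `<=` cell s.
Proof.
move=> cv q rq k.
have E p : dot (s * (edge P k).2, - (s * (edge P k).1)) p =
   s * tri (P k) (P (ordS k)) (P k) - s * tri (P k) (P (ordS k)) p +
   dot (s * (edge P k).2, - (s * (edge P k).1)) (P k).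
  by rewrite /edge /dot /tri /cross !coordE /=; ring.
have z a b : tri a b a = 0 by rewrite /tri /cross !coordE; ring.
have le p : (dot (s * (edge P k).2, - (s * (edge P k).1)) p <=
    dot (s * (edge P k).2, - (s * (edge P k).1)) (P k)) =
    (0 <= s * tri (P k) (P (ordS k)) p).
  by rewrite (E p) z mulr0 sub0r gerDr oppr_le0.
rewrite -le; apply: region_halfplane rq => l.
by rewrite le; exact: convex_position_ge0.
Qed.

Lemma cell_fan s k q : convex_position s -> cell s q ->
  [\/ hull3 (P k) (P (ordS k)) (P (ordS (ordS k))) q,
      hull3 (P k) (P (ordS (ordS k))) (P (ordS (ordS (ordS k)))) q |
      hull3 (P k) (P (ordS (ordS (ordS k)))) (P (ordS (ordS (ordS (ordS k))))) q].
Proof.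
move=> cv cq.
set k1 := ordS k; set k2 := ordS k1; set k3 := ordS k2; set k4 := ordS k3.
have k5 : ordS k4 = k by rewrite /k4 /k3 /k2 /k1 ordS5.
have [h012 h013 _] := cv k; have [_ h230 _] := cv k2; have [h340 _ _] := cv k3.
have [_ h124 _] := cv k1.
have [h401 h402 _] := cv k4.
rewrite -/k1 -/k2 -/k3 in h012 h013; rewrite -/k3 -/k4 k5 in h230.
rewrite -/k4 k5 in h340; rewrite k5 -/k1 -/k2 in h401 h402.
have q0 := cq k; have q1 := cq k1; have q2 := cq k2; have q3 := cq k3.
have q4 := cq k4; rewrite k5 in q4.
have [a|a] := leP 0 (s * tri (P k2) (P k) q).
  by apply: Or31; apply: (hull3P h012).
have [b|b] := leP 0 (s * tri (P k3) (P k) q).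
  apply: Or32; apply: (@hull3P s) => //; first by rewrite -tri_rot.
  by rewrite tri_swap mulrN oppr_ge0 ltW.
apply: Or33; apply: (@hull3P s) => //; first by rewrite -tri_rot.
by rewrite tri_swap mulrN oppr_ge0 ltW.
Qed.

Lemma cell_bounded s : convex_position s -> exists2 M : R, 0 < M &
  forall q, cell s q -> `|q.1| <= M /\ `|q.2| <= M.
Proof.
move=> cv.
pose M := \sum_k (`|(P k).1| + `|(P k).2|).
have Mk k : `|(P k).1| + `|(P k).2| <= M.
  rewrite /M (bigD1 k)//= lerDl sumr_ge0// => i _; exact: addr_ge0.
have M1 k : `|(P k).1| <= M by apply: le_trans (Mk k); rewrite lerDl.
have M2 k : `|(P k).2| <= M by apply: le_trans (Mk k); rewrite lerDr.
have M0 : 0 <= M by apply: le_trans (M1 ord0).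
have h i j l q : hull3 (P i) (P j) (P l) q -> `|q.1| <= M + 1 /\ `|q.2| <= M + 1.
  move=> [x [y [z [x0 y0 z0 xyz ->]]]]; rewrite !coordE.
  have n (a b c : R) : `|a| <= M -> `|b| <= M -> `|c| <= M ->
      `|x * a + y * b + z * c| <= M + 1.
    move=> a1 b1 c1; apply: (@le_trans _ _ M); last by rewrite lerDl.
    rewrite (le_trans (ler_normD _ _))// (le_trans (lerD (ler_normD _ _) (lexx _)))//.
    rewrite !normrM (ger0_norm x0) (ger0_norm y0) (ger0_norm z0).
    have -> : M = x * M + y * M + z * M by rewrite -!mulrDl xyz mul1r.
    by rewrite !lerD// ler_wpM2l.
  by split; apply: n.
exists (M + 1); first by rewrite ltr_wpDl.
by move=> q /(cell_fan ord0 cv)[] /h.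
Qed.

(** A point of the cell on the line of an edge lies between the ends of this edge, by the
    half-planes of the two neighbouring edges. *)
Lemma cell_outline s q : convex_position s -> cell s q -> ~ outline P q ->
  forall k, 0 < s * tri (P k) (P (ordS k)) q.
Proof.
move=> cv cq oq k; rewrite lt_neqAle cq andbT; apply/eqP => /esym h.
have [h2 h3 h4] := cv k.
have s0 : s != 0 by apply: contraTneq h2 => ->; rewrite mul0r ltxx.
have e0 : edge P k != 0.
  apply: contraTneq h2; rewrite /edge /tri => ->.
  by rewrite /cross/= !mul0r subrr mulr0 ltxx.
have c0 : cross (edge P k) (q - P k) = 0.
  by move/eqP: h; rewrite mulf_eq0 (negbTE s0) => /eqP.
have := cross_eq0 e0 c0; set u := _ / _ => E.
have qE : q = P k + u *: edge P k by rewrite -E addrC subrK.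
apply: oq; exists k; apply/segmentP; exists u => //.
apply/andP; split.
  have := cq (ord_pred k); rewrite ord_predK qE.
  have -> : s * tri (P (ord_pred k)) (P k) (P k + u *: edge P k) =
     u * (s * tri (P k) (P (ordS k)) (P (ord_pred k))).
    by rewrite /tri /cross /edge !coordE; ring.
  by rewrite ord_predE pmulr_lge0.
have := cq (ordS k); rewrite qE.
have -> : s * tri (P (ordS k)) (P (ordS (ordS k))) (P k + u *: edge P k) =
   (1 - u) * (s * tri (P k) (P (ordS k)) (P (ordS (ordS k)))).
  by rewrite /tri /cross /edge !coordE; ring.
by rewrite pmulr_lge0// subr_ge0.
Qed.

Lemma tri_continuous s a b : continuous (fun q => s * tri a b q).
Proof.
move=> q.
have E : (fun q => s * tri a b q) = (fun q => - (s * (b - a).2) * q.1 +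
    (s * (b - a).1) * q.2 + s * tri a b 0).
  apply/funext => z; rewrite /tri /cross /=; ring.
rewrite E.
apply: cvgD; last exact: cvg_cst.
apply: cvgD; apply: cvgM; (try exact: cvg_cst).
  exact: cvg_fst.
exact: cvg_snd.
Qed.

(** Off the outline, the points of the cell satisfy its inequalities strictly, so the cell is open
    and closed in the component of such a point. The component thus stays in the cell, which is
    bounded. *)
Lemma region_convex s : convex_position s -> region P = cell s.
Proof.
move=> cv; apply/seteqP; split; first exact: region_cell.
move=> p cp; have [op|op] := pselect (outline P p); first by left.
right; split => //; have [M M0 MP] := cell_bounded cv.
pose H := [set q | forall k, 0 < s * tri (P k) (P (ordS k)) q].
have oH : open H.
  have -> : H = ~` \bigcup_(k in [set: 'I_5])
      [set q | s * tri (P k) (P (ordS k)) q <= 0].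
    apply/seteqP; split => [q h [k _ /=]|q h k]; first by rewrite leNgt h.
    by rewrite ltNge; apply/negP => hk; apply: h; exists k.
  apply: closed_openC; apply: closed_bigcup => [|k _]; first exact: finite_finset.
  apply: (@closed_comp _ _ _ [set x : R | x <= 0]); last exact: closed_le.
  by move=> ? _; exact: tri_continuous.
have cC : closed (cell s).
  have -> : cell s = \bigcap_(k in [set: 'I_5]) [set q | 0 <= s * tri (P k) (P (ordS k)) q].
    by apply/seteqP; split => [q h k _|q h k]; exact: h.
  apply: closed_bigI => k _.
  apply: (@closed_comp _ _ _ [set x : R | 0 <= x]); last exact: closed_ge.
  by move=> ? _; exact: tri_continuous.
have sub : connected_component (~` outline P) p `<=` cell s.
  set C := connected_component _ _.
  have CE : C `&` H = C `&` cell s.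
    apply/seteqP; split => q [Cq hq]; split => //.
      by move=> k; exact/ltW/hq.
    apply: cell_outline => //.
    exact: (@connected_component_sub _ (~` outline P) p q Cq).
  have : C `&` H = C.
    apply: (@component_connected _ (~` outline P) p).
    - exists p; split; first exact: connected_component_refl.
      by apply: cell_outline.
    - by exists H.
    - by exists (cell s).
  by move=> <-; rewrite CE => q [].
exists M; split; first exact: num_real.
move=> N MN q /sub /MP[h1 h2]; rewrite /= /Num.norm /= ge_max.
by rewrite !(le_trans _ (ltW MN)).
Qed.

Lemma cell_convex s : convex_set (cell s).
Proof.
move=> x y l; rewrite !inE => hx hy k.
have l0 : 0 <= l%:num by [].
have l1 : l%:num <= 1 by [].
have := hx k; have := hy k.
change (0 <= s * tri (P k) (P (ordS k)) y -> 0 <= s * tri (P k) (P (ordS k)) x ->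
  0 <= s * tri (P k) (P (ordS k)) (l%:num *: (x : R * R) + (1 - l%:num) *: (y : R * R))).
move: (l%:num) l0 l1 => t t0 t1 h1 h2.
have -> : s * tri (P k) (P (ordS k)) (t *: (x : R * R) + (1 - t) *: (y : R * R)) =
    t * (s * tri (P k) (P (ordS k)) x) + (1 - t) * (s * tri (P k) (P (ordS k)) y).
  by rewrite /tri /cross !coordE; ring.
by apply: addr_ge0; apply: mulr_ge0 => //; lra.
Qed.

Lemma nonconvex_corner s : simple_pentagon P -> ~ convex_set (region P) ->
  exists k, corner P s k <= 0.
Proof.
move=> sP nc; apply: contrapT => h; apply: nc.
have cv : convex_position s.
  apply: corners_convex => // k; rewrite ltNge; apply/negP => k0.
  by apply: h; exists k.
by rewrite (region_convex cv); exact: cell_convex.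
Qed.

End Pent.
End Convex.

(** * Angles *)

Section Euclid.
Context {R : realType}.
Implicit Types (p q u v w : (R * R)%type) (t : R).

Lemma dot_ge0 u : 0 <= dot u u.
Proof. by rewrite /dot -!expr2 addr_ge0 ?sqr_ge0. Qed.

Lemma eucl_norm_ge0 u : 0 <= eucl_norm u.
Proof. exact: sqrtr_ge0. Qed.

Lemma eucl_norm_sqr u : eucl_norm u ^+ 2 = dot u u.
Proof. by rewrite sqr_sqrtr ?dot_ge0. Qed.

Lemma eucl_norm_gt0 u : u != 0 -> 0 < eucl_norm u.
Proof. by move=> u0; rewrite sqrtr_gt0 dot_gt0. Qed.

Lemma dot_cross_sqr u v : dot u v ^+ 2 + cross u v ^+ 2 = dot u u * dot v v.
Proof. by rewrite /dot /cross; ring. Qed.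

Lemma norm_cross_le u v : `|cross u v| <= eucl_norm u * eucl_norm v.
Proof.
rewrite -[leRHS]ger0_norm ?mulr_ge0 ?eucl_norm_ge0// -ler_sqr ?nnegrE//.
rewrite !real_normK ?num_real// exprMn !eucl_norm_sqr -dot_cross_sqr lerDr sqr_ge0//.
Qed.

Lemma norm_dot_le u v : `|dot u v| <= eucl_norm u * eucl_norm v.
Proof.
rewrite -[leRHS]ger0_norm ?mulr_ge0 ?eucl_norm_ge0// -ler_sqr ?nnegrE//.
rewrite !real_normK ?num_real// exprMn !eucl_norm_sqr -dot_cross_sqr lerDl sqr_ge0//.
Qed.

Lemma eucl_normD u v : eucl_norm (u + v) <= eucl_norm u + eucl_norm v.
Proof.
rewrite -ler_sqr ?nnegrE ?addr_ge0 ?eucl_norm_ge0//.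
have -> : eucl_norm (u + v) ^+ 2 = eucl_norm u ^+ 2 + dot u v *+ 2 + eucl_norm v ^+ 2.
  by rewrite !eucl_norm_sqr /dot !coordE; ring.
have := le_trans (ler_norm _) (norm_dot_le u v).
by rewrite sqrrD !mulr2n; lra.
Qed.

Lemma eucl_normZ t u : eucl_norm (t *: u) = `|t| * eucl_norm u.
Proof.
rewrite /eucl_norm -[`|t|]sqrtr_sqr -sqrtrM ?sqr_ge0//; congr Num.sqrt.
by rewrite /dot !coordE; ring.
Qed.

Lemma eucl_normN u : eucl_norm (- u) = eucl_norm u.
Proof. by rewrite -scaleN1r eucl_normZ normrN1 mul1r. Qed.

Lemma eucl_distC p q : eucl_dist p q = eucl_dist q p.
Proof. by rewrite /eucl_dist -opprB eucl_normN. Qed.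

Lemma eucl_dist_triangle p q u : eucl_dist p u <= eucl_dist p q + eucl_dist q u.
Proof.
rewrite /eucl_dist; have -> : u - p = (q - p) + (u - q); last exact: eucl_normD.
by apply: eq_pair; rewrite !coordE; ring.
Qed.

Lemma eucl_dist_ge0 p q : 0 <= eucl_dist p q.
Proof. exact: eucl_norm_ge0. Qed.

Lemma eucl_dist0l p : eucl_dist 0 p = eucl_norm p.
Proof. by rewrite /eucl_dist subr0. Qed.

Lemma vangle_arg u v : u != 0 -> v != 0 ->
  -1 <= dot u v / (eucl_norm u * eucl_norm v) <= 1.
Proof.
move=> /eucl_norm_gt0 u0 /eucl_norm_gt0 v0.
have uv : 0 < eucl_norm u * eucl_norm v by exact: mulr_gt0.
by rewrite ler_pdivlMr// ler_pdivrMr// mulN1r mul1r -ler_norml norm_dot_le.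
Qed.

Lemma cos_vangle u v : u != 0 -> v != 0 ->
  dot u v = cos (vangle u v) * (eucl_norm u * eucl_norm v).
Proof.
move=> u0 v0; rewrite /vangle acosK ?in_itv//= ?vangle_arg// divfK//.
by rewrite mulf_neq0// gt_eqF// eucl_norm_gt0.
Qed.

Lemma cos_2pi3 : cos (2 * pi / 3) = - (1 / 2) :> R.
Proof.
have pi0 : 0 < pi :> R := pi_gt0 R.
have c0 : 0 < cos (pi / 3 : R) by apply: cos_gt0_pihalf; lra.
have e2 : cos (2 * pi / 3 : R) = 2 * cos (pi / 3) ^+ 2 - 1.
  have -> : 2 * pi / 3 = (pi / 3 : R) *+ 2 by rewrite mulr2n; field.
  by rewrite cos_mulr2n mulr2n; ring.
have e3 : cos (pi / 3 : R) * (2 * cos (pi / 3) ^+ 2 - 1)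
    - 2 * cos (pi / 3) * sin (pi / 3) ^+ 2 = -1.
  have : cos (2 * pi / 3 + pi / 3 : R) = -1.
    have -> : 2 * pi / 3 + pi / 3 = pi :> R by field.
    exact: cospi.
  rewrite cosD e2.
  have -> : 2 * pi / 3 = (pi / 3 : R) *+ 2 by rewrite mulr2n; field.
  by rewrite sin_mulr2n mulr2n => h; rewrite -[RHS]h; ring.
rewrite e2; move: e3 c0; rewrite sin2cos2; move: (cos _) => c e3 c0.
(* The triple angle formula for [cos (3 * x) = -1] at [x = pi / 3]; the sign of [c] excludes the
   root -1. *)
have : (c + 1) * (2 * c - 1) ^+ 2 = 0.
  have -> : (c + 1) * (2 * c - 1) ^+ 2 =
    c * (2 * c ^+ 2 - 1) - 2 * c * (1 - c ^+ 2) + 1 by ring.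
  by rewrite e3; ring.
move/eqP; rewrite mulf_eq0 sqrf_eq0 => /orP[/eqP|/eqP] h; first by lra.
have -> : c = 1 / 2 by lra.
by field.
Qed.

End Euclid.

Section Angles.
Context {R : realType}.
Implicit Types (p q v : (R * R)%type) (s t : R) (k l : 'I_5).
Variable P : pentagon R.
Hypothesis simpleP : simple_pentagon P.
Variable s : R.
Hypothesis oP : oriented P s.

(** An angle below [pi] comes from the first branch of its definition, so points near the vertex in
    the direction [u + w] are in the region. At a reflex corner these points are in the sector of
    the outer side, and at a straight corner [vangle] equals [pi]. The cosine gets a minus sign
    because the first edge is directed towards the vertex. *)
Lemma interior_angle_convex k : interior_angle P k < pi ->
  0 < corner P s k /\ dot (edge P (ord_pred k)) (edge P k) =
  - cos (interior_angle P k) * (eucl_norm (edge P (ord_pred k)) * eucl_norm (edge P k)).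
Proof.
case: (oP) => ss _ hout.
have e0 := edge_neq0 simpleP k; have e'0 := edge_neq0 simpleP (ord_pred k).
have wE : P (ord_pred k) - P k = - edge P (ord_pred k) by rewrite edge_pred opprB.
have w0 : P (ord_pred k) - P k != 0 by rewrite wE oppr_eq0.
have va1 := acos_lepi (vangle_arg e0 w0).
have va0 := acos_ge0 (vangle_arg e0 w0).
rewrite /interior_angle -/(edge P k); case: asboolP => [near0|_]; last first.
  rewrite /vangle => h; exfalso; lra.
move=> hpi; have hd := cos_vangle e0 w0; split; last first.
  have : dot (edge P (ord_pred k)) (edge P k) = - dot (edge P k) (P (ord_pred k) - P k).
    by rewrite wE /dot !coordE; ring.
  by rewrite hd wE eucl_normN => ->; ring.
have [//|c|c] := ltrgt0P (corner P s k).
- exfalso; have [e e0' he] := hout k.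
  have [d d0 hd'] := ball_small (edge P k + (P (ord_pred k) - P k)) e0'.
  have [t [rt t0 td]] : exists t : R, [/\ region P
      (P k + t *: (edge P k + (P (ord_pred k) - P k))), 0 < t & t < d].
    have : ProperFilter (0:R)^'+ by exact: at_right_proper_filter.
    move=> pf; have := filter_ex (filterI near0 (filterI (nbhs_right_gt 0) (nbhs_right_lt d0))).
    by move=> [t [? [? ?]]]; exists t.
  have [_ []//] : ~ outline P (P k + t *: (edge P k + (P (ord_pred k) - P k))) /\
     (~` region P) (P k + t *: (edge P k + (P (ord_pred k) - P k))).
  apply: he; first by apply: hd'; rewrite ger0_norm// ltW.
  have cN : corner P (- s) k = - corner P s k by rewrite /corner mulNr.
  rewrite /sector cN oppr_gt0 c wE.
  have -> : - s * cross (edge P (ord_pred k))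
     (P k + t *: (edge P k - edge P (ord_pred k)) - P k) = t * - corner P s k.
    by rewrite /corner /cross !coordE; ring.
  have -> : - s * cross (edge P k)
     (P k + t *: (edge P k - edge P (ord_pred k)) - P k) = t * - corner P s k.
    by rewrite /corner /cross !coordE; ring.
  by rewrite mulr_gt0// oppr_gt0.
- exfalso; have c0 : cross (edge P (ord_pred k)) (edge P k) = 0.
    move/eqP: c; rewrite /corner mulf_eq0 => /orP[/eqP s0|/eqP//].
    by move: ss; rewrite s0 mul0r => /esym/eqP; rewrite oner_eq0.
  have dd := no_fold simpleP c0.
  move: hpi; rewrite /vangle wE eucl_normN.
  have -> : dot (edge P k) (- edge P (ord_pred k)) =
    - dot (edge P (ord_pred k)) (edge P k) by rewrite /dot !coordE; ring.
  have nn : 0 < eucl_norm (edge P k) * eucl_norm (edge P (ord_pred k)).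
    by rewrite mulr_gt0// eucl_norm_gt0.
  have -> : dot (edge P (ord_pred k)) (edge P k) =
      eucl_norm (edge P k) * eucl_norm (edge P (ord_pred k)).
    apply/eqP; rewrite -(@eqrXn2 _ 2) ?(ltW dd) ?(ltW nn)//; apply/eqP.
    rewrite exprMn !eucl_norm_sqr; have := dot_cross_sqr (edge P (ord_pred k)) (edge P k).
    by rewrite c0 expr0n addr0 => ->; rewrite mulrC.
  by rewrite mulNr divff ?gt_eqF// acosN1 ltxx.
Qed.

Lemma angle_lt_2pi3 k : pi / 2 < interior_angle P k < 2 * pi / 3 ->
  [/\ 0 < corner P s k,
      0 < dot (edge P (ord_pred k)) (edge P k) &
      dot (edge P (ord_pred k)) (edge P k) <
        1 / 2 * (eucl_norm (edge P (ord_pred k)) * eucl_norm (edge P k))].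
Proof.
move=> /andP[h1 h2]; have pi0 : 0 < pi :> R := pi_gt0 R.
have [|c ->] := interior_angle_convex (k := k); first by lra.
have nn : 0 < eucl_norm (edge P (ord_pred k)) * eucl_norm (edge P k).
  by rewrite mulr_gt0// eucl_norm_gt0// edge_neq0.
have l1 : cos (interior_angle P k) < 0.
  by rewrite -(cos_pihalf R) ltr_cos// in_itv/=; lra.
have l2 : - (1 / 2) < cos (interior_angle P k).
  by rewrite -cos_2pi3 ltr_cos// in_itv/=; lra.
by split => //; [rewrite pmulr_lgt0// oppr_gt0|rewrite ltr_pM2r//; lra].
Qed.

End Angles.

(** * Reflex vertices *)

Section Hull.
Context {R : realType}.
Implicit Types (p q v a b c f : (R * R)%type) (s t : R).

Lemma finite_separation (I : finType) (A B : pred I) (x y : I -> R) :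
  (forall i j, A i -> B j -> x i < y j) ->
  exists t, (forall i, A i -> x i < t) /\ (forall j, B j -> t < y j).
Proof.
move=> h; have [i0 Ai0|noA] := pickP A; last first.
  have [j0 Bj0|noB] := pickP B; last first.
    by exists 0; split=> i hi; [have := noA i|have := noB i]; rewrite hi.
  exists (y [arg min_(j < j0 | B j) y j]%O - 1); case: arg_minP => // j Bj hj.
  split=> i; first by rewrite noA.
  by move=> /hj; lra.
have [j0 Bj0|noB] := pickP B; last first.
  exists (x [arg max_(i > i0 | A i) x i]%O + 1); case: arg_maxP => // j Bj hj.
  split=> i; last by rewrite noB.
  by move=> /hj; rewrite /Order.ge /=; lra.
exists ((x [arg max_(i > i0 | A i) x i]%O + y [arg min_(j < j0 | B j) y j]%O) / 2).
case: arg_maxP => // i Ai hi; case: arg_minP => // j Bj hj.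
have ij := h _ _ Ai Bj.
by split=> k; [move=> /hi; rewrite /Order.ge /=|move=> /hj]; lra.
Qed.

(** Helly's theorem on the line: each condition on [t] is a half-line, or trivial, or void; when
    they have no common solution, one or two of them already conflict. *)
Lemma interval_system (I : finType) (a b : I -> R) :
  [\/ exists t, forall i, 0 < a i + t * b i,
      exists2 i, b i = 0 & a i <= 0 |
      exists i j, [/\ 0 < b i, b j < 0 & a i * - b j + a j * b i <= 0]].
Proof.
have [[i bi ai]|no0] := pselect (exists2 i, b i = 0 & a i <= 0).
  by apply: Or32; exists i.
have [h|no2] := pselect (exists i j,
    [/\ 0 < b i, b j < 0 & a i * - b j + a j * b i <= 0]).
  by apply: Or33.
have lt2 i j : 0 < b i -> b j < 0 -> - a i / b i < a j / - b j.
  move=> bi bj; rewrite ltr_pdivrMr// mulrAC ltr_pdivlMr ?oppr_gt0//.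
  rewrite ltNge; apply/negP => h; apply: no2; exists i, j; split => //.
  by move: h; rewrite mulNr; lra.
have [t [h1 h2]] := @finite_separation I (fun i => 0 < b i) (fun j => b j < 0)
  _ _ lt2.
apply: Or31; exists t => i; have [bi|bi|bi] := ltrgt0P (b i).
- by have := h1 i bi; rewrite ltr_pdivrMr//; lra.
- by have := h2 i bi; rewrite ltr_pdivlMr ?oppr_gt0//; lra.
- rewrite bi mulr0 addr0 ltNge; apply/negP => ai; apply: no0; exists i => //.
Qed.

Definition hull n (Q : 'I_n -> R * R) : set (R * R) := [set q |
  exists w : 'I_n -> R, [/\ forall i, 0 <= w i, \sum_i w i = 1,
    \sum_i w i * (Q i).1 = q.1 & \sum_i w i * (Q i).2 = q.2]].

Lemma sum_delta n (i : 'I_n) (c : R) (g : 'I_n -> R) :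
  \sum_x (c * (x == i)%:R) * g x = c * g i.
Proof.
rewrite (bigD1 i)//= eqxx mulr1 big1 ?addr0// => j /negbTE ->.
by rewrite mulr0 mul0r.
Qed.

Lemma hull3_hull n (Q : 'I_n -> R * R) i j l x y z p :
  0 <= x -> 0 <= y -> 0 <= z -> 0 < x + y + z ->
  x *: (p - Q i) + y *: (p - Q j) + z *: (p - Q l) = 0 -> hull Q p.
Proof.
move=> x0 y0 z0 S0 E; set S := x + y + z in S0 *.
have Sn : S != 0 by rewrite gt_eqF.
pose w k := (x / S * (k == i)%:R) + (y / S * (k == j)%:R) + (z / S * (k == l)%:R).
have wg g : \sum_k w k * g k = x / S * g i + y / S * g j + z / S * g l.
  rewrite -!sum_delta -!big_split /=; apply: eq_bigr => k _.
  by rewrite /w; ring.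
exists w; split => [k| | |].
- by rewrite /w !addr_ge0// mulr_ge0 ?ler0n// divr_ge0// ltW.
- under eq_bigr do rewrite -[w _]mulr1.
  by rewrite (wg (fun=> 1)) !mulr1 -!mulrDl divff.
- rewrite wg; have e : x * (p.1 - (Q i).1) + y * (p.1 - (Q j).1) +
      z * (p.1 - (Q l).1) = 0 := congr1 fst E.
  have -> : x / S * (Q i).1 + y / S * (Q j).1 + z / S * (Q l).1 =
     (x * (Q i).1 + y * (Q j).1 + z * (Q l).1) / S by field.
  apply: (mulIf Sn); rewrite divfK// /S.
  by apply/eqP; rewrite -subr_eq0; apply/eqP; rewrite -[RHS]oppr0 -e; ring.
- rewrite wg; have e : x * (p.2 - (Q i).2) + y * (p.2 - (Q j).2) +
      z * (p.2 - (Q l).2) = 0 := congr1 snd E.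
  have -> : x / S * (Q i).2 + y / S * (Q j).2 + z / S * (Q l).2 =
     (x * (Q i).2 + y * (Q j).2 + z * (Q l).2) / S by field.
  apply: (mulIf Sn); rewrite divfK// /S.
  by apply/eqP; rewrite -subr_eq0; apply/eqP; rewrite -[RHS]oppr0 -e; ring.
Qed.

(** With [v] pointing from [Q ord0] to [p], a functional positive on [v] is, up to scaling, [v] over
    [dot v v] plus [t] times a normal. Separation is thus an [interval_system] in [t], and an
    obstruction writes [p] as a combination of [Q ord0] and at most two other points. *)
Lemma hull_separation n (Q : 'I_n.+1 -> R * R) p :
  hull Q p \/ exists f, forall i, dot f (Q i) < dot f p.
Proof.
pose u i := p - Q i; pose v := u ord0.
have [v0|v0] := eqVneq v 0.
  left; apply: (@hull3_hull _ Q ord0 ord0 ord0 1 0 0) => //; rewrite ?addr0//.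
  by rewrite -/(u ord0) -/v v0 !scaler0 !addr0.
have vv := dot_gt0 v0; have vn : dot v v != 0 by rewrite gt_eqF.
have dec i : u i = (dot v (u i) / dot v v) *: v +
    (cross v (u i) / dot v v) *: (- v.2, v.1).
  by move: vn; rewrite /dot /cross => vn; apply: eq_pair; rewrite !coordE /=; field.
have [[t ht]|[i bi ai]|[i [j [bi bj hij]]]] :=
    interval_system (fun i => dot v (u i) / dot v v) (fun i => cross v (u i)).
- right; exists ((dot v v)^-1 *: v + t *: (- v.2, v.1)) => i.
  have := ht i.
  have -> : dot v (u i) / dot v v + t * cross v (u i) =
    dot ((dot v v)^-1 *: v + t *: (- v.2, v.1)) (u i).
    by rewrite {1 3}/dot /cross !coordE /=; ring.
  move: (_ + _) => f h; rewrite -subr_gt0.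
  have -> // : dot f p - dot f (Q i) = dot f (u i).
  by rewrite /u /dot !coordE; ring.
- left; apply: (@hull3_hull _ Q i ord0 ord0 1 (- (dot v (u i) / dot v v)) 0) => //.
  + by rewrite oppr_ge0.
  + by rewrite addr0; lra.
  + rewrite -/(u i) -/(u ord0) -/v {1}dec bi mul0r !scale0r !addr0 scale1r.
    by rewrite scaleNr subrr.
- left; set d := - (dot v (u i) / dot v v * - cross v (u j) +
     dot v (u j) / dot v v * cross v (u i)).
  apply: (@hull3_hull _ Q i j ord0 (- cross v (u j)) (cross v (u i)) d).
  + by rewrite oppr_ge0 ltW.
  + exact: ltW.
  + by rewrite /d oppr_ge0.
  + have : 0 <= d by rewrite /d oppr_ge0.
    by lra.
  + rewrite -/(u i) -/(u j) -/(u ord0) -/v.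
    move: (dec i) (dec j); rewrite /d; move: (dot v (u i)) (dot v (u j)) => ai aj.
    move: (cross v (u i)) (cross v (u j)) => ci cj -> ->.
    by apply: eq_pair; rewrite !coordE /=; ring.
Qed.

(** The reduction step of Caratheodory's theorem; [i] minimizes the time at which a decreasing
    weight vanishes. *)
Lemma hull_drop n (Q : 'I_n -> R * R) (al : 'I_n -> R) p : hull Q p ->
  \sum_i al i = 0 -> \sum_i al i * (Q i).1 = 0 -> \sum_i al i * (Q i).2 = 0 ->
  (exists i, al i < 0) -> exists2 i, al i < 0 &
    exists w : 'I_n -> R, [/\ forall i, 0 <= w i, \sum_i w i = 1, w i = 0,
    \sum_i w i * (Q i).1 = p.1 & \sum_i w i * (Q i).2 = p.2].
Proof.
move=> [w [w0 w1 wx wy]] a1 ax ay [i0 ai0].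
pose i := [arg min_(j < i0 | al j < 0) (w j / - al j)]%O.
have [ai hi] : al i < 0 /\ forall j, al j < 0 -> w i / - al i <= w j / - al j.
  by rewrite /i; case: arg_minP => // k.
exists i => //; pose t := w i / - al i.
have t0 : 0 <= t by rewrite /t divr_ge0 ?oppr_ge0 ?(ltW ai).
exists (fun j => w j + t * al j); split => [j| | | |].
- have [aj|aj] := ltP (al j) 0; last by apply: addr_ge0 => //; exact: mulr_ge0.
  by have := hi j aj; rewrite -/t ler_pdivlMr ?oppr_gt0//; lra.
- by rewrite big_split /= -mulr_sumr a1 w1 mulr0 addr0.
- by rewrite /t invrN mulrN mulNr divfK ?subrr// lt_eqF.
- under eq_bigr do rewrite mulrDl -mulrA.
  by rewrite big_split /= -mulr_sumr ax wx mulr0 addr0.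
- under eq_bigr do rewrite mulrDl -mulrA.
  by rewrite big_split /= -mulr_sumr ay wy mulr0 addr0.
Qed.

(** The default of [nth] is the entry of index 3, here and in [hull3_without]. *)
Definition quad (q0 q1 q2 q3 : R * R) (i : 'I_4) : R * R :=
  nth q3 [:: q0; q1; q2] i.

Definition hull3_without q0 q1 q2 q3 (i : 'I_4) : set (R * R) :=
  nth (hull3 q0 q1 q2) [:: hull3 q1 q2 q3; hull3 q0 q2 q3; hull3 q0 q1 q3] i.

Lemma sum4 (F : 'I_4 -> R) : \sum_i F i = F (@Ordinal 4 0 isT) +
  F (@Ordinal 4 1 isT) + F (@Ordinal 4 2 isT) + F (@Ordinal 4 3 isT).
Proof.
rewrite !big_ord_recr big_ord0 /= add0r.
by do !congr (_ + _); congr F; apply: ord_inj.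
Qed.

Lemma hull_without q0 q1 q2 q3 (i : 'I_4) p (w : 'I_4 -> R) :
  (forall i, 0 <= w i) -> \sum_i w i = 1 -> w i = 0 ->
  \sum_i w i * (quad q0 q1 q2 q3 i).1 = p.1 ->
  \sum_i w i * (quad q0 q1 q2 q3 i).2 = p.2 ->
  hull3_without q0 q1 q2 q3 i p.
Proof.
rewrite !sum4 /quad /= => w0 w1 wi px py.
have := w0 (@Ordinal 4 0 isT); have := w0 (@Ordinal 4 1 isT).
have := w0 (@Ordinal 4 2 isT); have := w0 (@Ordinal 4 3 isT).
move: w1 px py wi {w0}.
set x0 := w _; set x1 := w _; set x2 := w _; set x3 := w _.
case: i => [[|[|[|[|i]]]] hi] //= w1 px py wi h3 h2 h1 h0; rewrite /hull3_without /=.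
- have {}wi : x0 = 0 by rewrite -wi; congr (w _); exact: ord_inj.
  rewrite wi in w1 px py; exists x1, x2, x3; split => //; first by rewrite -w1; ring.
  by apply: eq_pair; rewrite !coordE -?px -?py; ring.
- have {}wi : x1 = 0 by rewrite -wi; congr (w _); exact: ord_inj.
  rewrite wi in w1 px py; exists x0, x2, x3; split => //; first by rewrite -w1; ring.
  by apply: eq_pair; rewrite !coordE -?px -?py; ring.
- have {}wi : x2 = 0 by rewrite -wi; congr (w _); exact: ord_inj.
  rewrite wi in w1 px py; exists x0, x1, x3; split => //; first by rewrite -w1; ring.
  by apply: eq_pair; rewrite !coordE -?px -?py; ring.
- have {}wi : x3 = 0 by rewrite -wi; congr (w _); exact: ord_inj.
  rewrite wi in w1 px py; exists x0, x1, x2; split => //; first by rewrite -w1; ring.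
  by apply: eq_pair; rewrite !coordE -?px -?py; ring.
Qed.

(* Moving [p] along an affine dependency of the four points, in either
   direction, until a weight vanishes, puts [p] in two different triangles. *)
Lemma hull_double_cover q0 q1 q2 q3 p : hull (quad q0 q1 q2 q3) p ->
  [\/ tri q1 q2 q3 != 0, tri q0 q2 q3 != 0, tri q0 q1 q3 != 0 | tri q0 q1 q2 != 0] ->
  exists i j, [/\ i != j, hull3_without q0 q1 q2 q3 i p &
    hull3_without q0 q1 q2 q3 j p].
Proof.
move=> hp nz.
(* The signed areas of the four triangles, with alternating signs, are the coefficients of the
   affine dependency of four points of the plane. *)
pose al (i : 'I_4) : R :=
  nth (- tri q0 q1 q2) [:: tri q1 q2 q3; - tri q0 q2 q3; tri q0 q1 q3] i.
have a1 : \sum_i al i = 0.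
  by rewrite sum4 /al /= /tri /cross !coordE; ring.
have ax : \sum_i al i * (quad q0 q1 q2 q3 i).1 = 0.
  by rewrite sum4 /al /= /tri /cross !coordE; ring.
have ay : \sum_i al i * (quad q0 q1 q2 q3 i).2 = 0.
  by rewrite sum4 /al /= /tri /cross !coordE; ring.
have [k ak] : exists k, al k != 0.
  by case: nz => h; [exists (@Ordinal 4 0 isT)|exists (@Ordinal 4 1 isT)|
    exists (@Ordinal 4 2 isT)|exists (@Ordinal 4 3 isT)]; rewrite /al //= oppr_eq0.
have [neg pos] : (exists i, al i < 0) /\ (exists i, - al i < 0).
  split; apply: contrapT => no.
    have p0 i : 0 <= al i by rewrite leNgt; apply/negP => h; apply: no; exists i.
    by have := @psumr_eq0P _ _ predT al (fun i _ => p0 i) a1 k isT => h; rewrite h eqxx in ak.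
  have p0 i : 0 <= - al i by rewrite leNgt; apply/negP => h; apply: no; exists i.
  have b1 : \sum_i - al i = 0 by rewrite sumrN a1 oppr0.
  have := @psumr_eq0P _ _ predT (fun i => - al i) (fun i _ => p0 i) b1 k isT => /eqP.
  by rewrite oppr_eq0 (negbTE ak).
have [i ai [w [w0 w1 wi wx wy]]] := hull_drop hp a1 ax ay neg.
have [j aj [w' [w'0 w'1 wj w'x w'y]]] : exists2 i, - al i < 0 &
    exists w : 'I_4 -> R, [/\ forall i, 0 <= w i, \sum_i w i = 1, w i = 0,
    \sum_i w i * (quad q0 q1 q2 q3 i).1 = p.1 &
    \sum_i w i * (quad q0 q1 q2 q3 i).2 = p.2].
  apply: hull_drop => //; under eq_bigr do rewrite ?mulNr; rewrite sumrN.
  - by rewrite a1 oppr0.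
  - by rewrite ax oppr0.
  - by rewrite ay oppr0.
exists i, j; split; [|exact: hull_without wi wx wy|exact: hull_without wj w'x w'y].
by apply: contraTneq ai => ->; rewrite -leNgt -oppr_le0 ltW.
Qed.

Section Reflex.
Variables (P : pentagon R) (s : R) (m : 'I_5).
Hypothesis simpleP : simple_pentagon P.
Hypothesis oP : oriented P s.
Hypothesis reflex : corner P s m <= 0.

Let Q := quad (P (ordS m)) (P (ordS (ordS m))) (P (ordS (ordS (ordS m))))
  (P (ordS (ordS (ordS (ordS m))))).

Lemma region_strict_halfplane f p : (forall k, dot f (P k) < dot f p) ->
  ~ region P p.
Proof.
move=> h; pose k := [arg max_(i > (ord0 : 'I_5)) dot f (P i)]%O.
have hk i : dot f (P i) <= dot f (P k) by rewrite /k; case: arg_maxP => // j _ /(_ i); exact.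
by move=> /(region_halfplane hk); rewrite leNgt h.
Qed.

(** A functional [f] with a strict maximum over the vertices at [P m] would also bound the region.
    At a reflex corner, the region contains points slightly off [P m] in the direction [e' - e],
    where [f] is larger. At a straight corner, [e] is a positive multiple of [e'], and [f] cannot
    increase along [e'] and decrease along [e]. *)
Lemma reflex_hull : hull Q (P m).
Proof.
have [//|[f hf]] := hull_separation Q (P m); exfalso.
case: (oP) => ss hin _.
have h0 : dot f (P (ordS m)) < dot f (P m) by exact: (hf (@Ordinal 4 0 isT)).
have h3 : dot f (P (ord_pred m)) < dot f (P m).
  by rewrite ord_predE; exact: (hf (@Ordinal 4 3 isT)).
have h1 : dot f (P (ordS (ordS m))) < dot f (P m) by exact: (hf (@Ordinal 4 1 isT)).
have h2 : dot f (P (ordS (ordS (ordS m)))) < dot f (P m).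
  exact: (hf (@Ordinal 4 2 isT)).
have le k : dot f (P k) <= dot f (P m).
  have [->//|n0] := eqVneq k m.
  have [->|n1] := eqVneq k (ordS m); first exact: ltW.
  have [->|n2] := eqVneq k (ordS (ordS m)); first exact: ltW.
  have [->|n3] := eqVneq k (ordS (ordS (ordS m))); first exact: ltW.
  have -> : k = ord_pred m; last exact: ltW.
  apply/eqP; move: n0 n1 n2 n3; clear.
  by case: m => [[|[|[|[|[|?]]]]] ?] //; case: k => [[|[|[|[|[|?]]]]] ?].
set e' := edge P (ord_pred m); set e := edge P m.
have e'0 : 0 < dot f e' by rewrite /e' edge_pred /dot !coordE; move: h3; rewrite /dot; lra.
have e0 : dot f e < 0 by rewrite /e /edge /dot !coordE; move: h0; rewrite /dot; lra.
have [c|c|c] := ltrgt0P (corner P s m); first by move: reflex; rewrite leNgt c.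
- have [r r0 hr] := hin m.
  have [d d0 hd] := ball_small (e' - e) r0.
  have d20 : 0 < d / 2 by lra.
  have [_ rq] : ~ outline P (P m + (d / 2) *: (e' - e)) /\
      region P (P m + (d / 2) *: (e' - e)).
    apply: hr; first by apply: hd; rewrite ger0_norm; lra.
    rewrite /sector ltNge reflex /=.
    have -> : s * cross (edge P (ord_pred m)) (P m + (d / 2) *: (e' - e) - P m) =
       d / 2 * - corner P s m.
      by rewrite /corner /e /e' /cross !coordE; ring.
    by rewrite mulr_gt0 ?oppr_gt0.
  have := region_halfplane le rq.
  have -> : dot f (P m + (d / 2) *: (e' - e)) =
    dot f (P m) + d / 2 * (dot f e' - dot f e) by rewrite /dot !coordE; ring.
  by rewrite gerDl leNgt mulr_gt0//; lra.
- have c0 : cross e' e = 0.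
    move/eqP: c; rewrite /corner mulf_eq0 => /orP[/eqP s0|/eqP//].
    by move: ss; rewrite s0 mul0r => /esym/eqP; rewrite oner_eq0.
  have dd := no_fold simpleP c0.
  have en0 := edge_neq0 simpleP (ord_pred m).
  have E := cross_eq0 en0 c0.
  move: e0; rewrite /e in E *; rewrite E.
  have -> (t : R) : dot f (t *: edge P (ord_pred m)) = t * dot f e'.
    by rewrite /e' /dot !coordE; ring.
  by rewrite ltNge mulr_ge0// ?(ltW e'0)// divr_ge0 ?dot_ge0// ltW.
Qed.

(** By [reflex_hull], a half-plane that contains the four points also contains [P m], hence the
    whole region. *)
Lemma region_hull : region P `<=` hull Q.
Proof.
move=> p rp; have [//|[f hf]] := hull_separation Q p; exfalso.
apply: (@region_strict_halfplane f p _ rp) => k.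
have h0 : dot f (P (ordS m)) < dot f p by exact: (hf (@Ordinal 4 0 isT)).
have h3 : dot f (P (ord_pred m)) < dot f p.
  by rewrite ord_predE; exact: (hf (@Ordinal 4 3 isT)).
have h1 : dot f (P (ordS (ordS m))) < dot f p by exact: (hf (@Ordinal 4 1 isT)).
have h2 : dot f (P (ordS (ordS (ordS m)))) < dot f p.
  exact: (hf (@Ordinal 4 2 isT)).
have [->|n0] := eqVneq k m.
  have [w [w0 w1 wx wy]] := reflex_hull.
  rewrite [ltLHS]/dot -wx -wy !mulr_sumr -big_split /=.
  have -> : dot f p = \sum_i w i * dot f p by rewrite -mulr_suml w1 mul1r.
  rewrite -subr_gt0 -sumrB.
  have F0 i : 0 <= w i * dot f p - (f.1 * (w i * (Q i).1) + f.2 * (w i * (Q i).2)).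
    have -> : w i * dot f p - (f.1 * (w i * (Q i).1) + f.2 * (w i * (Q i).2)) =
      w i * (dot f p - dot f (Q i)) by rewrite /dot; ring.
    by rewrite mulr_ge0// subr_ge0 ltW.
  rewrite lt_neqAle sumr_ge0 ?andbT => [|i _]; last exact: F0.
  apply/eqP => /esym /(psumr_eq0P (fun i _ => F0 i)) h.
  have wz i : w i = 0.
    have := h i isT.
    have -> : w i * dot f p - (f.1 * (w i * (Q i).1) + f.2 * (w i * (Q i).2)) =
      w i * (dot f p - dot f (Q i)) by rewrite /dot; ring.
    by move/eqP; rewrite mulf_eq0 subr_eq0 (gt_eqF (hf i)) orbF => /eqP.
  by move: w1; rewrite big1// => /esym/eqP; rewrite oner_eq0.
have [->//|n1] := eqVneq k (ordS m).
have [->//|n2] := eqVneq k (ordS (ordS m)).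
have [->//|n3] := eqVneq k (ordS (ordS (ordS m))).
have -> // : k = ord_pred m.
apply/eqP; move: n0 n1 n2 n3; clear.
by case: m => [[|[|[|[|[|?]]]]] ?] //; case: k => [[|[|[|[|[|?]]]]] ?].
Qed.

End Reflex.
End Hull.

(** * Area *)

Section PlaneMeasure.
Context {R : realType}.
Implicit Types (p q a b c : (R * R)%type) (A : set (R * R)).

Notation mu := (@lebesgue_measure R).

Notation plane_measurable A :=
  (measurable (A : set (measurableTypeR R * measurableTypeR R))).

(** The sigma-algebra is the product one, hence the countable union of open squares with rational
    centres; [F i] is empty unless its square is contained in [A]. *)
Lemma open_plane_measurable A : open A -> plane_measurable A.
Proof.
move=> oA.
pose F (i : rat * rat * nat) : set (R * R) :=
  [set q | ball ((ratr i.1.1, ratr i.1.2) : R * R) i.2.+1%:R^-1 `<=` A /\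
    ball ((ratr i.1.1, ratr i.1.2) : R * R) i.2.+1%:R^-1 q].
have -> : A = \bigcup_i F i.
  apply/seteqP; split => [q Aq|q [i _ [+]]]; last by move=> /[apply].
  have /nbhs_ballP[e e0 he] : nbhs q A by apply: open_nbhs_nbhs.
  have [n _ hn] : exists2 n, True & n.+1%:R^-1 < e / 2.
    have e2 : 0 < e / 2 by rewrite divr_gt0.
    by have [n hn] := ltr_add_invr e2; exists n => //; rewrite add0r in hn.
  set d : R := n.+1%:R^-1 in hn.
  have d0 : 0 < d by rewrite invr_gt0.
  have [x xq] : exists x : rat, q.1 - d < ratr x < q.1 + d.
    have [x] := @rat_in_itvoo R (q.1 - d) (q.1 + d) ltac:(lra).
    by rewrite in_itv => ?; exists x.
  have [y yq] : exists y : rat, q.2 - d < ratr y < q.2 + d.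
    have [y] := @rat_in_itvoo R (q.2 - d) (q.2 + d) ltac:(lra).
    by rewrite in_itv => ?; exists y.
  have bq : ball ((ratr x, ratr y) : R * R) d q.
    by apply/ball_plane => /=; rewrite !ltr_norml; split; lra.
  exists (x, y, n) => //; split => //= z bz; apply: he.
  have : ball q (d + d) z by apply: ball_triangle bz; exact: ball_sym.
  by apply: le_ball; lra.
apply: countable_bigcupT_measurable => // i.
have [sub|nsub] := pselect (ball ((ratr i.1.1, ratr i.1.2) : R * R) i.2.+1%:R^-1 `<=` A).
  have -> : F i = ball (ratr i.1.1 : R) i.2.+1%:R^-1 `*` ball (ratr i.1.2 : R) i.2.+1%:R^-1.
    by apply/seteqP; split => [q [_ []]|q []].
  by apply: measurableX; apply: open_measurable; exact: ball_open.
have -> : F i = set0 by rewrite -subset0 => q [].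
exact: measurable0.
Qed.

Lemma closed_plane_measurable A : closed A -> plane_measurable A.
Proof.
move=> cA; rewrite -(setCK A); apply: measurableC; apply: open_plane_measurable.
exact: closed_openC.
Qed.

(** Vertical sections of [A] are only required to lie between an open and a closed interval of the
    same length, so open and closed figures are treated alike. *)
Lemma area_strip A (D : set R) (l u : R -> R) : measurable D ->
  plane_measurable A -> (forall x, D x -> l x <= u x) ->
  (forall x y, D x -> l x < y < u x -> A (x, y)) ->
  (forall x y, A (x, y) -> D x /\ l x <= y <= u x) ->
  area A = (\int[mu]_(x in D) (u x - l x)%:E)%E.
Proof.
move=> mD mA lu sub sup; rewrite /area /product_measure1 [RHS]integral_mkcond.
apply: eq_integral => x _ /=; rewrite patchE.
have mx : measurable (xsection A x) by exact: measurable_xsection.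
case: ifPn => [/set_mem Dx|/negP nD].
  apply/eqP; rewrite eq_le; apply/andP; split.
    have -> : (u x - l x)%:E = mu `[l x, u x]%classic.
      rewrite lebesgue_measure_itv /= lte_fin -EFinB; case: ltP => // ul.
      by congr EFin; have := lu x Dx; lra.
    apply: le_measure; rewrite ?inE//.
    by move=> y /xsectionP /sup[_]; rewrite /= in_itv.
  have -> : (u x - l x)%:E = mu `]l x, u x[%classic.
    rewrite lebesgue_measure_itv /= lte_fin -EFinB; case: ltP => // ul.
    by congr EFin; have := lu x Dx; lra.
  apply: le_measure; rewrite ?inE//.
  by move=> y; rewrite /= in_itv /= => /(sub _ _ Dx) h; apply/xsectionP.
have -> : xsection A x = set0.
  by rewrite -subset0 => y /xsectionP /sup[Dx _]; apply: nD; exact: mem_set.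
by rewrite measure0.
Qed.

Lemma is_derive_FTC2 (f F : R -> R) (a b : R) : a < b ->
  {within `[a, b], continuous f} ->
  (forall x, a <= x <= b -> is_derive x 1 F (f x)) ->
  (\int[mu]_(x in `[a, b]) (f x)%:E = (F b - F a)%:E)%E.
Proof.
move=> ab cf dF; rewrite EFinB; apply: continuous_FTC2 => //.
  have cF x : a <= x <= b -> {for x, continuous F}.
    move=> /dF h; apply: differentiable_continuous; apply/derivable1_diffP.
    by case: h.
  split => [x| |].
  - by rewrite in_itv/= => /andP[ax xb]; have [] := dF x ltac:(lra).
  - by apply: cvg_at_right_filter; apply: cF; lra.
  - by apply: cvg_at_left_filter; apply: cF; lra.
move=> x; rewrite in_itv/= => /andP[ax xb].
by rewrite derive1E; have h := dF x ltac:(lra); rewrite derive_val.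
Qed.

Lemma integral_affine (a b u v : R) : a <= b ->
  (\int[mu]_(x in `[a, b]) (u * x + v)%:E =
    ((b - a) * ((u * a + v) + (u * b + v)) / 2)%:E)%E.
Proof.
rewrite le_eqVlt => /predU1P[->|ab].
  by rewrite set_itv1 integral_set1 subrr !mul0r.
have cf : {within `[a, b], continuous (fun x => u * x + v)}.
  apply: continuous_subspaceT => x; apply: cvgD; last exact: cvg_cst.
  by apply: cvgM; [exact: cvg_cst|exact: cvg_id].
pose F (x : R) := (u / 2) * x ^+ 2 + v * x.
have dF x : a <= x <= b -> is_derive x 1 F (u * x + v).
  move=> _; apply: is_derive_eq.
  by rewrite /GRing.scale /= !mulr1; field.
by rewrite (is_derive_FTC2 ab cf dF) /F; congr EFin; field.
Qed.

Lemma halfplane_measurable (x y z : R) :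
  plane_measurable [set q | 0 <= x * q.1 + y * q.2 + z] /\
  plane_measurable [set q | 0 < x * q.1 + y * q.2 + z].
Proof.
have c : continuous (fun q : R * R => x * q.1 + y * q.2 + z).
  move=> q; apply: cvgD; last exact: cvg_cst.
  apply: cvgD; apply: cvgM; (try exact: cvg_cst); first exact: cvg_fst.
  exact: cvg_snd.
split.
  apply: closed_plane_measurable.
  apply: (@closed_comp _ _ _ [set x : R | 0 <= x]); last exact: closed_ge.
  by move=> ? _; exact: c.
apply: open_plane_measurable.
apply: (@open_comp _ _ _ [set x : R | 0 < x]); last exact: open_gt.
by move=> ? _; exact: c.
Qed.

Section HalfTriangle.
Variables (px py be lo hi : R).
Hypothesis pb : px != be.
Hypothesis lohi : lo <= hi.

Let t (x : R) := (x - px) / (be - px).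

(** A triangle with apex [(px, py)] and a vertical opposite side, at abscissa [be] between the
    heights [lo] and [hi]. The apex may be to the left or to the right of this side; [t] is the
    fraction of the way from the apex to it. *)
Definition half_closed : set (R * R) := [set q | [/\ 0 <= t q.1, t q.1 <= 1,
  py + t q.1 * (lo - py) <= q.2 & q.2 <= py + t q.1 * (hi - py)]].

Definition half_open : set (R * R) := [set q | [/\ 0 < t q.1, t q.1 < 1,
  py + t q.1 * (lo - py) < q.2 & q.2 < py + t q.1 * (hi - py)]].

Let d0 : be - px != 0. Proof. by rewrite subr_eq0 eq_sym. Qed.

Let tE x : t x = (be - px)^-1 * x + - (px / (be - px)).
Proof. by rewrite /t; field. Qed.

Lemma half_closed_measurable : plane_measurable half_closed.
Proof.
have -> : half_closed =
    [set q | 0 <= (be - px)^-1 * q.1 + 0 * q.2 + - (px / (be - px))] `&`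
    [set q | 0 <= - (be - px)^-1 * q.1 + 0 * q.2 + (1 + px / (be - px))] `&`
    [set q | 0 <= - ((be - px)^-1 * (lo - py)) * q.1 + 1 * q.2 +
       (px / (be - px) * (lo - py) - py)] `&`
    [set q | 0 <= ((be - px)^-1 * (hi - py)) * q.1 + (-1) * q.2 +
       (py - px / (be - px) * (hi - py))].
  apply/seteqP; split => q.
    move=> [h1 h2 h3 h4]; rewrite !tE in h1 h2 h3 h4.
    by do 3?split; rewrite /=; lra.
  by move=> [[[/= h1 h2] h3] h4]; split; rewrite !tE; lra.
apply: measurableI; [apply: measurableI; [apply: measurableI|]|];
  exact: (halfplane_measurable _ _ _).1.
Qed.

Lemma half_open_measurable : plane_measurable half_open.
Proof.
have -> : half_open =
    [set q | 0 < (be - px)^-1 * q.1 + 0 * q.2 + - (px / (be - px))] `&`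
    [set q | 0 < - (be - px)^-1 * q.1 + 0 * q.2 + (1 + px / (be - px))] `&`
    [set q | 0 < - ((be - px)^-1 * (lo - py)) * q.1 + 1 * q.2 +
       (px / (be - px) * (lo - py) - py)] `&`
    [set q | 0 < ((be - px)^-1 * (hi - py)) * q.1 + (-1) * q.2 +
       (py - px / (be - px) * (hi - py))].
  apply/seteqP; split => q.
    move=> [h1 h2 h3 h4]; rewrite !tE in h1 h2 h3 h4.
    by do 3?split; rewrite /=; lra.
  by move=> [[[/= h1 h2] h3] h4]; split; rewrite !tE; lra.
apply: measurableI; [apply: measurableI; [apply: measurableI|]|];
  exact: (halfplane_measurable _ _ _).2.
Qed.

Let lo_x := Num.min px be.
Let hi_x := Num.max px be.

Let bounds (x : R) : ((0 <= t x <= 1) = (lo_x <= x <= hi_x)) *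
  ((0 < t x < 1) = (lo_x < x < hi_x)).
Proof.
rewrite /t /lo_x /hi_x; have [h|h|h] := ltgtP px be; last by move: pb; rewrite h eqxx.
- have dp : 0 < be - px by rewrite subr_gt0.
  rewrite ler_pdivlMr// ler_pdivrMr// ltr_pdivlMr// ltr_pdivrMr// !mul0r !mul1r.
  by rewrite subr_ge0 lerD2r subr_gt0 ltrD2r.
- have dp : be - px < 0 by rewrite subr_lt0.
  rewrite ler_ndivlMr// ler_ndivrMr// ltr_ndivlMr// ltr_ndivrMr// !mul0r !mul1r.
  by rewrite subr_le0 lerD2r subr_lt0 ltrD2r; split; rewrite andbC.
Qed.

Let lohi_x : lo_x <= hi_x.
Proof. by rewrite /lo_x /hi_x ge_min le_max lexx. Qed.

Let widths : (\int[mu]_(x in `[lo_x, hi_x])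
    ((py + t x * (hi - py)) - (py + t x * (lo - py)))%:E =
  (`|be - px| * (hi - lo) / 2)%:E)%E.
Proof.
rewrite [LHS](_ : _ = (\int[mu]_(x in `[lo_x, hi_x]) (((hi - lo) / (be - px)) * x +
    - ((hi - lo) * (px / (be - px))))%:E)%E); last first.
  by apply: eq_integral => x _; congr EFin; rewrite tE; ring.
rewrite integral_affine//; congr EFin; rewrite /lo_x /hi_x.
have [h|h] := leP px be.
  by rewrite ger0_norm ?subr_ge0//; field.
by rewrite ltr0_norm ?subr_lt0//; field.
Qed.

Let le_lu x : 0 <= t x <= 1 -> py + t x * (lo - py) <= py + t x * (hi - py).
Proof. by move=> /andP[t0 _]; rewrite lerD2l ler_wpM2l// lerD2r. Qed.

Lemma half_closed_area : area half_closed = (`|be - px| * (hi - lo) / 2)%:E.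
Proof.
rewrite -widths; apply: (area_strip (l := fun x => py + t x * (lo - py))
  (u := fun x => py + t x * (hi - py))).
- exact: measurable_itv.
- exact: half_closed_measurable.
- by move=> x /=; rewrite in_itv /= -bounds; exact: le_lu.
- by move=> x y /=; rewrite in_itv /= -bounds => /andP[? ?] /andP[/ltW ? /ltW ?]; split.
- by move=> x y [/= h1 h2 h3 h4]; rewrite in_itv /= -bounds h1 h2 h3 h4.
Qed.

Lemma half_open_area : area half_open = (`|be - px| * (hi - lo) / 2)%:E.
Proof.
rewrite -widths integral_itv_bndoo; last first.
  apply/measurable_EFinP; apply: measurable_funTS.
  have -> : (fun x => (py + t x * (hi - py)) - (py + t x * (lo - py))) =
    (fun x => ((hi - lo) / (be - px)) * x + - ((hi - lo) * (px / (be - px)))).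
    by apply/funext => x; rewrite tE; ring.
  by apply: measurable_funD => //; apply: measurable_funM.
apply: (area_strip (l := fun x => py + t x * (lo - py))
  (u := fun x => py + t x * (hi - py))).
- exact: measurable_itv.
- exact: half_open_measurable.
- move=> x /=; rewrite in_itv /= -bounds => /andP[h1 h2]; apply: le_lu.
  by rewrite !ltW.
- by move=> x y /=; rewrite in_itv /= -bounds => /andP[? ?] /andP[? ?]; split.
- move=> x y [/= h1 h2 h3 h4]; rewrite in_itv /= -bounds h1 h2.
  by rewrite (ltW h3) (ltW h4).
Qed.

End HalfTriangle.

Lemma hull3_perm a b c q : hull3 a b c q -> hull3 b a c q /\ hull3 a c b q.
Proof.
move=> [x [y [z [x0 y0 z0 e ->]]]]; split.
  by exists y, x, z; split => //; [rewrite -e; ring|apply: eq_pair; rewrite !coordE; ring].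
by exists x, z, y; split => //; [rewrite -e; ring|apply: eq_pair; rewrite !coordE; ring].
Qed.

(** The factors [tri a b c] make this open triangle independent of the orientation. *)
Definition inside3 a b c : set (R * R) := [set q | [/\ 0 < tri a b q * tri a b c,
  0 < tri b c q * tri a b c & 0 < tri c a q * tri a b c]].

Lemma inside3_perm a b c q : inside3 a b c q -> inside3 b a c q /\ inside3 a c b q.
Proof.
have e1 : tri b a q = - tri a b q by rewrite tri_swap.
have e2 : tri c b q = - tri b c q by rewrite tri_swap.
have e3 : tri a c q = - tri c a q by rewrite tri_swap.
have e4 : tri b a c = - tri a b c by rewrite tri_swap.
have e5 : tri a c b = - tri a b c by rewrite -tri_rot tri_swap tri_rot.
by move=> [h1 h2 h3]; rewrite /inside3 /= e1 e2 e3 e4 e5 !mulrNN.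
Qed.

(** Measurable approximations from outside and from inside, of the expected area, so that boundaries
    do not matter. *)
Definition triangle_measure (a b c : R * R) :=
  (exists M, [/\ plane_measurable M, hull3 a b c `<=` M &
     (area M <= (`|tri a b c| / 2)%:E)%E]) /\
  (exists M, [/\ plane_measurable M, M `<=` inside3 a b c &
     ((`|tri a b c| / 2)%:E <= area M)%E]).

Lemma triangle_measure_perm a b c : triangle_measure a b c ->
  triangle_measure b a c /\ triangle_measure a c b.
Proof.
have e4 : tri b a c = - tri a b c by rewrite tri_swap.
have e5 : tri a c b = - tri a b c by rewrite -tri_rot tri_swap tri_rot.
move=> [[M [m1 m2 m3]] [M' [n1 n2 n3]]].
split; (split; [exists M|exists M']; split; rewrite ?e4 ?e5 ?normrN//).
- by move=> q /hull3_perm[h _]; exact: m2.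
- by move=> q /n2 /inside3_perm[].
- by move=> q /hull3_perm[_ h]; exact: m2.
- by move=> q /n2 /inside3_perm[].
Qed.

Lemma area0 : area (set0 : set (R * R)) = 0%E.
Proof. exact: measure0. Qed.

Lemma area_vertical (x : R) : area [set q : R * R | q.1 = x] = 0%E.
Proof.
have -> : [set q : R * R | q.1 = x] = [set x] `*` setT.
  by apply/seteqP; split => [q /= ->//|q [/= ->]].
rewrite /area product_measure1E//=.
have -> : mu [set x] = 0%E by rewrite lebesgue_measure_set1.
by rewrite mul0e.
Qed.

Lemma areaU_le (M N : set (R * R)) (x y : R) : plane_measurable M ->
  plane_measurable N -> (area M <= x%:E)%E -> (area N <= y%:E)%E ->
  (area (M `|` N) <= (x + y)%:E)%E.
Proof.
move=> mM mN hM hN; apply: (le_trans (measureU2 _ mM mN)).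
by rewrite EFinD; exact: leeD.
Qed.

Lemma area_disjointU (M N : set (R * R)) : plane_measurable M ->
  plane_measurable N -> M `&` N = set0 -> area (M `|` N) = (area M + area N)%E.
Proof. by move=> mM mN MN; rewrite /area measureU. Qed.

(* The triangle is cut along the vertical line through [b] into two triangles
   with a vertical side. *)
Lemma triangle_measure_sorted a b c : a.1 <= b.1 -> b.1 <= c.1 ->
  triangle_measure a b c.
Proof.
move=> ab bc; have [ac|ac] := eqVneq a.1 c.1.
  have b1 : b.1 = a.1 by apply/eqP; rewrite eq_le ab ac bc.
  have T0 : tri a b c = 0.
    by rewrite /tri /cross !coordE b1 -ac; ring.
  have mv : plane_measurable [set q : R * R | q.1 = a.1].
    have -> : [set q : R * R | q.1 = a.1] = [set a.1] `*` setT.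
      by apply/seteqP; split => [q /= ->//|q [/= ->]].
    exact: measurableX.
  rewrite /triangle_measure T0 normr0 mul0r; split.
    exists [set q | q.1 = a.1]; split => //; last by rewrite area_vertical.
    move=> q [x [y [z [_ _ _ e ->]]]].
    have /= -> : (x *: a + y *: b + z *: c).1 = x * a.1 + y * b.1 + z * c.1 by [].
    by rewrite b1 -ac -!mulrDl e mul1r.
  by exists set0; split; [exact: measurable0|by []|rewrite area0].
have {ac}ac : a.1 < c.1 by rewrite lt_neqAle ac (le_trans ab bc).
have dn : c.1 - a.1 != 0 by rewrite subr_eq0 gt_eqF.
(* [m] is the slope of the line [ac], [d2] its height at the abscissa of [b], and [h] the signed
   height of [b] above it. *)
pose m := (c.2 - a.2) / (c.1 - a.1).
pose d2 := a.2 + (b.1 - a.1) * m.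
pose h := b.2 - d2.
have c2 : c.2 = a.2 + (c.1 - a.1) * m by rewrite /m mulrC divfK// addrC subrK.
have b2 : b.2 = d2 + h by rewrite /h addrC subrK.
pose lo := Num.min d2 b.2; pose hi := Num.max d2 b.2.
have lohi : lo <= hi by rewrite /lo /hi ge_min le_max lexx.
have hl : hi - lo = `|h|.
  by rewrite /hi /lo /h; case: (leP d2 b.2) => hh;
     [rewrite ger0_norm ?subr_ge0|rewrite ltr0_norm ?subr_lt0//; ring].
have TE : tri a b c = - h * (c.1 - a.1).
  by rewrite /tri /cross !coordE c2 b2 /d2; ring.
have TN : `|tri a b c| = `|h| * (c.1 - a.1).
  by rewrite TE normrM normrN [`|c.1 - a.1|]gtr0_norm ?subr_gt0.
(* the height above the line [ac] lies between those of the two bounds *)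
have btw (t y : R) : 0 <= y <= t -> t * (lo - d2) <= y * h <= t * (hi - d2).
  rewrite /lo /hi; case: (leP d2 b.2) => hh /andP[y0 yt].
    have h0 : 0 <= h by rewrite subr_ge0.
    by rewrite subrr mulr0 mulr_ge0//= -/h ler_wpM2r.
  have h0 : h <= 0 by rewrite subr_le0 ltW.
  by rewrite subrr mulr0 mulr_ge0_le0// andbT -/h ler_wnM2r.
split.
- pose M1 := if a.1 == b.1 then set0 else half_closed a.1 a.2 b.1 lo hi.
  pose M2 := if c.1 == b.1 then set0 else half_closed c.1 c.2 b.1 lo hi.
  have m1 : plane_measurable M1.
    by rewrite /M1; case: eqVneq => [_|?]; [exact: measurable0|exact: half_closed_measurable].
  have m2 : plane_measurable M2.
    by rewrite /M2; case: eqVneq => [_|?]; [exact: measurable0|exact: half_closed_measurable].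
  have a1 : (area M1 <= ((b.1 - a.1) * `|h| / 2)%:E)%E.
    rewrite /M1; case: eqVneq => [->|e]; first by rewrite area0 subrr !mul0r.
    by rewrite half_closed_area// hl ger0_norm ?subr_ge0.
  have a2 : (area M2 <= ((c.1 - b.1) * `|h| / 2)%:E)%E.
    rewrite /M2; case: eqVneq => [->|e]; first by rewrite area0 subrr !mul0r.
    by rewrite half_closed_area// hl distrC ger0_norm ?subr_ge0.
  exists (M1 `|` M2); split; [exact: measurableU| |]; last first.
    have -> : `|tri a b c| / 2 = (b.1 - a.1) * `|h| / 2 + (c.1 - b.1) * `|h| / 2.
      by rewrite TN; field.
    exact: areaU_le.
  move=> q [x [y [z [x0 y0 z0 e qE]]]].
  have q1 : q.1 = x * a.1 + y * b.1 + z * c.1 by rewrite qE.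
  have xE : x = 1 - y - z by rewrite -e; ring.
  (* The height of a point above the line [ac] is its weight at [b] times [h]. *)
  have q2 : q.2 = a.2 + (q.1 - a.1) * m + y * h.
    by rewrite q1 qE !coordE c2 b2 /d2 xE; ring.
  have y1 : y <= 1 by lra.
  have [qb|qb] := leP q.1 b.1.
    have [eab|nab] := eqVneq a.1 b.1.
      right; rewrite /M2; case: eqVneq => [ecb|ncb]; first by rewrite ecb -eab ltxx in ac.
      have cb0 : c.1 - b.1 != 0 by rewrite subr_eq0.
      have bE : (q.1 - c.1) / (b.1 - c.1) = 1 - z.
        have bc0 : b.1 - c.1 != 0 by rewrite subr_eq0 eq_sym.
        by rewrite q1 xE eab; field.
      rewrite /half_closed /= bE; have /andP[k1 k2] := btw (1 - z) y ltac:(lra).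
      have E (r : R) : q.2 - (c.2 + (1 - z) * (r - c.2)) = y * h - (1 - z) * (r - d2).
        by rewrite q2 q1 c2 /d2 xE eab; ring.
      have t0 : 0 <= 1 - z by rewrite -e -addrA addrA addrK addr_ge0.
      have t1 : 1 - z <= 1 by rewrite gerBl.
      split; [done|done|by rewrite -subr_ge0 E subr_ge0|by rewrite -subr_le0 E subr_le0].
    left; rewrite /M1 (negbTE nab).
    have ab0 : 0 < b.1 - a.1 by rewrite subr_gt0 lt_neqAle nab.
    have abn : b.1 - a.1 != 0 by rewrite gt_eqF.
    rewrite /half_closed /=; set t := _ / _.
    have tE : t * (b.1 - a.1) = q.1 - a.1 by rewrite /t divfK.
    have t1 : t <= 1 by rewrite /t ler_pdivrMr//; lra.
    have yt : y <= t.
      rewrite /t ler_pdivlMr// q1 xE.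
      have : 0 <= z * (c.1 - a.1) by rewrite mulr_ge0// subr_ge0 ltW.
      lra.
    have /andP[k1 k2] := btw t y ltac:(lra).
    have E (r : R) : q.2 - (a.2 + t * (r - a.2)) = y * h - t * (r - d2).
      rewrite q2 -tE /d2; ring.
    have t0 : 0 <= t := le_trans y0 yt.
    split; [done|done|by rewrite -subr_ge0 E subr_ge0|by rewrite -subr_le0 E subr_le0].
  right; rewrite /M2; case: eqVneq => [ecb|ncb].
    exfalso; move: qb; rewrite q1 -ecb ltNge; apply/negP/negPn.
    have : x * a.1 <= x * c.1 by rewrite ler_wpM2l// ltW.
    have cE : x * c.1 + y * c.1 + z * c.1 = c.1 by rewrite -!mulrDl e mul1r.
    by move: cE; clear; lra.
  have cb0 : 0 < c.1 - b.1 by rewrite subr_gt0 lt_neqAle eq_sym ncb.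
  have cbn : b.1 - c.1 != 0 by rewrite subr_eq0 eq_sym.
  rewrite /half_closed /=; set t := _ / _.
  have tE : t * (b.1 - c.1) = q.1 - c.1 by rewrite /t divfK.
  have tE' : t = (c.1 - q.1) / (c.1 - b.1).
    by rewrite /t -[c.1 - b.1]opprB invrN mulrN -mulNr opprB.
  have t1 : t <= 1 by rewrite tE' ler_pdivrMr//; lra.
  have yt : y <= t.
    rewrite tE' ler_pdivlMr// q1.
    have : 0 <= x * (c.1 - a.1) by rewrite mulr_ge0// subr_ge0 ltW.
    have -> : z = 1 - x - y by rewrite -e; ring.
    lra.
  have /andP[k1 k2] := btw t y ltac:(lra).
  have E (r : R) : q.2 - (c.2 + t * (r - c.2)) = y * h - t * (r - d2).
    have q1' : q.1 = c.1 + t * (b.1 - c.1) by rewrite tE addrC subrK.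
    by rewrite q2 q1' c2 /d2; ring.
  have t0 : 0 <= t := le_trans y0 yt.
  split; [done|done|by rewrite -subr_ge0 E subr_ge0|by rewrite -subr_le0 E subr_le0].
- pose M1 := if a.1 == b.1 then set0 else half_open a.1 a.2 b.1 lo hi.
  pose M2 := if c.1 == b.1 then set0 else half_open c.1 c.2 b.1 lo hi.
  have m1 : plane_measurable M1.
    by rewrite /M1; case: eqVneq => [_|?]; [exact: measurable0|exact: half_open_measurable].
  have m2 : plane_measurable M2.
    by rewrite /M2; case: eqVneq => [_|?]; [exact: measurable0|exact: half_open_measurable].
  have a1 : area M1 = ((b.1 - a.1) * `|h| / 2)%:E.
    rewrite /M1; case: eqVneq => [->|e]; first by rewrite area0 subrr !mul0r.
    by rewrite half_open_area// hl ger0_norm ?subr_ge0.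
  have a2 : area M2 = ((c.1 - b.1) * `|h| / 2)%:E.
    rewrite /M2; case: eqVneq => [->|e]; first by rewrite area0 subrr !mul0r.
    by rewrite half_open_area// hl distrC ger0_norm ?subr_ge0.
  have s1 q : M1 q -> q.1 < b.1.
    rewrite /M1; case: eqVneq => // e [h1 h2 _ _].
    have ab0 : 0 < b.1 - a.1 by rewrite subr_gt0 lt_neqAle e.
    by move: h2; rewrite ltr_pdivrMr//; lra.
  have s2 q : M2 q -> b.1 < q.1.
    rewrite /M2; case: eqVneq => // e [h1 h2 _ _].
    have ab0 : b.1 - c.1 < 0 by rewrite subr_lt0 lt_neqAle eq_sym e.
    by move: h2; rewrite ltr_ndivrMr//; lra.
  exists (M1 `|` M2); split; [exact: measurableU| |]; last first.
    have -> : `|tri a b c| / 2 = (b.1 - a.1) * `|h| / 2 + (c.1 - b.1) * `|h| / 2.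
      by rewrite TN; field.
    rewrite area_disjointU// ?a1 ?a2//.
    by rewrite -subset0 => q [/s1 + /s2]; lra.
  (* [g] is the height of [q] above the line [ac]; its sign is that of [h] *)
  have btw' (t g : R) : 0 < t -> t * (lo - d2) < g < t * (hi - d2) ->
      0 < g * h /\ 0 < (t * h - g) * h.
    rewrite /lo /hi; case: (leP d2 b.2) => hh t0; rewrite -/h subrr mulr0 => /andP[g1 g2].
      have h0 : 0 < h by rewrite -(pmulr_rgt0 _ t0) (lt_trans g1).
      by split; apply: mulr_gt0 => //; lra.
    have h0 : h < 0 by rewrite -(pmulr_rlt0 _ t0) (lt_trans g1).
    by split; rewrite nmulr_lgt0//; lra.
  move=> q; pose g := q.2 - (a.2 + (q.1 - a.1) * m).
  have T1 : tri c a q = - (c.1 - a.1) * g.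
    by rewrite /tri /cross /g !coordE c2; ring.
  have T2 : tri a b q = - ((q.1 - a.1) * h - (b.1 - a.1) * g).
    by rewrite /tri /cross /g !coordE b2 /d2; ring.
  have T3 : tri b c q = - ((c.1 - q.1) * h - (c.1 - b.1) * g).
    by rewrite /tri /cross /g !coordE b2 c2 /d2; ring.
  have fin : 0 < g * h -> 0 < ((q.1 - a.1) * h - (b.1 - a.1) * g) * h ->
      0 < ((c.1 - q.1) * h - (c.1 - b.1) * g) * h -> inside3 a b c q.
    move=> k1 k2 k3; have ca : 0 < c.1 - a.1 by rewrite subr_gt0.
    rewrite /inside3 /= T1 T2 T3 TE; split.
    + have -> x : - x * (- h * (c.1 - a.1)) = x * h * (c.1 - a.1) by ring.
      exact: mulr_gt0.
    + have -> x : - x * (- h * (c.1 - a.1)) = x * h * (c.1 - a.1) by ring.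
      exact: mulr_gt0.
    + have -> : - (c.1 - a.1) * g * (- h * (c.1 - a.1)) =
        (g * h) * (c.1 - a.1) * (c.1 - a.1) by ring.
      by do 2?apply: mulr_gt0.
  case=> [Mq|Mq].
    have qb := s1 _ Mq; move: Mq; rewrite /M1; case: eqVneq => // e.
    rewrite /half_open /=; set t := _ / _ => -[t0 t1 l1 l2].
    have abn : b.1 - a.1 != 0 by rewrite subr_eq0 eq_sym.
    have ab0 : 0 < b.1 - a.1 by rewrite subr_gt0 lt_neqAle e.
    have tE : q.1 - a.1 = t * (b.1 - a.1) by rewrite /t divfK.
    have gE (r : R) : g - t * (r - d2) = q.2 - (a.2 + t * (r - a.2)).
      by rewrite /g tE /d2; ring.
    have [|k1 k2] := btw' t g t0; first by have := gE lo; have := gE hi; lra.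
    apply: fin => //.
      have -> : ((q.1 - a.1) * h - (b.1 - a.1) * g) * h =
        (b.1 - a.1) * ((t * h - g) * h) by rewrite tE; ring.
      exact: mulr_gt0.
    have -> : ((c.1 - q.1) * h - (c.1 - b.1) * g) * h =
       (c.1 - b.1) * ((t * h - g) * h) +
       ((c.1 - b.1) * (1 - t) + (b.1 - q.1)) * h ^+ 2.
      by ring.
    have hn0 : h != 0 by apply: contraTneq k1 => ->; rewrite mulr0 ltxx.
    have h2 : 0 < h ^+ 2 by rewrite exprn_even_gt0.
    apply: ltr_wpDl; first by rewrite mulr_ge0 ?subr_ge0// ltW.
    apply: mulr_gt0 => //; apply: ltr_wpDl; last by rewrite subr_gt0.
    by apply: mulr_ge0; rewrite subr_ge0// ltW.
  have qb := s2 _ Mq; move: Mq; rewrite /M2; case: eqVneq => // e.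
  rewrite /half_open /=; set t := _ / _ => -[t0 t1 l1 l2].
  have abn : b.1 - c.1 != 0 by rewrite subr_eq0 eq_sym.
  have cb0 : 0 < c.1 - b.1 by rewrite subr_gt0 lt_neqAle eq_sym e.
  have tE : q.1 = c.1 + t * (b.1 - c.1) by rewrite /t divfK// addrC subrK.
  have gE (r : R) : g - t * (r - d2) = q.2 - (c.2 + t * (r - c.2)).
    by rewrite /g tE c2 /d2; ring.
  have [|k1 k2] := btw' t g t0; first by have := gE lo; have := gE hi; lra.
  have h0 : h != 0 by apply: contraTneq k1 => ->; rewrite mulr0 ltxx.
  have h2 : 0 < h ^+ 2 by rewrite exprn_even_gt0.
  apply: fin => //.
    have -> : ((q.1 - a.1) * h - (b.1 - a.1) * g) * h =
       (b.1 - a.1) * ((t * h - g) * h) +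
       ((b.1 - a.1) * (1 - t) + (q.1 - b.1)) * h ^+ 2.
      by ring.
    apply: ltr_wpDl; first by rewrite mulr_ge0 ?subr_ge0// ltW.
    apply: mulr_gt0 => //; apply: ltr_wpDl; last by rewrite subr_gt0.
    by apply: mulr_ge0; rewrite subr_ge0// ltW.
  have -> : ((c.1 - q.1) * h - (c.1 - b.1) * g) * h =
     (c.1 - b.1) * ((t * h - g) * h) by rewrite tE; ring.
  exact: mulr_gt0.
Qed.

Lemma triangle_measureP a b c : triangle_measure a b c.
Proof.
have [ab|/ltW ba] := leP a.1 b.1; have [bc|/ltW cb] := leP b.1 c.1.
- exact: triangle_measure_sorted.
- have [ac|/ltW ca] := leP a.1 c.1.
    by have [_] := triangle_measure_perm (triangle_measure_sorted ac cb).
  have [_ h] := triangle_measure_perm (triangle_measure_sorted ca ab).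
  have [h' _] := triangle_measure_perm (triangle_measure_sorted ca ab).
  by have [_] := triangle_measure_perm h'.
- have [ac|/ltW ca] := leP a.1 c.1.
    by have [] := triangle_measure_perm (triangle_measure_sorted ba ac).
  have [_ h] := triangle_measure_perm (triangle_measure_sorted bc ca).
  by have [] := triangle_measure_perm h.
- have [h _] := triangle_measure_perm (triangle_measure_sorted cb ba).
  have [_ h'] := triangle_measure_perm h.
  by have [] := triangle_measure_perm h'.
Qed.

End PlaneMeasure.

(** * Area of disks, and perimeter of tiles with a reflex or straight corner *)

Section DiskArea.
Context {R : realType}.
Implicit Types (p q a b c : (R * R)%type) (A : set (R * R)).

Notation plane_measurable A :=
  (measurable (A : set (measurableTypeR R * measurableTypeR R))).
Notation mu := (@lebesgue_measure R).

Lemma region_measurable (P : pentagon R) : plane_measurable (region P).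
Proof. by apply: closed_plane_measurable; exact: region_closed. Qed.

Lemma le_area A B : plane_measurable A -> plane_measurable B -> A `<=` B ->
  (area A <= area B)%E.
Proof. by move=> mA mB AB; apply: le_measure; rewrite ?inE. Qed.

Lemma is_derive_circle (y : R) : -1 < y < 1 ->
  is_derive y 1 (fun y => y * Num.sqrt (1 - y ^+ 2) + asin y)
    (2 * Num.sqrt (1 - y ^+ 2)).
Proof.
move=> y1; have y2 : 0 < 1 - y ^+ 2.
  by rewrite subr_gt0 -(real_normK (num_real y)) exprn_ilt1// ltr_norml.
have ds : is_derive y 1 (fun y => Num.sqrt (1 - y ^+ 2))
    ((2 * Num.sqrt (1 - y ^+ 2))^-1 * (- (2 * y))).
  have h1 : is_derive (1 - y ^+ 2) 1 (@Num.sqrt R) (2 * Num.sqrt (1 - y ^+ 2))^-1.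
    exact: is_derive1_sqrt.
  have h2 : is_derive y 1 (fun y : R => 1 - y ^+ 2) (- (2 * y)).
    apply: is_derive_eq; rewrite /GRing.scale /=; ring.
  exact: (@is_derive1_comp _ (@Num.sqrt R) (fun y : R => 1 - y ^+ 2)).
have da := is_derive1_asin y1.
have s0 : 0 < Num.sqrt (1 - y ^+ 2) by rewrite sqrtr_gt0.
apply: is_derive_eq; rewrite /GRing.scale /=.
have sn : Num.sqrt (1 - y ^+ 2) != 0 by rewrite gt_eqF.
have sq : Num.sqrt (1 - y ^+ 2) ^+ 2 = 1 - y ^+ 2 by rewrite sqr_sqrtr// ltW.
set S := Num.sqrt _ in sn sq *.
apply: (mulIf sn).
have -> : 2 * S * S = 2 * S ^+ 2 by ring.
have -> : (y * ((2 * S)^-1 * (- (2 * y))) + S * 1 + S^-1) * S =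
  - y ^+ 2 + S ^+ 2 + 1 by field.
by rewrite sq; ring.
Qed.

Lemma norm2_continuous : continuous (fun q : R * R => dot q q).
Proof.
by move=> q; apply: cvgD; apply: cvgM; solve [exact: cvg_fst|exact: cvg_snd].
Qed.

Lemma disk0E (r : R) : 0 <= r -> disk (0, 0)%R r = [set q | dot q q <= r ^+ 2].
Proof.
move=> r0; apply/seteqP; split => q; rewrite /disk /= eucl_dist0l => h.
  by rewrite -eucl_norm_sqr lerXn2r ?nnegrE ?eucl_norm_ge0.
by rewrite -(@ler_pXn2r _ 2)// ?nnegrE ?eucl_norm_ge0// eucl_norm_sqr.
Qed.

Lemma disk0_measurable (r : R) : 0 <= r -> plane_measurable (disk (0, 0)%R r).
Proof.
move=> r0; rewrite disk0E//; apply: closed_plane_measurable.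
apply: (@closed_comp _ _ _ [set x : R | x <= r ^+ 2]); last exact: closed_le.
by move=> ? _; exact: norm2_continuous.
Qed.

(** Integrating over [|x| <= r sin th] only avoids the ends of the diameter, where the square root
    is not differentiable. This strip has area [r^2 (2 th + 2 sin th cos th)], of which the first
    term is kept; the count only asks for a lower bound. *)
Lemma disk_area_ge_sector (r th : R) : 0 < r -> 0 < th < pi / 2 ->
  ((2 * th * r ^+ 2)%:E <= area (disk (0, 0)%R r))%E.
Proof.
move=> r0 /andP[th0 th1].
have pi0 : 0 < pi :> R := pi_gt0 R.
have s0 : 0 < sin th by apply: sin_gt0_pi; lra.
have c0 : 0 < cos th by apply: cos_gt0_pihalf; lra.
have s1 : sin th < 1.
  rewrite lt_neqAle sin_le1 andbT; apply/eqP => s1.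
  have := cos2Dsin2 th; rewrite s1 expr1n => h.
  have : cos th ^+ 2 = 0 by lra.
  by move/eqP; rewrite sqrf_eq0 gt_eqF.
set ro := r * sin th; have ro0 : 0 < ro by rewrite mulr_gt0.
have rn : r != 0 by rewrite gt_eqF.
have dom x : - ro <= x <= ro -> -1 < x / r < 1.
  move=> /andP[x1 x2]; rewrite ltr_pdivlMr// ltr_pdivrMr// mulN1r mul1r.
  have : ro < r by rewrite /ro gtr_pMr.
  lra.
pose A := [set q : R * R | - ro <= q.1 <= ro] `&` disk (0, 0)%R r.
have mA : plane_measurable A.
  apply: measurableI; last by apply: disk0_measurable; exact: ltW.
  have -> : [set q : R * R | - ro <= q.1 <= ro] =
    [set q | 0 <= 1 * q.1 + 0 * q.2 + ro] `&` [set q | 0 <= (-1) * q.1 + 0 * q.2 + ro].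
    by apply/seteqP; split => q /=; [move=> ?; split|case]; lra.
  by apply: measurableI; exact: (halfplane_measurable _ _ _).1.
pose u (x : R) := r * Num.sqrt (1 - (x / r) ^+ 2).
have u0 x : 0 <= u x by rewrite mulr_ge0 ?sqrtr_ge0 ?ltW.
have usq x : - ro <= x <= ro -> u x ^+ 2 = r ^+ 2 - x ^+ 2.
  move=> /dom x1; rewrite /u exprMn sqr_sqrtr; first by field.
  by rewrite subr_ge0 -(real_normK (num_real _)) exprn_ile1//= ler_norml; lra.
have aA : area A = (\int[mu]_(x in `[(- ro)%R, ro]) (u x - - u x)%:E)%E.
  apply: area_strip => //.
  - by move=> x _; have := u0 x; lra.
  - move=> x y /=; rewrite in_itv /= => xr /andP[y1 y2].
    split=> //; rewrite disk0E ?ltW// /= /dot /= -!expr2.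
    have : y ^+ 2 <= u x ^+ 2.
      by rewrite -(real_normK (num_real y)) lerXn2r ?nnegrE// ler_norml; lra.
    by rewrite usq//; lra.
  - move=> x y [/= xr]; rewrite (disk0E (ltW r0)) => h0.
    have h : x ^+ 2 + y ^+ 2 <= r ^+ 2 by move: h0; rewrite /= /dot /= !expr2.
    split; first by rewrite in_itv.
    rewrite -ler_norml -(@ler_pXn2r _ 2)// ?nnegrE// (real_normK (num_real y)) usq//; lra.
have dF x : - ro <= x <= ro -> is_derive x 1
   (fun x => r ^+ 2 * (x / r * Num.sqrt (1 - (x / r) ^+ 2) + asin (x / r)))
   (u x - - u x).
  move=> xr; have h1 := is_derive_circle (dom x xr).
  have h2 : is_derive x 1 (fun x : R => x / r) r^-1.
    by apply: is_derive_eq; rewrite /GRing.scale /=; ring.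
  have h3 := @is_derive1_comp _ (fun y => y * Num.sqrt (1 - y ^+ 2) + asin y)
    (fun x : R => x / r) x _ _ h1 h2.
  have h4 : is_derive x 1 (fun x => r ^+ 2 *
      ((fun y => y * Num.sqrt (1 - y ^+ 2) + asin y) \o (fun x : R => x / r)) x)
    (u x - - u x).
    apply: is_derive_eq; rewrite /GRing.scale /= /u.
    set S := Num.sqrt _.
    by field.
  exact: h4.
have ab : - ro < ro by lra.
have cf : {within `[(- ro), ro], continuous (fun x => u x - - u x)}.
  apply: continuous_subspaceT => x.
  have cu : {for x, continuous u}.
    apply: cvgM; first exact: cvg_cst.
    apply: (@continuous_comp _ _ _ (fun x : R => 1 - (x / r) ^+ 2) (@Num.sqrt R));
      last exact: sqrt_continuous.
    apply: cvgB; first exact: cvg_cst.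
    have cx : (fun x : R => x / r) x @[x --> x] --> x / r.
      by apply: cvgM; [exact: cvg_id|exact: cvg_cst].
    by rewrite /=; apply: cvgM.
  by apply: cvgB => //; apply: cvgN.
apply: (@le_trans _ _ (area A)); last first.
  by apply: le_area => //; [by apply: disk0_measurable; exact: ltW|move=> q []].
rewrite aA (is_derive_FTC2 ab cf dF) lee_fin.
have -> : ro / r = sin th by rewrite /ro mulrAC divff// mul1r.
have -> : - ro / r = sin (- th) by rewrite sinN /ro mulNr mulrAC divff// mul1r.
rewrite !sinK ?in_itv/=; [|lra|lra].
rewrite sinN sqrrN -cos2sin2 sqrtr_sqr gtr0_norm//.
have : 0 <= r ^+ 2 * (sin th * cos th) by rewrite mulr_ge0 ?sqr_ge0// mulr_ge0 ?ltW.
lra.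
Qed.

Lemma disk_area_ge (r : R) : 0 < r -> ((pi * r ^+ 2)%:E <= area (disk (0, 0)%R r))%E.
Proof.
move=> r0; have pi0 : 0 < pi :> R := pi_gt0 R.
have r2 : 0 < r ^+ 2 by rewrite exprn_gt0.
rewrite leNgt; apply/negP => h.
have /fineK aE : area (disk (0, 0)%R r) \is a fin_num.
  by rewrite ge0_fin_numE ?(lt_trans h) ?ltry// measure_ge0.
move: aE h; set v := fine _ => aE; rewrite -aE lte_fin => h.
have v0 : 0 <= v by rewrite /v fine_ge0// measure_ge0.
pose w := v / r ^+ 2; have vE : v = w * r ^+ 2 by rewrite /w divfK// gt_eqF.
have w0 : 0 <= w by rewrite /w divr_ge0// ltW.
have wpi : w < pi by rewrite /w ltr_pdivrMr.
(* The area is [w * r ^+ 2] with [w < pi]; any angle strictly between [w / 2] and [pi / 2] gives a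
   contradiction. *)
have := @disk_area_ge_sector r ((w / 2 + pi / 2) / 2) r0.
rewrite -aE lee_fin vE => /(_ ltac:(lra)).
by rewrite ler_pM2r//; lra.
Qed.

Lemma sum5 (F : 'I_5 -> R) m : \sum_k F k = F m + F (ordS m) +
  F (ordS (ordS m)) + F (ordS (ordS (ordS m))) + F (ordS (ordS (ordS (ordS m)))).
Proof.
pose l := [:: m; ordS m; ordS (ordS m); ordS (ordS (ordS m));
  ordS (ordS (ordS (ordS m)))].
have pl : perm_eq (index_enum 'I_5) l.
  apply: uniq_perm; first exact: index_enum_uniq.
    by rewrite /l; clear l; case: m => [[|[|[|[|[|?]]]]] ?].
  move=> x; rewrite mem_index_enum /l; clear l.
  by case: m => [[|[|[|[|[|?]]]]] ?] //; case: x => [[|[|[|[|[|?]]]]] ?].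
by rewrite (perm_big _ pl) /= !big_cons big_nil addr0 !addrA.
Qed.

Section Reflex.
Variables (P : pentagon R) (s : R) (m : 'I_5).
Hypothesis simpleP : simple_pentagon P.
Hypothesis oP : oriented P s.
Hypothesis reflex : corner P s m <= 0.
Hypothesis areaP : area (region P) = 1%E.

Lemma reflex_perimeter : 4 <= perimeter P.
Proof.
set q0 := P (ordS m); set q1 := P (ordS (ordS m)).
set q2 := P (ordS (ordS (ordS m))); set q3 := P (ordS (ordS (ordS (ordS m)))).
have hull_sub : region P `<=` hull (quad q0 q1 q2 q3).
  exact: (region_hull simpleP oP reflex).
have [[M0 [m0 s0 a0]] _] := triangle_measureP q1 q2 q3.
have [[M1 [m1 s1 a1]] _] := triangle_measureP q0 q2 q3.
have [[M2 [m2 s2 a2]] _] := triangle_measureP q0 q1 q3.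
have [[M3 [m3 s3 a3]] _] := triangle_measureP q0 q1 q2.
set t0 := tri q1 q2 q3 in a0; set t1 := tri q0 q2 q3 in a1.
set t2 := tri q0 q1 q3 in a2; set t3 := tri q0 q1 q2 in a3.
have mr := region_measurable P.
(* Inclusion-exclusion, used three times, turns the double covering into a bound on the sum of the
   four areas: a point in two of the sets lies in their union and in one of the three intersections
   that appear. *)
have areaUI A B : plane_measurable A -> plane_measurable B ->
   (area A + area B = area (A `|` B) + area (A `&` B))%E.
  move=> mA mB; rewrite /area [X in (_ + X)%E](measureDI _ mB mA) addeA.
  congr (_ + _)%E; last by rewrite setIC.
  rewrite -measureU//; last 2 first.
    exact: measurableD.
    by rewrite setIDA setIC -setIDA setDv setI0.
  congr (product_measure1 _ _ _); apply/seteqP; split => [x [Ax|[Bx _]]|x [Ax|Bx]].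
  - by left.
  - by right.
  - by left.
  - by have [Ax|Ax] := pselect (A x); [left|right].
have cover2 : ((2 : R)%:E <= ((`|t0| / 2 + `|t1| / 2) + (`|t2| / 2 + `|t3| / 2))%:E)%E.
  apply: (@le_trans _ _ ((area M0 + area M1) + (area M2 + area M3))%E); last first.
    by rewrite !EFinD; apply: leeD; apply: leeD.
  have mu01 : plane_measurable (M0 `|` M1) by exact: measurableU.
  have mu23 : plane_measurable (M2 `|` M3) by exact: measurableU.
  have mi01 : plane_measurable (M0 `&` M1) by exact: measurableI.
  have mi23 : plane_measurable (M2 `&` M3) by exact: measurableI.
  have mui : plane_measurable ((M0 `|` M1) `&` (M2 `|` M3)) by exact: measurableI.
  have muu : plane_measurable ((M0 `|` M1) `|` (M2 `|` M3)) by exact: measurableU.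
  rewrite (areaUI M0 M1)// (areaUI M2 M3)// addeACA (areaUI (M0 `|` M1))//.
  have -> : (2 : R)%:E = (1 + 1)%E by rewrite -EFinD.
  have [nz|z] := pselect ([\/ t0 != 0, t1 != 0, t2 != 0 | t3 != 0]); last first.
    (* If the four points were on a line, the region would be confined to it, but close to [q0] the
       region has points off this line. *)
    exfalso.
    have z0 : t0 = 0 by apply/eqP/negPn/negP => h; apply: z; apply: Or41.
    have z1 : t1 = 0 by apply/eqP/negPn/negP => h; apply: z; apply: Or42.
    have z2 : t2 = 0 by apply/eqP/negPn/negP => h; apply: z; apply: Or43.
    have z3 : t3 = 0 by apply/eqP/negPn/negP => h; apply: z; apply: Or44.
    have flat p : hull (quad q0 q1 q2 q3) p -> tri q0 q1 p = 0.
      move=> [w [_ w1 wx wy]]; rewrite !sum4 /quad /= in w1 wx wy.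
      have -> : tri q0 q1 p = w (@Ordinal 4 2 isT) * t3 + w (@Ordinal 4 3 isT) * t2 +
          (1 - (w (@Ordinal 4 0 isT) + w (@Ordinal 4 1 isT) + w (@Ordinal 4 2 isT) +
            w (@Ordinal 4 3 isT))) * cross (q1 - q0) (- q0).
        by rewrite /t3 /t2 /tri /cross !coordE -wx -wy; ring.
      by rewrite z2 z3 w1 subrr mul0r !mulr0 !addr0.
    case: (oP) => ss hin _; have [d [d1 d2]] := left_dir simpleP (ordS m) ss.
    have [e e0 he] := hin (ordS m); have [r r0 hr] := ball_small d e0.
    have r20 : 0 < r / 2 by lra.
    have [_ /hull_sub /flat] : ~ outline P (q0 + (r / 2) *: d) /\
        region P (q0 + (r / 2) *: d).
      apply: he; first by apply: hr; rewrite ger0_norm; lra.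
      have E v : s * cross v (q0 + (r / 2) *: d - P (ordS m)) = (r / 2) * (s * cross v d).
        by rewrite /q0 /cross !coordE; ring.
      have F v : 0 < s * cross v d -> 0 < s * cross v (q0 + (r / 2) *: d - P (ordS m)).
        by move=> v0; rewrite E; exact: mulr_gt0.
      by rewrite /sector !F//; case: ifP.
    have -> : tri q0 q1 (q0 + (r / 2) *: d) = r / 2 * cross (edge P (ordS m)) d.
      by rewrite /tri /edge /q1 /q0 /cross !coordE; ring.
    move=> /eqP; rewrite mulf_eq0 gt_eqF//= => /eqP c0.
    by move: d2; rewrite c0 mulr0 ltxx.
  have dbl p : region P p -> exists i j, [/\ i != j, hull3_without q0 q1 q2 q3 i p &
      hull3_without q0 q1 q2 q3 j p].
    by move=> /hull_sub hp; apply: hull_double_cover.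
  have inM i p : hull3_without q0 q1 q2 q3 i p ->
      nth M3 [:: M0; M1; M2] i p.
    by case: i => [[|[|[|[|i]]]] hi] //=; [exact: s0|exact: s1|exact: s2|exact: s3].
  rewrite -addeA; apply: leeD.
    rewrite -areaP; apply: le_area => // p /dbl[i [_ [_ /inM + _]]].
    by case: i => [[|[|[|[|i]]]] hi] //=; [left; left|left; right|right; left|right; right].
  apply: (@le_trans _ _ (area (((M0 `|` M1) `&` (M2 `|` M3)) `|`
     ((M0 `&` M1) `|` (M2 `&` M3))))).
    rewrite -areaP; apply: le_area => //.
      by apply: measurableU => //; exact: measurableU.
    move=> p /dbl[i [j [+ /inM + /inM]]].
    case: i => [[|[|[|[|i]]]] hi] //=; case: j => [[|[|[|[|j]]]] hj] //= _ pi pj;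
      solve [by left; split; [left|right]; auto|by left; split; [right|left]; auto
            |by left; split; auto; [left|right]; auto
            |by right; left; split|by right; right; split
            |by left; split; [by left|by left] |by left; split; [by left|by right]
            |by left; split; [by right|by left] |by left; split; [by right|by right]].
  apply: (le_trans (measureU2 _ _ _)) => //; first exact: measurableU.
  by apply: leeD => //; apply: (le_trans (measureU2 _ _ _)).
rewrite lee_fin in cover2.
pose d (p q : R * R) := eucl_dist p q.
have d0 p q : 0 <= d p q by exact: eucl_dist_ge0.
have tle a b c : `|tri a b c| <= d a b * d b c.
  have -> : tri a b c = cross (b - a) (c - b) by rewrite /tri /cross !coordE; ring.
  exact: norm_cross_le.
(* Going straight from [q3] to [q0] skips the vertex [P m]. *)
have per : d q0 q1 + d q1 q2 + d q2 q3 + d q3 q0 <= perimeter P.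
  rewrite /perimeter (sum5 _ m) ordS5.
  have := eucl_dist_triangle q3 (P m) q0.
  rewrite -/q0 -/q1 -/q2 -/q3 /d; lra.
have h3 : `|t3| <= d q0 q1 * d q1 q2 by exact: tle.
have h0 : `|t0| <= d q1 q2 * d q2 q3 by exact: tle.
have h1 : `|t1| <= d q2 q3 * d q3 q0 by rewrite /t1 -(tri_rot q0); exact: tle.
have h2 : `|t2| <= d q3 q0 * d q0 q1.
  by rewrite /t2 -(tri_rot q0) -(tri_rot q1); exact: tle.
have := d0 q0 q1; have := d0 q1 q2; have := d0 q2 q3; have := d0 q3 q0.
move: per h0 h1 h2 h3 cover2.
move: (d q0 q1) (d q1 q2) (d q2 q3) (d q3 q0) => x y z w.
move: (`|t0|) (`|t1|) (`|t2|) (`|t3|) => u0 u1 u2 u3.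
move: (perimeter P) => L per h0 h1 h2 h3 cover2 w0 z0 y0 x0.
(* Each triangle has two consecutive sides of the closed path through the four points. The products
   of consecutive sides add up to [(x + z) * (y + w)], at most the square of half the length of the
   path. *)
have key : 4 <= (x + z) * (y + w).
  have -> : (x + z) * (y + w) = x * y + y * z + z * w + w * x by ring.
  by lra.
have L0 : 0 <= L by lra.
have L2 : 4 ^+ 2 <= L ^+ 2.
  have e1 : (x + y + z + w) ^+ 2 <= L ^+ 2 by rewrite lerXn2r ?nnegrE//; lra.
  have e2 : (x + y + z + w) ^+ 2 =
    4 * ((x + z) * (y + w)) + ((x + z) - (y + w)) ^+ 2 by ring.
  have e3 := sqr_ge0 ((x + z) - (y + w)).
  by apply: le_trans e1; rewrite e2; lra.
by rewrite -(@ler_pXn2r _ 2)// ?nnegrE.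
Qed.

End Reflex.

End DiskArea.

(** * Isoperimetric inequality for pentagons *)

Lemma sum_sqr_le1 (R : realDomainType) (a b c d e : R) :
  0 <= a -> 0 <= b -> 0 <= c -> 0 <= d -> 0 <= e -> a + b + c + d + e <= 1 ->
  a ^+ 2 + b ^+ 2 + c ^+ 2 + d ^+ 2 + e ^+ 2 <= 1.
Proof.
move=> a0 b0 c0 d0 e0 h.
have sq (u : R) : 0 <= u -> u <= 1 -> u ^+ 2 <= u by move=> *; rewrite expr2 ler_piMr.
by apply: le_trans (h); do 4?apply: lerD; apply: sq => //; lra.
Qed.

Section Isoperimetric.
Context {R : realType}.
Implicit Types (p q a b c x : (R * R)%type).

Definition quadruple : Type := ((R * R) * (R * R) * (R * R) * (R * R))%type.

Definition shoelace5 p0 p1 p2 p3 p4 : R :=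
  (tri p0 p1 p2 + tri p0 p2 p3 + tri p0 p3 p4) / 2.

Definition length5 p0 p1 p2 p3 p4 : R := eucl_dist p0 p1 + eucl_dist p1 p2 +
  eucl_dist p2 p3 + eucl_dist p3 p4 + eucl_dist p4 p0.

Definition energy5 p0 p1 p2 p3 p4 : R := eucl_dist p0 p1 ^+ 2 +
  eucl_dist p1 p2 ^+ 2 + eucl_dist p2 p3 ^+ 2 + eucl_dist p3 p4 ^+ 2 +
  eucl_dist p4 p0 ^+ 2.

(* [d |p - (w / d) q|^2 >= 0] for the complex number [w = 1 - i t]. *)
Lemma hermitian_step (d t : R) p q : 0 < d ->
  2 * dot p q + 2 * t * cross p q <= d * dot p p + (1 + t ^+ 2) / d * dot q q.
Proof.
move=> d0; have dn : d != 0 by rewrite gt_eqF.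
rewrite -subr_ge0 -(pmulr_rge0 _ d0).
have -> : d * (d * dot p p + (1 + t ^+ 2) / d * dot q q -
    (2 * dot p q + 2 * t * cross p q)) =
  (d * p.1 - (q.1 + t * q.2)) ^+ 2 + (d * p.2 - (q.2 - t * q.1)) ^+ 2.
  by rewrite /dot /cross; field.
by rewrite addr_ge0 ?sqr_ge0.
Qed.

(* Fourier analysis gives the sharp constant [4 tan (pi / 5)], about [2.90617]. *)
Lemma shoelace_energy p0 p1 p2 p3 p4 :
  1453 / 500 * shoelace5 p0 p1 p2 p3 p4 <= energy5 p0 p1 p2 p3 p4.
Proof.
rewrite /energy5 /eucl_dist !eucl_norm_sqr.
(* Just below [tan (pi / 5)]. The coefficients given to [hermitian_step] are the pivots of Gaussian
   elimination on the tridiagonal form [energy - 4 t area]: first 2, then [2 - (1 + t^2) / d]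
   rounded down. The last pivot would vanish for the exact tangent; the slack in [t] leaves it
   positive. *)
pose t : R := 1453 / 2000.
have h1 := @hermitian_step 2 t (p1 - p0) (p2 - p0) ltac:(lra).
have h2 := @hermitian_step (309 / 250) t (p2 - p0) (p3 - p0) ltac:(lra).
have h3 := @hermitian_step (453 / 593) t (p3 - p0) (p4 - p0) ltac:(lra).
have e2 p q : dot (q - p) (q - p) =
    dot (p - p0) (p - p0) + dot (q - p0) (q - p0) - 2 * dot (p - p0) (q - p0).
  by rewrite /dot !coordE; ring.
have e4 : dot (p0 - p4) (p0 - p4) = dot (p4 - p0) (p4 - p0).
  by rewrite /dot !coordE; ring.
rewrite (e2 p1 p2) (e2 p2 p3) (e2 p3 p4) e4 /shoelace5 /tri.
have := dot_ge0 (p1 - p0); have := dot_ge0 (p2 - p0).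
have := dot_ge0 (p3 - p0); have := dot_ge0 (p4 - p0).
move: h1 h2 h3; rewrite /t.
move: (dot (p1 - p0) (p2 - p0)) (dot (p2 - p0) (p3 - p0)) (dot (p3 - p0) (p4 - p0)).
move: (dot (p1 - p0) (p1 - p0)) (dot (p2 - p0) (p2 - p0))
  (dot (p3 - p0) (p3 - p0)) (dot (p4 - p0) (p4 - p0)).
move: (cross _ _) (cross (p2 - p0) _) (cross (p3 - p0) _).
by move=> c1 c2 c3 a1 a2 a3 a4 b1 b2 b3; lra.
Qed.

(** By Heron's formula, four times the square of the cross product is [(S^2 - c^2) (c^2 - delta^2)],
    where [delta] is the difference of the two distances. For a fixed sum [S], it is largest when
    the distances are equal; [y] is placed where the cross product is nonnegative. *)
Lemma isosceles_apex a b x : exists y,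
  [/\ eucl_dist a y = (eucl_dist a x + eucl_dist x b) / 2,
      eucl_dist y b = (eucl_dist a x + eucl_dist x b) / 2 &
      cross (x - a) (b - a) <= cross (y - a) (b - a)].
Proof.
set S := eucl_dist a x + eucl_dist x b.
have [ab|ab] := eqVneq (b - a) 0.
  exists x; have {}ab : b = a by apply/eqP; rewrite -subr_eq0 ab.
  by rewrite /S ab (eucl_distC x a); split => //; field.
have c0 := eucl_norm_gt0 ab; set c := eucl_norm (b - a) in c0.
have cS : c <= S by exact: eucl_dist_triangle.
have S0 : 0 <= S by rewrite (le_trans _ cS) ?ltW.
have cn : c != 0 by rewrite gt_eqF.
have cc : c ^+ 2 = dot (b - a) (b - a) by rewrite eucl_norm_sqr.
have SS : 0 <= S ^+ 2 - c ^+ 2 by rewrite subr_ge0 lerXn2r ?nnegrE// ltW.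
pose h : R := Num.sqrt (S ^+ 2 - c ^+ 2) / (2 * c).
have h0 : 0 <= h by rewrite divr_ge0 ?sqrtr_ge0// mulr_ge0// ltW.
have hh : h ^+ 2 * c ^+ 2 = (S ^+ 2 - c ^+ 2) / 4.
  by rewrite /h expr_div_n sqr_sqrtr//; field.
pose y := a + (2^-1 *: (b - a) + h *: ((b - a).2, - (b - a).1)).
have ya : y - a = 2^-1 *: (b - a) + h *: ((b - a).2, - (b - a).1).
  by rewrite /y addrC addKr.
have by_ : b - y = 2^-1 *: (b - a) - h *: ((b - a).2, - (b - a).1).
  by rewrite /y; apply: eq_pair; rewrite !coordE /=; field.
have nrm z : dot z z = (S / 2) ^+ 2 -> eucl_norm z = S / 2.
  by move=> e; rewrite /eucl_norm e sqrtr_sqr ger0_norm// divr_ge0.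
have q1 : (S / 2) ^+ 2 = (4^-1 + h ^+ 2) * dot (b - a) (b - a).
  by rewrite [RHS]mulrDl -cc hh; field.
exists y; split.
- by rewrite /eucl_dist ya; apply: nrm; rewrite q1 /dot !coordE /=; field.
- by rewrite /eucl_dist by_; apply: nrm; rewrite q1 /dot !coordE /=; field.
- have -> : cross (y - a) (b - a) = h * c ^+ 2.
    by rewrite ya cc /cross /dot !coordE /=; ring.
  have z0 : 0 <= h * c ^+ 2 by rewrite mulr_ge0 ?sqr_ge0.
  rewrite (le_trans (ler_norm _))// -(@ler_pXn2r _ 2)// ?nnegrE//.
  rewrite (real_normK (num_real _)).
  have -> : (h * c ^+ 2) ^+ 2 = (h ^+ 2 * c ^+ 2) * c ^+ 2 by ring.
  rewrite hh.
  have ax := eucl_norm_sqr (x - a); have xb := eucl_norm_sqr (b - x).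
  have dE : 2 * dot (x - a) (b - a) = eucl_norm (x - a) ^+ 2 + c ^+ 2 -
     eucl_norm (b - x) ^+ 2.
    by rewrite ax xb cc /dot !coordE; ring.
  have l4 : 4 * cross (x - a) (b - a) ^+ 2 = 4 * (eucl_norm (x - a) ^+ 2 * c ^+ 2) -
      (2 * dot (x - a) (b - a)) ^+ 2.
    by rewrite ax cc -dot_cross_sqr; ring.
  have heron : 4 * cross (x - a) (b - a) ^+ 2 = (S ^+ 2 - c ^+ 2) *
      (c ^+ 2 - (eucl_norm (x - a) - eucl_norm (b - x)) ^+ 2).
    by rewrite l4 dE /S /eucl_dist; ring.
  have le : (S ^+ 2 - c ^+ 2) * (c ^+ 2 -
      (eucl_norm (x - a) - eucl_norm (b - x)) ^+ 2) <= (S ^+ 2 - c ^+ 2) * c ^+ 2.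
    by rewrite ler_wpM2l// gerBl sqr_ge0.
  move: heron le; move: (_ - (_ - _) ^+ 2) => u heron le.
  have -> : (S ^+ 2 - c ^+ 2) / 4 * c ^+ 2 = ((S ^+ 2 - c ^+ 2) * c ^+ 2) / 4 by field.
  by lra.
Qed.

Section Maximize.
Variable eta : R.
Hypothesis eta0 : 0 < eta.

Let len (x : quadruple) := length5 0 x.1.1.1 x.1.1.2 x.1.2 x.2.
Let shoe (x : quadruple) := shoelace5 0 x.1.1.1 x.1.1.2 x.1.2 x.2.
Let ener (x : quadruple) := energy5 0 x.1.1.1 x.1.1.2 x.1.2 x.2.
Let phi (x : quadruple) := shoe x - eta * ener x.
(** Fixing one vertex at the origin makes this set compact. Its pentagons need not be simple, so it
    remains open to moving a single vertex. *)
Let K : set quadruple := [set x | len x <= 1].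

Let pcont (T : topologicalType) (f : T -> R * R) (t : T) :=
  (fun z => (f z).1) z @[z --> t] --> (f t).1 /\
  (fun z => (f z).2) z @[z --> t] --> (f t).2.

Let pcontB (T : topologicalType) (f g : T -> R * R) t : pcont f t -> pcont g t ->
  pcont (fun z => g z - f z) t.
Proof. by move=> [f1 f2] [g1 g2]; split; apply: cvgB. Qed.

Let pcont_dist (T : topologicalType) (f g : T -> R * R) t : pcont f t -> pcont g t ->
  (fun z => eucl_dist (f z) (g z)) z @[z --> t] --> eucl_dist (f t) (g t).
Proof.
move=> pf pg; have [h1 h2] := pcontB pf pg.
have hd : (fun z => dot (g z - f z) (g z - f z)) z @[z --> t] -->
    dot (g t - f t) (g t - f t) by apply: cvgD; apply: cvgM.
exact: (cvg_comp _ _ hd (@sqrt_continuous R _)).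
Qed.

Let pcont_tri (T : topologicalType) (f g h : T -> R * R) t :
  pcont f t -> pcont g t -> pcont h t ->
  (fun z => tri (f z) (g z) (h z)) z @[z --> t] --> tri (f t) (g t) (h t).
Proof.
move=> pf pg ph; have [g1 g2] := pcontB pf pg; have [h1 h2] := pcontB pf ph.
by apply: cvgB; apply: cvgM.
Qed.

Let pc0 (t : quadruple) : pcont (fun _ : quadruple => 0 : R * R) t.
Proof. by split; exact: cvg_cst. Qed.

Let pc1 (t : quadruple) : pcont (fun z : quadruple => z.1.1.1) t.
Proof.
have c1 : (fun z : quadruple => z.1) z @[z --> t] --> t.1 by exact: cvg_fst.
have c2 : (fun z : quadruple => z.1.1) z @[z --> t] --> t.1.1.
  by apply: cvg_comp c1 _; exact: cvg_fst.
have c3 : (fun z : quadruple => z.1.1.1) z @[z --> t] --> t.1.1.1.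
  by apply: cvg_comp c2 _; exact: cvg_fst.
by split; apply: cvg_comp c3 _; [exact: cvg_fst|exact: cvg_snd].
Qed.

Let pc2 (t : quadruple) : pcont (fun z : quadruple => z.1.1.2) t.
Proof.
have c1 : (fun z : quadruple => z.1) z @[z --> t] --> t.1 by exact: cvg_fst.
have c2 : (fun z : quadruple => z.1.1) z @[z --> t] --> t.1.1.
  by apply: cvg_comp c1 _; exact: cvg_fst.
have c3 : (fun z : quadruple => z.1.1.2) z @[z --> t] --> t.1.1.2.
  by apply: cvg_comp c2 _; exact: cvg_snd.
by split; apply: cvg_comp c3 _; [exact: cvg_fst|exact: cvg_snd].
Qed.

Let pc3 (t : quadruple) : pcont (fun z : quadruple => z.1.2) t.
Proof.
have c1 : (fun z : quadruple => z.1) z @[z --> t] --> t.1 by exact: cvg_fst.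
have c3 : (fun z : quadruple => z.1.2) z @[z --> t] --> t.1.2.
  by apply: cvg_comp c1 _; exact: cvg_snd.
by split; apply: cvg_comp c3 _; [exact: cvg_fst|exact: cvg_snd].
Qed.

Let pc4 (t : quadruple) : pcont (fun z : quadruple => z.2) t.
Proof.
have c3 : (fun z : quadruple => z.2) z @[z --> t] --> t.2 by exact: cvg_snd.
by split; apply: cvg_comp c3 _; [exact: cvg_fst|exact: cvg_snd].
Qed.

Let len_continuous : continuous len.
Proof.
by move=> t; do 4?apply: cvgD; apply: pcont_dist.
Qed.

Let phi_continuous : continuous phi.
Proof.
move=> t.
have h1 := pcont_tri (pc0 t) (pc1 t) (pc2 t).
have h2 := pcont_tri (pc0 t) (pc2 t) (pc3 t).
have h3 := pcont_tri (pc0 t) (pc3 t) (pc4 t).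
have hs : shoe z @[z --> t] --> shoe t.
  exact: (cvgM (cvgD (cvgD h1 h2) h3) (cvg_cst _)).
have d1 := pcont_dist (pc0 t) (pc1 t); have d2 := pcont_dist (pc1 t) (pc2 t).
have d3 := pcont_dist (pc2 t) (pc3 t); have d4 := pcont_dist (pc3 t) (pc4 t).
have d5 := pcont_dist (pc4 t) (pc0 t).
have he : ener z @[z --> t] --> ener t.
  exact: (cvgD (cvgD (cvgD (cvgD (cvgM d1 d1) (cvgM d2 d2)) (cvgM d3 d3))
    (cvgM d4 d4)) (cvgM d5 d5)).
exact: (cvgB hs (cvgM (cvg_cst _) he)).
Qed.

Let coord_le p : `|p.1| <= eucl_norm p /\ `|p.2| <= eucl_norm p.
Proof.
split; rewrite -(@ler_pXn2r _ 2)// ?nnegrE ?eucl_norm_ge0// (real_normK (num_real _))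
  eucl_norm_sqr /dot -!expr2.
  by rewrite lerDl sqr_ge0.
by rewrite lerDr sqr_ge0.
Qed.

Let K_compact : compact K.
Proof.
pose B : set (R * R) := `[(-1), 1]%classic `*` `[(-1), 1]%classic.
have cB : compact B by apply: compact_setX; exact: segment_compact.
apply: (@subclosed_compact _ K (B `*` B `*` B `*` B)).
- apply: (@closed_comp _ _ len [set x : R | x <= 1]); last exact: closed_le.
  by move=> ? _; exact: len_continuous.
- exact: (compact_setX (compact_setX (compact_setX cB cB) cB) cB).
- have inB p : eucl_norm p <= 1 -> B p.
    move=> p1; have [h1 h2] := coord_le p.
    by split; rewrite /= in_itv /= -ler_norml (le_trans _ p1).
  move=> x; rewrite /K /= /len /length5 => h.
  have d0 p q := eucl_dist_ge0 p q.
  have t1 := eucl_dist_triangle 0 x.1.1.1 x.1.1.2.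
  have t2 := eucl_dist_triangle 0 x.1.1.2 x.1.2.
  have t3 := eucl_dist_triangle 0 x.1.2 x.2.
  have := d0 0 x.1.1.1; have := d0 x.1.1.1 x.1.1.2; have := d0 x.1.1.2 x.1.2.
  have := d0 x.1.2 x.2; have := d0 x.2 0.
  move=> k1 k2 k3 k4 k5.
  by split; [split; [split|]|]; apply: inB; rewrite -eucl_dist0l; lra.
Qed.

(* The penalty [eta * ener] makes a maximizer of [phi] on [K] equilateral: moving
   a vertex to the apex of the isosceles triangle with the same perimeter does
   not decrease [shoe] and decreases [ener]. For an equilateral pentagon,
   [shoelace_energy] is an isoperimetric inequality. *)
Lemma shoelace_max (x : quadruple) : K x -> shoe x <= 1 / (20 * (1453 / 2000)) + eta.
Proof.
move=> hx; have K0 : K !=set0.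
  exists (0, 0, 0, 0); rewrite /K /= /len /length5 /= /eucl_dist subrr.
  have -> : eucl_norm (0 : R * R) = 0 by rewrite /eucl_norm /dot /= !mul0r addr0 sqrtr0.
  by lra.
have [m mK mmax] := compact_EVT_max K0 K_compact
  (continuous_subspaceT phi_continuous).
rewrite inE in mK.
have imp y : len y = len m -> shoe m <= shoe y -> ener m <= ener y.
  move=> lE sE; have /mmax : y \in K by rewrite inE /K /= lE.
  rewrite /phi => h; rewrite -(ler_pM2l eta0); lra.
(* Replacing two lengths by their mean lowers the sum of squares unless they are equal. *)
have eqs (a b e e' : R) : e' = e - (a ^+ 2 + b ^+ 2) + 2 * ((a + b) / 2) ^+ 2 ->
    e <= e' -> a = b.
  move=> -> h; apply/eqP; rewrite -subr_eq0 -sqrf_eq0; apply/eqP.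
  have := sqr_ge0 (a - b).
  have -> : (a - b) ^+ 2 = 2 * (a ^+ 2 + b ^+ 2 - 2 * ((a + b) / 2) ^+ 2) by field.
  by lra.
case: m mK mmax imp => [[[p1 p2] p3] p4] mK mmax imp.
have l01 : eucl_dist 0 p1 = eucl_dist p1 p2.
  have [y [y1 y2 yc]] := isosceles_apex 0 p2 p1.
  have /= := imp (y, p2, p3, p4); rewrite /len /shoe /ener /length5 /energy5 /= y1 y2.
  move=> h; apply: eqs (h _ _); first by ring.
    by field.
  rewrite /shoelace5 ler_pM2r// lerD2r lerD2r.
  by move: yc; rewrite /tri /cross !coordE; lra.
have l12 : eucl_dist p1 p2 = eucl_dist p2 p3.
  have [y [y1 y2 yc]] := isosceles_apex p1 p3 p2.
  have /= := imp (p1, y, p3, p4); rewrite /len /shoe /ener /length5 /energy5 /= y1 y2.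
  move=> h; apply: eqs (h _ _); first by ring.
    by field.
  rewrite /shoelace5 ler_pM2r// lerD2r.
  by move: yc; rewrite /tri /cross !coordE; lra.
have l23 : eucl_dist p2 p3 = eucl_dist p3 p4.
  have [y [y1 y2 yc]] := isosceles_apex p2 p4 p3.
  have /= := imp (p1, p2, y, p4); rewrite /len /shoe /ener /length5 /energy5 /= y1 y2.
  move=> h; apply: eqs (h _ _); first by ring.
    by field.
  rewrite /shoelace5 ler_pM2r// -!addrA lerD2l.
  by move: yc; rewrite /tri /cross !coordE; lra.
have l34 : eucl_dist p3 p4 = eucl_dist p4 0.
  have [y [y1 y2 yc]] := isosceles_apex p3 0 p4.
  have /= := imp (p1, p2, p3, y); rewrite /len /shoe /ener /length5 /energy5 /= y1 y2.
  move=> h; apply: eqs (h _ _); first by ring.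
    by field.
  rewrite /shoelace5 ler_pM2r// lerD2l.
  by move: yc; rewrite /tri /cross !coordE; lra.
have ls := shoelace_energy 0 p1 p2 p3 p4.
have phix : phi x <= shoe (p1, p2, p3, p4) - eta * ener (p1, p2, p3, p4).
  by apply: mmax; rewrite inE.
(* Five equal sides of total length at most 1. *)
have em : ener (p1, p2, p3, p4) <= 1 / 5.
  move: mK; rewrite /K /= /ener /len /length5 /energy5 /= l34 -?l34.
  rewrite l01 l12 l23 l34; set l := eucl_dist p4 0 => h.
  have l0 : 0 <= l by exact: eucl_dist_ge0.
  have : l ^+ 2 <= (1 / 5) ^+ 2 by rewrite lerXn2r ?nnegrE//; lra.
  by lra.
have en0 : 0 <= ener (p1, p2, p3, p4).
  by rewrite /ener /energy5 /= !addr_ge0 ?sqr_ge0.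
(* Hence the penalty at [x] is at most [eta], the error term of the statement. *)
have ex1 : ener x <= 1.
  have d0 p q := eucl_dist_ge0 p q.
  have := d0 0 x.1.1.1; have := d0 x.1.1.1 x.1.1.2; have := d0 x.1.1.2 x.1.2.
  have := d0 x.1.2 x.2; have := d0 x.2 0; move: hx.
  rewrite /K /= /len /length5 /ener /energy5.
  move: (eucl_dist 0 _) (eucl_dist x.1.1.1 _) (eucl_dist x.1.1.2 _)
    (eucl_dist x.1.2 _) (eucl_dist x.2 _) => a b c d e h e0 d0' c0 b0 a0.
  exact: sum_sqr_le1.
have ee : 0 <= eta * ener (p1, p2, p3, p4) by rewrite mulr_ge0// ltW.
have ex : eta * ener x <= eta by rewrite ger_pMr.
move: ls phix em; rewrite /phi /shoe /ener /=.
set A := shoelace5 _ _ _ _ _; set B := shoelace5 _ _ _ _ _.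
by move: ee ex; rewrite /ener /=; lra.
Qed.

End Maximize.

Lemma shoelace_le_unit p1 p2 p3 p4 : length5 0 p1 p2 p3 p4 <= 1 ->
  shoelace5 0 p1 p2 p3 p4 <= 1 / (20 * (1453 / 2000)).
Proof.
move=> h; apply/ler_addgt0Pr => e e0.
exact: (shoelace_max e0 (x := (p1, p2, p3, p4))).
Qed.

Lemma eucl_distZ (t : R) p q : eucl_dist (t *: p) (t *: q) = `|t| * eucl_dist p q.
Proof. by rewrite /eucl_dist -scalerBr eucl_normZ. Qed.

Lemma eucl_distB c p q : eucl_dist (p - c) (q - c) = eucl_dist p q.
Proof.
by rewrite /eucl_dist; congr eucl_norm; apply: eq_pair; rewrite !coordE; ring.
Qed.

Lemma pentagon_isoperimetric p0 p1 p2 p3 p4 :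
  1453 / 100 * shoelace5 p0 p1 p2 p3 p4 <= length5 p0 p1 p2 p3 p4 ^+ 2.
Proof.
set L := length5 _ _ _ _ _.
have d0 p q := eucl_dist_ge0 p q.
have L0 : 0 <= L by rewrite /L /length5 !addr_ge0.
have [LZ|LN] := eqVneq L 0.
  have z : shoelace5 p0 p1 p2 p3 p4 = 0.
    have := d0 p0 p1; have := d0 p1 p2; have := d0 p2 p3; have := d0 p3 p4.
    have := d0 p4 p0; move: LZ; rewrite /L /length5 => LZ h5 h4 h3 h2 h1.
    have nz p q : eucl_dist p q = 0 -> q = p.
      move=> h; apply/eqP; rewrite -subr_eq0; apply/negPn/negP => /eucl_norm_gt0.
      by rewrite -/(eucl_dist p q) h ltxx.
    have e1 := nz p0 p1 ltac:(lra); have e2 := nz p1 p2 ltac:(lra).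
    have e3 := nz p2 p3 ltac:(lra); have e4 := nz p3 p4 ltac:(lra).
    by rewrite /shoelace5 /tri e4 e3 e2 e1 subrr /cross /=; ring.
  by rewrite z mulr0 sqr_ge0.
have Lp : 0 < L by rewrite lt_neqAle eq_sym LN.
pose f p := L^-1 *: (p - p0).
have f0 : f p0 = 0 by rewrite /f subrr scaler0.
have fd p q : eucl_dist (f p) (f q) = L^-1 * eucl_dist p q.
  by rewrite eucl_distZ eucl_distB ger0_norm// invr_ge0.
have := @shoelace_le_unit (f p1) (f p2) (f p3) (f p4).
rewrite -f0 /length5 !fd -!mulrDr -/(length5 _ _ _ _ _) -/L mulVf// lexx => /(_ isT).
have -> : shoelace5 (f p0) (f p1) (f p2) (f p3) (f p4) =
    (L ^+ 2)^-1 * shoelace5 p0 p1 p2 p3 p4.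
  by rewrite /shoelace5 /f /tri /cross !coordE; field.
have L2 : 0 < L ^+ 2 by rewrite exprn_gt0.
by rewrite ler_pdivrMl//; lra.
Qed.

Lemma pentagon_isoperimetric_signed (s : R) p0 p1 p2 p3 p4 : s * s = 1 ->
  1453 / 100 * (s * shoelace5 p0 p1 p2 p3 p4) <= length5 p0 p1 p2 p3 p4 ^+ 2.
Proof.
move=> ss; have [->|->] : s = 1 \/ s = -1.
  have : (s - 1) * (s + 1) = 0.
    have -> : (s - 1) * (s + 1) = s * s - 1 by ring.
    by rewrite ss subrr.
  by move/eqP; rewrite mulf_eq0 subr_eq0 addr_eq0 => /orP[] /eqP; [left|right].
  by rewrite mul1r; exact: pentagon_isoperimetric.
have := pentagon_isoperimetric p0 p4 p3 p2 p1.
have -> : shoelace5 p0 p4 p3 p2 p1 = - 1 * shoelace5 p0 p1 p2 p3 p4.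
  by rewrite /shoelace5 /tri /cross !coordE; field.
suff -> : length5 p0 p4 p3 p2 p1 = length5 p0 p1 p2 p3 p4 by [].
rewrite /length5 (eucl_distC p0 p4) (eucl_distC p4 p3) (eucl_distC p3 p2).
by rewrite (eucl_distC p2 p1) (eucl_distC p1 p0); ring.
Qed.

Notation plane_measurable A :=
  (measurable (A : set (measurableTypeR R * measurableTypeR R))).

Section ConvexArea.
Variables (P : pentagon R) (s : R).
Hypothesis ss : s * s = 1.
Hypothesis cP : convex_position P s.

Definition shoelace : R := shoelace5 (P ord0) (P (ordS ord0)) (P (ordS (ordS ord0)))
  (P (ordS (ordS (ordS ord0)))) (P (ordS (ordS (ordS (ordS ord0))))).

Lemma perimeterE : perimeter P = length5 (P ord0) (P (ordS ord0)) (P (ordS (ordS ord0)))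
  (P (ordS (ordS (ordS ord0)))) (P (ordS (ordS (ordS (ordS ord0))))).
Proof. by rewrite /perimeter (sum5 _ ord0) ordS5 /length5. Qed.

Lemma hull3_cell i j l : hull3 (P i) (P j) (P l) `<=` cell P s.
Proof.
move=> q [x [y [z [x0 y0 z0 e ->]]]] k.
have -> : s * tri (P k) (P (ordS k)) (x *: P i + y *: P j + z *: P l) =
   x * (s * tri (P k) (P (ordS k)) (P i)) + y * (s * tri (P k) (P (ordS k)) (P j)) +
   z * (s * tri (P k) (P (ordS k)) (P l)) +
   (1 - (x + y + z)) * (s * cross (P (ordS k) - P k) (- P k)).
  by rewrite /tri /cross !coordE; ring.
rewrite e subrr mul0r addr0.
by do 2?apply: addr_ge0; apply: mulr_ge0 => //; exact: convex_position_ge0.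
Qed.

(** In the fan from [P ord0], the outer approximations of the three triangles cover the cell, and
    the inner ones are disjoint parts of it. *)
Lemma convex_area : area (region P) = (s * shoelace)%:E.
Proof.
rewrite (region_convex cP) /shoelace.
set k0 := ord0; set k1 := ordS k0; set k2 := ordS k1; set k3 := ordS k2.
set k4 := ordS k3.
have k5 : ordS k4 = k0 by rewrite /k4 /k3 /k2 /k1 ordS5.
have [h012 h013 h014] := cP k0; have [_ h230 _] := cP k2; have [h340 h341 h342] := cP k3.
have [_ h402 _] := cP k4.
rewrite -/k1 -/k2 -/k3 -/k4 in h012 h013 h014; rewrite -/k3 -/k4 k5 in h230.
rewrite -/k4 k5 -/k1 -/k2 in h340 h341 h342; rewrite k5 -/k1 -/k2 in h402.
have h023 : 0 < s * tri (P k0) (P k2) (P k3) by rewrite -tri_rot.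
have h034 : 0 < s * tri (P k0) (P k3) (P k4) by rewrite -tri_rot.
have h024 : 0 < s * tri (P k0) (P k2) (P k4) by rewrite -tri_rot -tri_rot.
have s1 : `|s| = 1.
  apply/eqP; rewrite -(@eqrXn2 _ 2)// (real_normK (num_real _)) expr2 ss expr1n//.
have nrm (x : R) : 0 < s * x -> `|x| = s * x.
  by move=> h; rewrite -[RHS]ger0_norm ?ltW// normrM s1 mul1r.
have mc : plane_measurable (cell P s).
  by rewrite -(region_convex cP); exact: region_measurable.
have [[M1 [m1 s1' a1]] [N1 [n1 t1 b1]]] := triangle_measureP (P k0) (P k1) (P k2).
have [[M2 [m2 s2 a2]] [N2 [n2 t2 b2]]] := triangle_measureP (P k0) (P k2) (P k3).
have [[M3 [m3 s3 a3]] [N3 [n3 t3 b3]]] := triangle_measureP (P k0) (P k3) (P k4).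
rewrite (nrm _ h012) in a1 b1; rewrite (nrm _ h023) in a2 b2.
rewrite (nrm _ h034) in a3 b3.
have E : s * shoelace5 (P k0) (P k1) (P k2) (P k3) (P k4) =
    (s * tri (P k0) (P k1) (P k2) / 2 + s * tri (P k0) (P k2) (P k3) / 2) +
    s * tri (P k0) (P k3) (P k4) / 2.
  by rewrite /shoelace5; field.
apply/eqP; rewrite eq_le; apply/andP; split.
  apply: (@le_trans _ _ (area ((M1 `|` M2) `|` M3))).
    apply: le_area => //; first by apply: measurableU => //; exact: measurableU.
    move=> q /(cell_fan k0 cP)[h|h|h].
    - by left; left; exact: s1'.
    - by left; right; exact: s2.
    - by right; exact: s3.
  rewrite E; apply: areaU_le => //; first exact: measurableU.
  exact: areaU_le.
have ins a b c q : 0 < s * tri a b c -> inside3 a b c q ->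
    [/\ 0 < s * tri a b q, 0 < s * tri b c q & 0 < s * tri c a q].
  move=> h [q1 q2 q3].
  have pos (x : R) : 0 < x * tri a b c -> 0 < s * x.
    move=> hx; rewrite -(pmulr_lgt0 _ h).
    have -> : s * x * (s * tri a b c) = (s * s) * (x * tri a b c) by ring.
    by rewrite ss mul1r.
  by split; apply: pos.
have sub a b c : 0 < s * tri a b c -> inside3 a b c `<=` hull3 a b c.
  by move=> h q /(ins _ _ _ _ h)[q1 q2 q3]; apply: (hull3P h); exact: ltW.
have d12 : N1 `&` N2 = set0.
  rewrite -subset0 => q [/t1 /(ins _ _ _ _ h012)[_ _ q1] /t2 /(ins _ _ _ _ h023)[q2 _ _]].
  by move: q1; rewrite tri_swap mulrN oppr_gt0 ltNge ltW.
have d123 : (N1 `|` N2) `&` N3 = set0.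
  have pos q : inside3 (P k0) (P k3) (P k4) q -> 0 < s * tri (P k0) (P k2) q /\
      0 < s * tri (P k0) (P k3) q.
    move=> /(ins _ _ _ _ h034)[q1 _ q3]; split => //.
    rewrite -(pmulr_lgt0 _ h034).
    (* A Grassmann-Plucker relation at [P k0]: a point of the third triangle is also beyond the
       diagonal to [P k2]. *)
    have -> : s * tri (P k0) (P k2) q * (s * tri (P k0) (P k3) (P k4)) =
       (s * tri (P k0) (P k2) (P k3)) * (s * tri (P k4) (P k0) q) +
       (s * tri (P k0) (P k2) (P k4)) * (s * tri (P k0) (P k3) q).
      by rewrite /tri /cross !coordE; ring.
    by apply: addr_gt0; apply: mulr_gt0.
  rewrite -subset0 => q [[/t1 /(ins _ _ _ _ h012)[_ _ q1]|
      /t2 /(ins _ _ _ _ h023)[_ _ q1]] /t3 /pos[q2 q3]].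
    by move: q1; rewrite tri_swap mulrN oppr_gt0 ltNge ltW.
  by move: q1; rewrite tri_swap mulrN oppr_gt0 ltNge ltW.
apply: (@le_trans _ _ (area ((N1 `|` N2) `|` N3))); last first.
  apply: le_area => //; first by apply: measurableU => //; exact: measurableU.
  move=> q [[/t1|/t2]|/t3].
  - by move/(sub _ _ _ h012); exact: hull3_cell.
  - by move/(sub _ _ _ h023); exact: hull3_cell.
  - by move/(sub _ _ _ h034); exact: hull3_cell.
rewrite area_disjointU//; last exact: measurableU.
rewrite area_disjointU// E !EFinD.
by apply: leeD => //; apply: leeD.
Qed.

(** [324 / 85] is just below the square root of [1453 / 100]. *)
Lemma convex_perimeter : area (region P) = 1%E -> 324 / 85 <= perimeter P.
Proof.
rewrite convex_area => -[h].
have := @pentagon_isoperimetric_signed s (P ord0) (P (ordS ord0))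
  (P (ordS (ordS ord0))) (P (ordS (ordS (ordS ord0))))
  (P (ordS (ordS (ordS (ordS ord0))))) ss.
rewrite -/shoelace h -perimeterE => h2.
have p0 : 0 <= perimeter P by apply: sumr_ge0 => i _; exact: eucl_dist_ge0.
move: (perimeter P) p0 h2 => p p0 h2; rewrite leNgt; apply/negP => lt.
have : p * p <= p * (324 / 85) by rewrite ler_wpM2l// ltW.
by rewrite -expr2; lra.
Qed.

End ConvexArea.

End Isoperimetric.

(** * Prismatic pentagons *)

Section Inner.
Context {R : realType}.
Implicit Types (p q : (R * R)%type) (P : pentagon R).

Notation plane_measurable A :=
  (measurable (A : set (measurableTypeR R * measurableTypeR R))).

(** Each side is contained in a degenerate triangle, so the outline has area 0. *)
Lemma inner_point P : area (region P) = 1%E ->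
  exists2 p, region P p & ~ outline P p.
Proof.
move=> a1; apply: contrapT => no.
have sub : region P `<=` outline P.
  by move=> p rp; apply: contrapT => op; apply: no; exists p.
have cov k : exists M, [/\ plane_measurable M, side P k `<=` M & (area M <= 0%:E)%E].
  have [[M [m1 m2 m3]] _] := triangle_measureP (P k) (P (ordS k)) (P k).
  exists M; split => //.
    move=> q /segmentP[t /andP[t0 t1] ->]; apply: m2.
    exists (1 - t), t, 0; split => //; [by rewrite subr_ge0|by ring|].
    by apply: eq_pair; rewrite !coordE; ring.
  move: m3; suff -> : tri (P k) (P (ordS k)) (P k) = 0 by rewrite normr0 mul0r.
  by rewrite /tri /cross !coordE; ring.
have [M hM] := choice cov.
have mM k : plane_measurable (M k) by have [] := hM k.
have aM k : (area (M k) <= 0%:E)%E by have [] := hM k.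
pose k1 : 'I_5 := ordS ord0; pose k2 := ordS k1; pose k3 := ordS k2.
pose k4 := ordS k3.
have mU A B : plane_measurable A -> plane_measurable B -> plane_measurable (A `|` B).
  exact: measurableU.
have m1 := mU _ _ (mM ord0) (mM k1); have m2 := mU _ _ m1 (mM k2).
have m3 := mU _ _ m2 (mM k3); have m4 := mU _ _ m3 (mM k4).
have : (area (region P) <= (0 + 0 + 0 + 0 + 0)%R%:E)%E.
  apply: (@le_trans _ _ (area (M ord0 `|` M k1 `|` M k2 `|` M k3 `|` M k4))).
    apply: le_area; [exact: region_measurable|exact: m4|].
    move=> p /sub[k]; have [_ s _] := hM k => /s.
    suff sM : M k `<=` M ord0 `|` M k1 `|` M k2 `|` M k3 `|` M k4 by move=> /sM.
    case: (eqVneq k ord0) => [->|n0]; first by move=> x; left; left; left; left.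
    case: (eqVneq k k1) => [->|n1]; first by move=> x; left; left; left; right.
    case: (eqVneq k k2) => [->|n2]; first by move=> x; left; left; right.
    case: (eqVneq k k3) => [->|n3]; first by move=> x; left; right.
    have -> : k = k4; last by move=> x; right.
    apply/eqP; move: n0 n1 n2 n3; clear; rewrite /k4 /k3 /k2 /k1.
    by case: k => [[|[|[|[|[|?]]]]] ?].
  have b1 := areaU_le (mM ord0) (mM k1) (aM ord0) (aM k1).
  have b2 := areaU_le m1 (mM k2) b1 (aM k2); have b3 := areaU_le m2 (mM k3) b2 (aM k3).
  exact: (areaU_le m3 (mM k4) b3 (aM k4)).
by rewrite a1 !addr0 lee_fin ler10.
Qed.

Lemma tile_orientation P : simple_pentagon P -> area (region P) = 1%E ->
  exists s, oriented P s.
Proof.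
by move=> sP /inner_point[p rp op]; exact: (orientation sP rp op).
Qed.

Section Prismatic.
Variable P : pentagon R.
Hypothesis prismP : prismatic P.
Hypothesis areaP : area (region P) = 1%E.

(** The tangents from a vertex of angle [theta] have length [r cot (theta / 2)], so the perimeter is
    [2 r (1 + 1 + 3 cot (pi / 3))], that is [2 r (2 + sqrt 3)]. Unit area means [r * perimeter = 2],
    and [r] is eliminated. *)
Lemma prismatic_perimeter : perimeter P = 2 * Num.sqrt (2 + Num.sqrt 3).
Proof.
case: prismP => sP [k0 [a0 a1 a2]] [c [r [r0 dsub tang]]].
have pi0 : 0 < pi :> R := pi_gt0 R.
have [s oP] := tile_orientation sP areaP.
have ss : s * s = 1 by case: oP.
have ang k : interior_angle P k < pi.
  have [->|n0] := eqVneq k k0; first by rewrite a0; lra.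
  have [->|n1] := eqVneq k (ordS k0); first by rewrite a1; lra.
  by rewrite a2//; lra.
have cor k : 0 < corner P s k by have [] := interior_angle_convex sP oP (ang k).
have cP := corners_convex sP cor.
pose l k := eucl_norm (edge P k).
have l0 k : 0 < l k by rewrite eucl_norm_gt0// edge_neq0.
(* The distance from [c] to the line of side [k] is at most [r] because the side has a point at
   distance [r], and at least [r] because the disk stays in the cell. *)
have tangent k : s * cross (edge P k) (c - P k) = r * l k.
  apply/eqP; rewrite eq_le; apply/andP; split.
    have [p pk cp] := tang k.
    have -> : cross (edge P k) (c - P k) = cross (edge P k) (c - p).
      have := side_cross pk; rewrite /cross !coordE => h.
      by apply/eqP; rewrite -subr_eq0 -[X in _ == X]h; apply/eqP; ring.
    rewrite -crossZl (le_trans (ler_norm _))// (le_trans (norm_cross_le _ _))//.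
    have s1 : `|s| = 1.
      by apply/eqP; rewrite -(@eqrXn2 _ 2)// (real_normK (num_real _)) expr2 ss expr1n.
    by rewrite eucl_normZ s1 mul1r mulrC -/(eucl_dist p c) eucl_distC cp.
  pose n : R * R := (s * - (edge P k).2, s * (edge P k).1).
  pose q := c - (r / l k) *: n.
  have nn : eucl_norm n = l k.
    rewrite /l /eucl_norm; congr Num.sqrt.
    have -> : dot n n = (s * s) * dot (edge P k) (edge P k) by rewrite /n /dot /=; ring.
    by rewrite ss mul1r.
  have : cell P s q.
    rewrite -(region_convex cP); apply: dsub; rewrite /disk /= /eucl_dist.
    have -> : q - c = - ((r / l k) *: n) by rewrite /q addrC addKr.
    rewrite eucl_normN eucl_normZ nn ger0_norm ?divfK ?gt_eqF//.
    by rewrite divr_ge0// ltW.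
  move=> /(_ k).
  have -> : s * tri (P k) (P (ordS k)) q = s * cross (edge P k) (c - P k) -
      (s * s) * (r / l k) * dot (edge P k) (edge P k).
    by rewrite /q /n /tri /edge /cross /dot !coordE /=; ring.
  rewrite ss mul1r -eucl_norm_sqr -/(l k) subr_ge0.
  by have -> : r / l k * l k ^+ 2 = r * l k by field; rewrite gt_eqF.
pose g k := - cos (interior_angle P k).
have dotE k : dot (edge P (ord_pred k)) (edge P k) = g k * (l (ord_pred k) * l k).
  by have [_] := interior_angle_convex sP oP (ang k).
have id1 (a b x : R * R) : cross a x * dot b b = dot a b * cross b x + cross a b * dot b x.
  by rewrite /cross /dot; ring.
have id2 (a b x : R * R) : cross b x * dot a a = dot a b * cross a x - cross a b * dot a x.
  by rewrite /cross /dot; ring.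
pose w k := Num.sqrt (1 - g k ^+ 2).
have corE k : corner P s k = l (ord_pred k) * l k * w k.
  have e : corner P s k ^+ 2 = (l (ord_pred k) * l k) ^+ 2 * (1 - g k ^+ 2).
    have -> : corner P s k ^+ 2 = cross (edge P (ord_pred k)) (edge P k) ^+ 2.
      have -> : corner P s k ^+ 2 = (s * s) * cross (edge P (ord_pred k)) (edge P k) ^+ 2.
        by rewrite /corner; ring.
      by rewrite ss mul1r.
    have h := dot_cross_sqr (edge P (ord_pred k)) (edge P k).
    have -> : cross (edge P (ord_pred k)) (edge P k) ^+ 2 =
      dot (edge P (ord_pred k)) (edge P (ord_pred k)) * dot (edge P k) (edge P k) -
      dot (edge P (ord_pred k)) (edge P k) ^+ 2 by rewrite -h; ring.
    by rewrite dotE -!eucl_norm_sqr -/(l k) -/(l (ord_pred k)); ring.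
  rewrite /w -[LHS]ger0_norm ?ltW// -sqrtr_sqr e sqrtrM ?sqr_ge0//.
  by rewrite sqrtr_sqr ger0_norm// mulr_ge0// ltW.
have wn k : w k != 0.
  by have := cor k; rewrite corE; apply: contraTneq => ->; rewrite mulr0 ltxx.
(* The cotangent of half the interior angle: [g] is minus its cosine and [w] its sine. *)
pose ka k := (1 - g k) / w k.
have mul_s (x y : R) : s * x = y -> x = s * y.
  by move=> <-; rewrite mulrA ss mul1r.
(* The projection of [c - P k] on the edge is the tangent length at [P k]; [bwd] does the same for
   the previous edge. *)
have fwd k : dot (edge P k) (c - P k) = r * l k * ka k.
  have := id1 (edge P (ord_pred k)) (edge P k) (c - P k).
  have -> : cross (edge P (ord_pred k)) (c - P k) = s * (r * l (ord_pred k)).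
    apply: mul_s; rewrite -tangent; congr (s * _).
    by rewrite edge_pred /cross !coordE; ring.
  rewrite dotE (mul_s _ _ (tangent k)) (mul_s _ _ (esym (erefl (corner P s k)))) corE.
  rewrite -eucl_norm_sqr -/(l k) => h.
  have sn : s != 0 by apply/eqP => z; move: ss; rewrite z mul0r => /esym/eqP; rewrite oner_eq0.
  have h2 : s * l (ord_pred k) * l k * (w k * dot (edge P k) (c - P k)) =
     s * l (ord_pred k) * l k * (r * l k * (1 - g k)).
    by move: h; set X := dot _ _ => h; lra.
  have nz : s * l (ord_pred k) * l k != 0 by rewrite !mulf_neq0// gt_eqF.
  have := mulfI nz h2 => h3; rewrite /ka mulrA -h3.
  by rewrite mulrC mulrA mulVf// mul1r.
have bwd k : dot (edge P (ord_pred k)) (c - P k) = - (r * l (ord_pred k) * ka k).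
  have := id2 (edge P (ord_pred k)) (edge P k) (c - P k).
  have -> : cross (edge P (ord_pred k)) (c - P k) = s * (r * l (ord_pred k)).
    apply: mul_s; rewrite -tangent; congr (s * _).
    by rewrite edge_pred /cross !coordE; ring.
  rewrite dotE (mul_s _ _ (tangent k)) (mul_s _ _ (esym (erefl (corner P s k)))) corE.
  rewrite -eucl_norm_sqr -/(l _) => h.
  have sn : s != 0 by apply/eqP => z; move: ss; rewrite z mul0r => /esym/eqP; rewrite oner_eq0.
  have h2 : s * l (ord_pred k) * l k * (w k * dot (edge P (ord_pred k)) (c - P k)) =
     s * l (ord_pred k) * l k * - (r * l (ord_pred k) * (1 - g k)).
    by move: h; set X := dot _ _ => h; lra.
  have nz : s * l (ord_pred k) * l k != 0 by rewrite !mulf_neq0// gt_eqF.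
  have := mulfI nz h2 => h3; rewrite /ka mulrA -mulNr -mulrN.
  by apply: (mulIf (wn k)); rewrite mulrC h3; field.
have lE k : l k = r * (ka k + ka (ordS k)).
  have e : l k ^+ 2 = dot (edge P k) (c - P k) - dot (edge P k) (c - P (ordS k)).
    by rewrite eucl_norm_sqr /edge /dot !coordE; ring.
  have b := bwd (ordS k); rewrite ordSK in b.
  rewrite fwd b in e.
  have ln : l k != 0 by rewrite gt_eqF.
  by apply: (mulfI ln); rewrite -expr2 e; ring.
have s3 : Num.sqrt 3 ^+ 2 = 3 :> R by rewrite sqr_sqrtr.
have s30 : 0 < Num.sqrt 3 :> R by rewrite sqrtr_gt0.
have s3n : Num.sqrt 3 != 0 :> R by rewrite gt_eqF.
have kaR k : interior_angle P k = pi / 2 -> ka k = 1.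
  move=> h; rewrite /ka /w /g h cos_pihalf oppr0 expr0n /= subr0 sqrtr1.
  by rewrite divr1.
have kaO k : interior_angle P k = 2 * pi / 3 -> ka k = Num.sqrt 3 / 3.
  move=> h; rewrite /ka /w /g h cos_2pi3 !opprK.
  have -> : 1 - (1 / 2) ^+ 2 = (Num.sqrt 3 / 2) ^+ 2 :> R.
    by rewrite [RHS]expr_div_n s3; field.
  rewrite sqrtr_sqr ger0_norm ?divr_ge0 ?(ltW s30)//.
  have -> : Num.sqrt 3 / 3 = (Num.sqrt 3)^-1 :> R.
    by apply: (mulIf s3n); rewrite mulVf// mulrAC -expr2 s3 divff.
  by field.
pose k1 := ordS k0; pose k2 := ordS k1; pose k3 := ordS k2; pose k4 := ordS k3.
have k5 : ordS k4 = k0 by rewrite /k4 /k3 /k2 /k1 ordS5.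
have ka0 : ka k0 = 1 by exact: kaR.
have ka1 : ka k1 = 1 by exact: kaR.
have ka2 : ka k2 = Num.sqrt 3 / 3.
  by apply: kaO; apply: a2; rewrite /k2 /k1; clear; case: k0 => [[|[|[|[|[|?]]]]] ?].
have ka3 : ka k3 = Num.sqrt 3 / 3.
  by apply: kaO; apply: a2; rewrite /k3 /k2 /k1; clear; case: k0 => [[|[|[|[|[|?]]]]] ?].
have ka4 : ka k4 = Num.sqrt 3 / 3.
  by apply: kaO; apply: a2; rewrite /k4 /k3 /k2 /k1; clear; case: k0 => [[|[|[|[|[|?]]]]] ?].
have perE : perimeter P = \sum_k l k by [].
have LE : perimeter P = 2 * r * (2 + Num.sqrt 3).
  rewrite perE (sum5 _ k0) -/k1 -/k2 -/k3 -/k4.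
  rewrite (lE k0) (lE k1) (lE k2) (lE k3) (lE k4) k5 -/k1 -/k2 -/k3 -/k4.
  by rewrite ka0 ka1 ka2 ka3 ka4; field.
have rL : r * perimeter P = 2.
  move: areaP; rewrite (convex_area ss cP) => -[a].
  suff -> : r * perimeter P = 2 * (s * shoelace P) by rewrite a mulr1.
  rewrite perE (sum5 _ ord0) !mulrDr -!tangent /shoelace /shoelace5.
  by rewrite /tri /cross /edge !coordE ordS5; field.
have L0 : 0 <= perimeter P by rewrite perE sumr_ge0// => i _; exact: ltW.
have sq : perimeter P ^+ 2 = 4 * (2 + Num.sqrt 3).
  have -> : perimeter P ^+ 2 = perimeter P * (2 * r * (2 + Num.sqrt 3)).
    by rewrite -LE expr2.
  have -> : perimeter P * (2 * r * (2 + Num.sqrt 3)) =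
     (r * perimeter P) * (2 * (2 + Num.sqrt 3)) by ring.
  by rewrite rL; ring.
rewrite -[LHS]ger0_norm// -sqrtr_sqr sq sqrtrM//.
have -> : 4 = 2 ^+ 2 :> R by ring.
by rewrite sqrtr_sqr ger0_norm.
Qed.

End Prismatic.

Lemma sqrt_lt (x y : R) : 0 < y -> x < y * y -> Num.sqrt x < y.
Proof.
move=> y0 xy; rewrite -[ltRHS]ger0_norm ?ltW// -sqrtr_sqr ltr_sqrt ?exprn_gt0// expr2.
Qed.

(** [97 / 56] is a convergent of [sqrt 3]; [539 / 279] still lies below [2956 / 1530], the bound of
    [ratio_lower_bound]. *)
Lemma sqrt_bound : Num.sqrt (2 + Num.sqrt 3) < 539 / 279 :> R.
Proof.
have s3 : Num.sqrt 3 < 97 / 56 :> R by apply: sqrt_lt; lra.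
by apply: sqrt_lt; lra.
Qed.

End Inner.

(** * Corners and vertices of the tiling *)

Lemma ltr_pwDr_half (R : realFieldType) (m x y : R) :
  0 < m -> m <= x -> - (m / 2) <= y -> 0 < x + y.
Proof. by lra. Qed.

Section Cones.
Context {R : realType}.
Implicit Types (p q u w b d n v : (R * R)%type) (s t : R).

Definition turn p : R * R := (- p.2, p.1).

(** The last two conditions describe the closed right-angled cone around [b]. Because it is closed,
    it cannot avoid all four quarter turns of [d]. *)
Lemma quarter_turns b d : b != 0 -> d != 0 ->
  exists2 e, e \in [:: d; turn d; - d; - turn d] &
    0 < dot e b /\ `|cross b e| <= dot e b.
Proof.
move=> b0 d0; have bb := dot_gt0 b0; have dd := dot_gt0 d0.
set x := dot d b; set y := cross b d.
have xy : 0 < x ^+ 2 + y ^+ 2.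
  have -> : x ^+ 2 + y ^+ 2 = dot b b * dot d d by rewrite /x /y /dot /cross; ring.
  exact: mulr_gt0.
have e1 : dot (turn d) b = - y by rewrite /y /dot /cross /=; ring.
have e2 : cross b (turn d) = x by rewrite /x /dot /cross /=; ring.
have e3 : dot (- d) b = - x by rewrite /x /dot /=; ring.
have e4 : cross b (- d) = - y by rewrite /y /cross /=; ring.
have e5 : dot (- turn d) b = y by rewrite /y /dot /cross /=; ring.
have e6 : cross b (- turn d) = - x by rewrite /x /dot /cross /=; ring.
have nz : x = 0 -> y = 0 -> False.
  by move=> x0 y0; move: xy; rewrite x0 y0 expr0n addr0 ltxx.
have [yx|xy'] := leP `|y| `|x|.
  have [x0|x0|x0] := ltrgt0P x.
  - by exists d; rewrite ?inE ?eqxx// -/x -/y; rewrite (gtr0_norm x0) in yx.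
  - exists (- d); rewrite ?inE ?eqxx ?orbT// e3 e4 normrN oppr_gt0.
    by rewrite (ltr0_norm x0) in yx.
  - exfalso; apply: nz => //; apply/eqP; rewrite -normr_le0.
    by move: yx; rewrite x0 normr0.
have [y0|y0|y0] := ltrgt0P y.
- exists (- turn d); rewrite ?inE ?eqxx ?orbT// e5 e6 normrN.
  by rewrite (gtr0_norm y0) in xy'; split => //; exact: ltW.
- exists (turn d); rewrite ?inE ?eqxx ?orbT// e1 e2 oppr_gt0.
  by rewrite (ltr0_norm y0) in xy'; split => //; exact: ltW.
- by move: xy'; rewrite y0 normr0 ltNge normr_ge0.
Qed.

(** [u] and [w] are unit vectors along the sides of a corner and [u + w] is its bisector. As the
    angle exceeds [pi / 2], the closed right-angled cone around the bisector lies in the open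
    corner. *)
Lemma cone_inner s u w d : s * s = 1 -> dot u u = 1 -> dot w w = 1 ->
  0 < s * cross u w -> dot u w < 0 -> 0 < dot d (u + w) ->
  `|cross (u + w) d| <= dot d (u + w) ->
  0 < s * cross u d /\ 0 < s * cross d w.
Proof.
move=> ss uu ww; set sg := s * _; set g := dot u w => s0 g0 x0.
set b := u + w in x0 *; set x := dot d b in x0 *; set y := cross b d => yx.
have sg2 : sg ^+ 2 = 1 - g ^+ 2.
  have -> : sg ^+ 2 = (s * s) * cross u w ^+ 2 by rewrite /sg; ring.
  by rewrite ss mul1r -[1]mulr1 -{1}uu -ww -dot_cross_sqr /g; ring.
have g1 : -1 < g.
  rewrite ltNge; apply/negP => g1.
  have : 0 < sg ^+ 2 by rewrite exprn_gt0.
  have : 1 <= g ^+ 2.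
    by rewrite -sqrrN -[leLHS](expr1n _ 2) lerXn2r ?nnegrE ?ler01//; lra.
  by rewrite sg2; lra.
(* The cotangent of half the angle is less than 1. *)
have sgg : 1 + g < sg.
  rewrite -(@ltr_pXn2r _ 2)// ?nnegrE ?(ltW s0)//; last lra.
  rewrite sg2; have -> : 1 - g ^+ 2 = (1 + g) ^+ 2 - 2 * (g * (1 + g)) by ring.
  have : g * (1 + g) < 0 by rewrite nmulr_rlt0//; lra.
  lra.
have s1 : `|s| = 1.
  by apply/eqP; rewrite -(@eqrXn2 _ 2)// (real_normK (num_real _)) expr2 ss expr1n.
have bb : dot b b = 2 * (1 + g).
  have -> : dot b b = dot u u + dot w w + 2 * dot u w.
    by rewrite /b /dot !coordE; ring.
  by rewrite uu ww -/g; ring.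
have b0 : 0 < dot b b by rewrite bb; lra.
have e1 : dot b b * (s * cross u d) = x * sg + (s * y) * (dot u u + g).
  by rewrite /x /y /sg /g /b /dot /cross !coordE; ring.
have e2 : dot b b * (s * cross d w) = x * sg - (s * y) * (dot w w + g).
  by rewrite /x /y /sg /g /b /dot /cross !coordE; ring.
rewrite uu in e1; rewrite ww in e2.
have sy : `|s * y| <= x by rewrite normrM s1 mul1r.
move: sy; rewrite ler_norml => /andP[y1 y2].
have xs : x * (1 + g) < x * sg by rewrite ltr_pM2l.
have k1 : - x * (1 + g) <= s * y * (1 + g) by rewrite ler_wpM2r//; lra.
have k2 : s * y * (1 + g) <= x * (1 + g) by rewrite ler_wpM2r//; lra.
by split; rewrite -(pmulr_rgt0 _ b0) ?e1 ?e2; lra.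
Qed.

(** For a corner of angle less than [2 * pi / 3], the directions in it are at an angle less than
    [pi / 3] from the bisector, where the cosine exceeds one half. *)
Lemma cone_outer s u w d : s * s = 1 -> dot u u = 1 -> dot w w = 1 ->
  0 < s * cross u w -> - (1 / 2) < dot u w -> d != 0 ->
  0 <= s * cross u d -> 0 <= s * cross d w ->
  eucl_norm d * eucl_norm (u + w) < 2 * dot d (u + w).
Proof.
move=> ss uu ww; set sg := s * _; set g := dot u w => s0 g0 d0 h1 h2.
have sg2 : sg ^+ 2 = 1 - g ^+ 2.
  have -> : sg ^+ 2 = (s * s) * cross u w ^+ 2 by rewrite /sg; ring.
  by rewrite ss mul1r -[1]mulr1 -{1}uu -ww -dot_cross_sqr /g; ring.
have g1 : g < 1.
  rewrite ltNge; apply/negP => g1.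
  have : 0 < sg ^+ 2 by rewrite exprn_gt0.
  have : 1 <= g ^+ 2.
    by rewrite -[leLHS](expr1n _ 2) lerXn2r ?nnegrE ?ler01//; lra.
  by rewrite sg2; lra.
set al := s * cross d w in h2; set be := s * cross u d in h1.
have dE : sg *: d = al *: u + be *: w.
  by apply: eq_pair; rewrite /sg /al /be /cross !coordE; ring.
have E1 : sg * dot d (u + w) = (al + be) * (1 + g).
  have -> : sg * dot d (u + w) = dot (sg *: d) (u + w) by rewrite /dot !coordE; ring.
  rewrite dE; have -> : dot (al *: u + be *: w) (u + w) =
    al * dot u u + be * dot w w + (al + be) * dot u w by rewrite /dot !coordE; ring.
  by rewrite uu ww -/g; ring.
have E2 : sg ^+ 2 * dot d d = al ^+ 2 + be ^+ 2 + 2 * al * be * g.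
  have -> : sg ^+ 2 * dot d d = dot (sg *: d) (sg *: d) by rewrite /dot !coordE; ring.
  rewrite dE; have -> : dot (al *: u + be *: w) (al *: u + be *: w) =
    al ^+ 2 * dot u u + be ^+ 2 * dot w w + 2 * al * be * dot u w.
    by rewrite /dot !coordE; ring.
  by rewrite uu ww -/g; ring.
have ab : 0 < al + be.
  rewrite lt_neqAle addr_ge0// andbT eq_sym paddr_eq0//; apply/negP => /andP[/eqP a0 /eqP b0].
  have := dot_gt0 d0; rewrite -(pmulr_rgt0 _ (exprn_gt0 2 s0)) E2 a0 b0.
  by rewrite !expr0n /= !mulr0 mul0r !addr0 ltxx.
have E3 : dot (u + w) (u + w) = 2 * (1 + g).
  have -> : dot (u + w) (u + w) = dot u u + dot w w + 2 * dot u w.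
    by rewrite /dot !coordE; ring.
  by rewrite uu ww -/g; ring.
have db : 0 < dot d (u + w).
  by rewrite -(pmulr_rgt0 _ s0) E1 mulr_gt0//; lra.
rewrite -(@ltr_pXn2r _ 2)// ?nnegrE; last 2 first.
- by rewrite mulr_ge0 ?eucl_norm_ge0.
- by rewrite mulr_ge0 ?(ltW db).
rewrite exprMn !eucl_norm_sqr E3 -(ltr_pM2l (exprn_gt0 2 s0)) mulrA E2.
have -> : sg ^+ 2 * (2 * dot d (u + w)) ^+ 2 = 4 * (sg * dot d (u + w)) ^+ 2 by ring.
rewrite E1.
have -> : 4 * ((al + be) * (1 + g)) ^+ 2 = (2 * (al + be) ^+ 2 * (1 + g)) * (2 * (1 + g)).
  by ring.
rewrite ltr_pM2r; last by lra.
have a2 : 0 < (al + be) ^+ 2 by rewrite exprn_gt0.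
have abg : al * be * g <= al * be by apply: ler_piMr; [exact: mulr_ge0|exact: ltW].
have -> : 2 * (al + be) ^+ 2 * (1 + g) = (al + be) ^+ 2 + (al + be) ^+ 2 * (1 + 2 * g).
  by ring.
have : 0 < (al + be) ^+ 2 * (1 + 2 * g) by rewrite mulr_gt0//; lra.
have -> : (al + be) ^+ 2 = al ^+ 2 + be ^+ 2 + 2 * (al * be) by ring.
by move: abg; rewrite -!mulrA; lra.
Qed.

(** Tiles around [v] are compared through directions instead of angles: two tiles entered along a
    common direction overlap. *)
Definition into P v d := exists2 e : R, 0 < e &
  forall t, 0 < t < e -> ((region (P : pentagon R))° : set (R * R)) (v + t *: d).

Section Corner.
Variables (P : pentagon R) (s : R).
Hypothesis simpleP : simple_pentagon P.
Hypothesis oP : oriented P s.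

Lemma sector_into k d : (forall t, 0 < t -> sector P s k (P k + t *: d)) ->
  into P (P k) d.
Proof.
move=> hs; case: (oP) => ss hin _; have [e e0 he] := hin k.
have [r r0 hr] := ball_small d e0; exists r => // t /andP[t0 tr].
have [oq rq] := he _ (hr t (P k) ltac:(rewrite gtr0_norm//)) (hs t t0).
rewrite /interior /=; apply: (@filterS _ _ _ (region P `\` outline P)) => [q []//|].
by apply: open_nbhs_nbhs; split => //; exact: region_inner_open.
Qed.

Lemma sector_crossE k d t (x : R * R) :
  s * cross x (P k + t *: d - P k) = t * (s * cross x d).
Proof. by rewrite /cross !coordE; ring. Qed.

(** The sector is then a union, and contains the whole half-plane of the next edge. *)
Lemma reflex_half k : corner P s k <= 0 ->
  exists2 n, n != 0 & forall d, 0 < dot n d -> into P (P k) d.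
Proof.
move=> c; exists (s *: turn (edge P k)).
  rewrite scaler_eq0 negb_or; apply/andP; split.
    case: (oP) => ss _ _; apply/eqP => s0.
    by move: ss; rewrite s0 mul0r => /esym/eqP; rewrite oner_eq0.
  apply: contra (edge_neq0 simpleP k) => /eqP h; apply/eqP/eq_pair.
    by have := congr1 snd h.
  by have /eqP := congr1 fst h; rewrite /= oppr_eq0 => /eqP.
move=> d hd; apply: sector_into => t t0; rewrite /sector ltNge c /=.
rewrite !sector_crossE; apply/orP; right; apply: mulr_gt0 => //.
by have -> : s * cross (edge P k) d = dot (s *: turn (edge P k)) d
  by rewrite /cross /dot !coordE /=; ring.
Qed.

(** [b] is the bisector. A direction of the closed cone may be perturbed by any [n] since the corner
    is open; this serves when the direction runs along the boundary of another tile. The last clause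
    rests on convexity and confines the whole tile to an angle less than [pi / 3] from [b]. *)
Lemma acute_cone k : (forall k, pi / 2 < interior_angle P k < 2 * pi / 3) ->
  exists2 b, b != 0 &
  (forall d, 0 < dot d b -> `|cross b d| <= dot d b ->
     into P (P k) d /\ forall n, exists2 e : R, 0 < e & into P (P k) (d + e *: n)) /\
  (forall q, region P q -> q = P k \/
     eucl_norm (q - P k) * eucl_norm b < 2 * dot (q - P k) b).
Proof.
move=> ang; have [c g0 g1] := angle_lt_2pi3 simpleP oP (ang k).
have ss : s * s = 1 by case: oP.
have cP : convex_position P s.
  by apply: corners_convex => // l; have [] := angle_lt_2pi3 simpleP oP (ang l).
set e := edge P k in g0 g1; set e' := edge P (ord_pred k) in g0 g1.
have n0 : 0 < eucl_norm e by rewrite eucl_norm_gt0 ?edge_neq0.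
have n'0 : 0 < eucl_norm e' by rewrite eucl_norm_gt0 ?edge_neq0.
pose u := (eucl_norm e)^-1 *: e; pose w := - (eucl_norm e')^-1 *: e'.
have unit (a : R * R) : 0 < eucl_norm a -> (eucl_norm a)^-1 ^+ 2 * dot a a = 1.
  by move=> a0; rewrite -eucl_norm_sqr -exprMn mulVf ?gt_eqF// expr1n.
have uu : dot u u = 1.
  by rewrite -(unit e)// /u /dot !coordE; ring.
have ww : dot w w = 1.
  by rewrite -(unit e')// /w /dot !coordE; ring.
have uw : dot u w = - (dot e' e / (eucl_norm e' * eucl_norm e)).
  by rewrite /u /w /dot !coordE invfM; ring.
have nn : 0 < eucl_norm e' * eucl_norm e by rewrite mulr_gt0.
have uw0 : dot u w < 0 by rewrite uw oppr_lt0 divr_gt0.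
have uw1 : - (1 / 2) < dot u w by rewrite uw ltrN2 ltr_pdivrMr.
have cuw : 0 < s * cross u w.
  have -> : s * cross u w = corner P s k / (eucl_norm e' * eucl_norm e).
    by rewrite /corner -/e -/e' /u /w /cross !coordE invfM; ring.
  by rewrite divr_gt0.
have cu d : s * cross u d = (eucl_norm e)^-1 * (s * cross e d).
  by rewrite /u /cross !coordE; ring.
have cw d : s * cross d w = (eucl_norm e')^-1 * (s * cross e' d).
  by rewrite /w /cross !coordE; ring.
have i0 : 0 < (eucl_norm e)^-1 by rewrite invr_gt0.
have i'0 : 0 < (eucl_norm e')^-1 by rewrite invr_gt0.
have dirin d : 0 < s * cross e d -> 0 < s * cross e' d -> into P (P k) d.
  move=> h1 h2; apply: sector_into => t t0; rewrite /sector c !sector_crossE.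
  by apply/andP; split; apply: mulr_gt0.
exists (u + w).
  apply/eqP => b0; have : u = - w by apply/eqP; rewrite -addr_eq0 b0.
  by move=> E; move: cuw; rewrite E /cross !coordE; lra.
split.
  move=> d d1 d2; have [h1 h2] := cone_inner ss uu ww cuw uw0 d1 d2.
  have {}h1 : 0 < s * cross e d by move: h1; rewrite cu pmulr_rgt0.
  have {}h2 : 0 < s * cross e' d by move: h2; rewrite cw pmulr_rgt0.
  split; first exact: dirin.
  move=> n; pose M := `|s * cross e n| + `|s * cross e' n| + 1.
  have M0 : 0 < M by rewrite /M ltr_wpDl// addr_ge0.
  pose m := Num.min (s * cross e d) (s * cross e' d).
  have m0 : 0 < m by rewrite /m lt_min h1.
  (* Such a perturbation lowers either cross product by at most half of its minimum [m]. *)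
  exists (m / (2 * M)); first by rewrite divr_gt0// mulr_gt0.
  have small x : `|x| <= M -> - (m / 2) <= m / (2 * M) * x.
    rewrite ler_norml => /andP[x1 _].
    have -> : - (m / 2) = m / (2 * M) * - M by field; rewrite gt_eqF.
    by rewrite ler_pM2l// divr_gt0// mulr_gt0.
  have m1 : m <= s * cross e d by rewrite /m ge_min lexx.
  have m2 : m <= s * cross e' d by rewrite /m ge_min lexx orbT.
  have E x : s * cross x (d + (m / (2 * M)) *: n) =
      s * cross x d + m / (2 * M) * (s * cross x n).
    by rewrite /cross !coordE; ring.
  have b1 : `|s * cross e n| <= M.
    by rewrite /M -addrA lerDl addr_ge0.
  have b2 : `|s * cross e' n| <= M.
    by rewrite /M -addrA addrCA lerDl addr_ge0.
  apply: dirin; rewrite E.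
    exact: ltr_pwDr_half m0 m1 (small _ b1).
  exact: ltr_pwDr_half m0 m2 (small _ b2).
move=> q rq; have [->|qk] := eqVneq q (P k); [by left|right].
have cq := region_cell cP rq.
apply: (cone_outer ss uu ww cuw uw1); first by rewrite subr_eq0.
- by rewrite cu mulr_ge0 ?(ltW i0)//; exact: (cq k).
- rewrite cw mulr_ge0 ?(ltW i'0)//; have := cq (ord_pred k); rewrite ord_predK.
  have -> // : s * tri (P (ord_pred k)) (P k) q = s * cross e' (q - P k).
  by rewrite /e' edge_pred /tri /cross !coordE; ring.
Qed.

End Corner.

End Cones.

(** * Sharp corners around a common vertex *)

Section Vertices.
Context {R : realType}.
Variable T : nat -> pentagon R.
Hypothesis simpleT : forall i, simple_pentagon (T i).
Hypothesis coverT : \bigcup_i region (T i) = [set: R * R].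
Hypothesis disjointT :
  forall i j, i <> j -> (region (T i))° `&` (region (T j))° = set0.
Hypothesis edgeT : edge_to_edge T.
Hypothesis areaT : forall i, area (region (T i)) = 1%E.
Implicit Types (p q u w b d n v : (R * R)%type) (i j : nat).

(** Ends are extreme points: [a] lies between [c] and [d], and neither of these is behind [a] as
    seen from [b]. *)
Lemma segment_endpoint (a b c d : R * R) : a != b -> segment a b = segment c d ->
  a = c \/ a = d.
Proof.
move=> ab E; have : segment c d a by rewrite -E; exact: segment_start.
move=> /segmentP[t /andP[t0 t1] at_].
have /segmentP[x /andP[x0 _] cx] : segment a b c by rewrite E; exact: segment_start.
have /segmentP[y /andP[y0 _] dy] : segment a b d by rewrite E; exact: segment_end.
have xy : (1 - t) * x + t * y = 0.
  have : ((1 - t) * x + t * y) *: (b - a) = 0.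
    have -> : ((1 - t) * x + t * y) *: (b - a) = c + t *: (d - c) - a.
      by rewrite cx dy; apply: eq_pair; rewrite !coordE; ring.
    by rewrite -at_ subrr.
  by move/eqP; rewrite scaler_eq0 subr_eq0 (eq_sym b) (negbTE ab) orbF => /eqP.
have [tE|t1'] := eqVneq t 1.
  by right; rewrite at_ tE scale1r addrC subrK.
left; have x00 : x = 0.
  apply/eqP; rewrite eq_le x0 andbT.
  have t2 : 0 < 1 - t by rewrite subr_gt0 lt_neqAle t1' t1.
  rewrite -(pmulr_rle0 _ t2); have := mulr_ge0 t0 y0; lra.
by rewrite cx x00 scale0r addr0.
Qed.

(** If the point is on a common side, it is an end of this side, since it is a vertex of the simple
    pentagon [T i]; and equal segments have the same ends. *)
Lemma shared_vertex i j k : region (T j) (T i k) -> exists l, T j l = T i k.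
Proof.
have [<- _|/eqP ij] := eqVneq i j; first by exists k.
move=> rj; have ri : region (T i) (T i k).
  by apply: outline_region; exact: outline_vertex.
have [[k' [l [E sk]]]|[k' [l [_ <-]]]] := edgeT ij ri rj; last by exists l.
have ne m : T i m != T i (ordS m).
  by rewrite eq_sym -subr_eq0; exact: edge_neq0.
have [<-|<-] := vertex_side (simpleT i) sk.
  by have [->|->] := segment_endpoint (ne k') E; [exists l|exists (ordS l)].
have E' : segment (T i (ordS k')) (T i k') = segment (T j l) (T j (ordS l)).
  by rewrite segmentC; exact: E.
have ne' : T i (ordS k') != T i k' by rewrite eq_sym.
by have [->|->] := segment_endpoint ne' E'; [exists l|exists (ordS l)].
Qed.

Lemma into_disjoint i j v d : i != j -> into (T i) v d -> into (T j) v d -> False.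
Proof.
move=> /eqP ij [e e0 he] [e' e'0 he'].
have m0 : 0 < Num.min e e' by rewrite lt_min e0.
have m1 : Num.min e e' / 2 < Num.min e e' by lra.
have : ((region (T i))° `&` (region (T j))°) (v + (Num.min e e' / 2) *: d).
  split; [apply: he|apply: he']; rewrite divr_gt0//=.
    by move: m1; rewrite lt_min => /andP[].
  by move: m1; rewrite lt_min => /andP[].
by rewrite disjointT.
Qed.

Definition sharp i := forall k, pi / 2 < interior_angle (T i) k < 2 * pi / 3.

Definition sharp_at v i := sharp i /\ exists k, T i k = v.

Lemma sharp_cone v i : sharp_at v i -> exists2 b, b != 0 &
  (forall d, 0 < dot d b -> `|cross b d| <= dot d b ->
     into (T i) v d /\ forall n, exists2 e : R, 0 < e & into (T i) v (d + e *: n)) /\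
  (forall q, region (T i) q -> q = v \/
     eucl_norm (q - v) * eucl_norm b < 2 * dot (q - v) b).
Proof.
move=> [si [k <-]]; have [s os] := tile_orientation (simpleT i) (areaT i).
exact: (acute_cone (simpleT i) os).
Qed.

(** The direction [d] is chosen so that [d] and [turn d] are the boundary rays of the closed cone of
    [i1], which therefore takes two of the four quarter turns of [d]. Each of the other three tiles
    takes one of the remaining two, so two of these tiles overlap. *)
Lemma no_four_sharp v i1 i2 i3 i4 : uniq [:: i1; i2; i3; i4] ->
  sharp_at v i1 -> sharp_at v i2 -> sharp_at v i3 -> sharp_at v i4 -> False.
Proof.
rewrite /= !inE !negb_or -!andbA => /and5P[n12 n13 n14 n23 /andP[n24 /andP[n34 _]]] s1 s2 s3 s4.
have [b b0 [cone _]] := sharp_cone s1.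
have bb := dot_gt0 b0.
pose d := b - turn b.
have rd : turn d = b + turn b.
  by apply: eq_pair; rewrite /turn /d !coordE /=; ring.
have d1 : dot d b = dot b b by rewrite /d /turn /dot !coordE /=; ring.
have d2 : cross b d = - dot b b by rewrite /d /turn /dot /cross !coordE /=; ring.
have d3 : dot (turn d) b = dot b b by rewrite rd /turn /dot !coordE /=; ring.
have d4 : cross b (turn d) = dot b b by rewrite rd /turn /dot /cross !coordE /=; ring.
have in1 : into (T i1) v d.
  by case: (cone d) => //; rewrite d1 ?d2 ?normrN ?gtr0_norm.
have in2 : into (T i1) v (turn d).
  by case: (cone (turn d)) => //; rewrite d3 ?d4 ?gtr0_norm.
have d0 : d != 0.
  by apply/eqP => E; move: bb; rewrite -d1 E /dot /= !mul0r addr0 ltxx.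
have other i : i1 != i -> sharp_at v i ->
    into (T i) v (- d) \/ into (T i) v (- turn d).
  move=> ni si; have [c c0 [ci _]] := sharp_cone si.
  have [e + [e1 e2]] := quarter_turns c0 d0; have [ie _] := ci _ e1 e2.
  rewrite !inE => /or4P[]/eqP E; rewrite E in ie; [exfalso|exfalso|left|right] => //.
    exact: into_disjoint ni in1 ie.
  exact: into_disjoint ni in2 ie.
case: (other _ n12 s2) => h2; case: (other _ n13 s3) => h3;
  case: (other _ n14 s4) => h4;
  by [apply: into_disjoint n23 h2 h3|apply: into_disjoint n24 h2 h4
     |apply: into_disjoint n34 h3 h4].
Qed.

(** Among the quarter turns of the normal [n] of the half-plane occupied by [T j], a sharp tile can
    only contain [- n]: a slight turn towards [n] would carry any of the others into the half-plane.
    Two sharp tiles cannot both contain [- n]. *)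
Lemma reflex_one_sharp v j s k i1 i2 : oriented (T j) s -> T j k = v ->
  corner (T j) s k <= 0 -> i1 != j -> i2 != j -> i1 != i2 ->
  sharp_at v i1 -> sharp_at v i2 -> False.
Proof.
move=> oj <- ck n1 n2 n12 s1 s2.
have [n n0 half] := reflex_half (simpleT j) oj ck.
have nn := dot_gt0 n0.
have back i : i != j -> sharp_at (T j k) i -> into (T i) (T j k) (- n).
  move=> ij si; have [c c0 [ci _]] := sharp_cone si.
  have [e eI [e1 e2]] := quarter_turns c0 n0; have [ie open] := ci _ e1 e2.
  suff <- : e = - n by [].
  have [x x0 ix] := open n.
  have [le0|lt0] := leP 0 (dot n e).
    exfalso; apply: into_disjoint ij ix _; apply: half.
    have -> : dot n (e + x *: n) = dot n e + x * dot n n.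
      by rewrite /dot !coordE; ring.
    by have := mulr_gt0 x0 nn; lra.
  have nt : dot n (turn n) = 0 by rewrite /dot /turn /=; ring.
  have ntN : dot n (- turn n) = 0 by rewrite /dot /turn /=; ring.
  move: eI lt0; rewrite !inE => /or4P[]/eqP -> //; rewrite ?nt ?ntN ?ltxx//.
  by rewrite ltNge (ltW nn).
exact: into_disjoint n12 (back _ n1 s1) (back _ n2 s2).
Qed.

(** If all tiles at [v] were sharp, three points close to [v], in directions [2 * pi / 3] apart and
    at least [pi / 3] away from the bisector of [i], would lie in three distinct tiles other than
    [i], making four sharp tiles at [v]. *)
Lemma sharp_meets_blunt v i (e : R) : 0 < e ->
  (forall j q, region (T j) q -> ball v e q -> region (T j) v) ->
  sharp_at v i -> exists2 j, ~ sharp j & exists k, T j k = v.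
Proof.
move=> e0 near si; apply: contrapT => no.
have all_sharp j : (exists k, T j k = v) -> sharp_at v j.
  by move=> hj; split => //; apply: contrapT => nj; apply: no; exists j.
have [b b0 [_ cone]] := sharp_cone si; have bb := dot_gt0 b0.
pose r3 : R := Num.sqrt 3 / 2.
have r3E : r3 ^+ 2 = 3 / 4.
  by rewrite /r3 exprMn sqr_sqrtr ?ler0n//; field.
(* [d1] and [d2] are at angle exactly [pi / 3] from [b], which the strict bound of [sharp_cone]
   excludes for tile [i]. *)
pose d0 := - b; pose d1 := 2^-1 *: b + r3 *: turn b.
pose d2 := 2^-1 *: b - r3 *: turn b.
have n0 : dot d0 d0 = dot b b by rewrite /d0 /dot /=; ring.
have nE x : dot (2^-1 *: b + x *: turn b) (2^-1 *: b + x *: turn b) =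
    (4^-1 + x ^+ 2) * dot b b.
  by rewrite /dot /turn !coordE /=; field.
have n1 : dot d1 d1 = dot b b by rewrite /d1 nE r3E; field.
have n2 : dot d2 d2 = dot b b by rewrite /d2 -scaleNr nE sqrrN r3E; field.
pose isd d := [/\ dot d d = dot b b, 2 * dot d b <= dot b b & True].
have i0 : isd d0 by split => //; rewrite /d0; move: bb; rewrite /dot /=; lra.
have i1 : isd d1 by split => //; rewrite /d1 /dot /turn !coordE /=; lra.
have i2 : isd d2 by split => //; rewrite /d2 /dot /turn !coordE /=; lra.
have [x0 x00 h0] := ball_small d0 e0.
have [x1 x10 h1] := ball_small d1 e0.
have [x2 x20 h2] := ball_small d2 e0.
pose t := Num.min x0 (Num.min x1 x2) / 2.
have m0 : 0 < Num.min x0 (Num.min x1 x2) by rewrite !lt_min x00 x10.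
have t0 : 0 < t by rewrite divr_gt0.
have : t < Num.min x0 (Num.min x1 x2) by rewrite /t; lra.
rewrite !lt_min => /and3P[t0' t1' t2'].
have tn : `|t| = t by rewrite gtr0_norm.
have normd d : isd d -> eucl_norm d = eucl_norm b by move=> [E _ _]; rewrite /eucl_norm E.
have tile d : isd d -> ball v e (v + t *: d) ->
    exists j, [/\ sharp_at v j, i != j & region (T j) (v + t *: d)].
  move=> hd bd; have : [set: R * R] (v + t *: d) by [].
  rewrite -coverT => -[j _ rj]; exists j.
  have rv := near _ _ rj bd.
  have sj : sharp_at v j.
    by apply: all_sharp; case: si => _ [k kv]; rewrite -kv; apply: shared_vertex; rewrite kv.
  split => //; apply/eqP => ij; rewrite -ij in rj.
  have vd : v + t *: d - v = t *: d by rewrite addrC addKr.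
  case: (cone _ rj) => [E|].
    move: bb; have [<- _ _] := hd.
    have td : t *: d = 0 by rewrite -vd E subrr.
    move/eqP: td; rewrite scaler_eq0 (gt_eqF t0) /= => /eqP ->.
    by rewrite /dot /= mul0r addr0 ltxx.
  rewrite vd eucl_normZ (gtr0_norm t0) (normd _ hd).
  have -> : 2 * dot (t *: d) b = t * (2 * dot d b) by rewrite /dot !coordE; ring.
  rewrite -mulrA ltr_pM2l// -expr2 eucl_norm_sqr.
  by case: hd => _ + _; lra.
have [j0 [sj0 ij0 r0]] := tile _ i0 (h0 t v ltac:(by rewrite tn)).
have [j1 [sj1 ij1 r1]] := tile _ i1 (h1 t v ltac:(by rewrite tn)).
have [j2 [sj2 ij2 r2]] := tile _ i2 (h2 t v ltac:(by rewrite tn)).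
(* Were both points in one tile with bisector [c], the dot product of [d + d'] with [c] would exceed
   the product of the norms of [b] and [c]; but [d + d'] has the norm of [b]. *)
have dist d d' d'' j j' : isd d -> isd d' -> isd d'' -> d + d' = - d'' ->
   sharp_at v j -> region (T j) (v + t *: d) -> region (T j') (v + t *: d') -> j != j'.
  move=> hd hd' hd'' sum sj rj rj'; apply/eqP => jj; rewrite -jj in rj'.
  have [c c0 [_ co]] := sharp_cone sj.
  have key x : isd x -> region (T j) (v + t *: x) ->
      eucl_norm b * eucl_norm c < 2 * dot x c.
    move=> hx rx; have vd : v + t *: x - v = t *: x by rewrite addrC addKr.
    case: (co _ rx) => [E|].
      move: bb; have [<- _ _] := hx.
      have td : t *: x = 0 by rewrite -vd E subrr.
      move/eqP: td; rewrite scaler_eq0 (gt_eqF t0) /= => /eqP ->.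
      by rewrite /dot /= mul0r addr0 ltxx.
    rewrite vd eucl_normZ (gtr0_norm t0) (normd _ hx).
    have -> : 2 * dot (t *: x) c = t * (2 * dot x c) by rewrite /dot !coordE; ring.
    by rewrite -mulrA ltr_pM2l.
  have k1 := key _ hd rj; have k2 := key _ hd' rj'.
  have k3 : dot d c + dot d' c = - dot d'' c.
    have -> : - dot d'' c = dot (- d'') c by rewrite /dot /=; ring.
    by rewrite -sum /dot !coordE; ring.
  have := norm_dot_le d'' c; rewrite (normd _ hd'') ler_norml => /andP[k4 _].
  by lra.
apply: (@no_four_sharp v i j0 j1 j2) => //.
have s01 : d0 + d1 = - d2 by apply: eq_pair; rewrite /d0 /d1 /d2 !coordE; field.
have s02 : d0 + d2 = - d1 by apply: eq_pair; rewrite /d0 /d1 /d2 !coordE; field.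
have s12 : d1 + d2 = - d0 by apply: eq_pair; rewrite /d0 /d1 /d2 !coordE; field.
rewrite /= !inE !negb_or ij0 ij1 ij2 (dist _ _ _ _ _ i0 i1 i2 s01 sj0 r0 r1).
by rewrite (dist _ _ _ _ _ i0 i2 i1 s02 sj0 r0 r2) (dist _ _ _ _ _ i1 i2 i0 s12 sj1 r1 r2).
Qed.

End Vertices.

(** * Length inside a disk *)

Section Lengths.
Context {R : realType}.
Implicit Types (p q x y : (R * R)%type) (P : pentagon R) (r : R).

Notation plane_measurable A :=
  (measurable (A : set (measurableTypeR R * measurableTypeR R))).

Lemma disk0_norm r p : disk (0, 0)%R r p <-> eucl_norm p <= r.
Proof. by rewrite /disk /= eucl_dist0l. Qed.

Lemma norm_segment r p q x : eucl_norm p <= r -> eucl_norm q <= r ->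
  segment p q x -> eucl_norm x <= r.
Proof.
move=> pr qr /segmentP[t /andP[t0 t1] ->].
have -> : p + t *: (q - p) = (1 - t) *: p + t *: q.
  by apply: eq_pair; rewrite !coordE; ring.
apply: (le_trans (eucl_normD _ _)); rewrite !eucl_normZ (ger0_norm t0).
rewrite ger0_norm ?subr_ge0//.
have -> : r = (1 - t) * r + t * r by ring.
by apply: lerD; apply: ler_wpM2l => //; rewrite subr_ge0.
Qed.

Lemma line_norm2_continuous p q :
  continuous (fun t : R => dot (p + t *: q) (p + t *: q)).
Proof.
move=> t; apply: (@continuous_comp _ _ _ (fun t : R => p + t *: q) (fun q => dot q q)).
  exact: continuous_line.
exact: norm2_continuous.
Qed.

Lemma param_measurable r p q : 0 <= r ->
  measurable [set t : R | 0 <= t <= 1 /\ disk (0, 0)%R r (p + t *: (q - p))].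
Proof.
move=> r0; apply: closed_measurable.
have -> : [set t : R | 0 <= t <= 1 /\ disk (0, 0)%R r (p + t *: (q - p))] =
   `[0, 1]%classic `&` (fun t : R => dot (p + t *: (q - p)) (p + t *: (q - p))) @^-1`
     [set x : R | x <= r ^+ 2].
  by rewrite disk0E//; apply/seteqP; split => t /=; rewrite in_itv.
apply: closedI; first exact: itv_closed.
apply: closed_comp; last exact: closed_le.
by move=> ? _; exact: line_norm2_continuous.
Qed.

Lemma length_in_ge0 p q (A : set (R * R)) : (0 <= length_in p q A)%E.
Proof. by rewrite /length_in mule_ge0// lee_fin eucl_dist_ge0. Qed.

Lemma length_in_sub r p q x y : segment p q x -> segment p q y ->
  eucl_norm x <= r -> eucl_norm y <= r ->
  ((eucl_dist x y)%:E <= length_in p q (disk (0, 0)%R r))%E.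
Proof.
have sym u v a b : segment p q (p + a *: (q - p)) -> a <= b ->
    0 <= a <= 1 -> 0 <= b <= 1 -> u = p + a *: (q - p) -> v = p + b *: (q - p) ->
    eucl_norm u <= r -> eucl_norm v <= r ->
    ((eucl_dist u v)%:E <= length_in p q (disk (0, 0)%R r))%E.
  move=> _ ab /andP[a0 _] /andP[_ b1] uE vE ur vr.
  have r0 : 0 <= r := le_trans (eucl_norm_ge0 u) ur.
  have -> : (eucl_dist u v)%:E = ((eucl_dist p q)%:E * (b - a)%:E)%E.
    rewrite -EFinM uE vE; congr EFin; rewrite /eucl_dist.
    have -> : p + b *: (q - p) - (p + a *: (q - p)) = (b - a) *: (q - p).
      by apply: eq_pair; rewrite !coordE; ring.
    by rewrite eucl_normZ ger0_norm ?subr_ge0// mulrC.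
  apply: lee_pmul => //; rewrite ?lee_fin ?eucl_dist_ge0 ?subr_ge0//.
  have -> : (b - a)%:E = lebesgue_measure `[a, b]%classic :> \bar R.
    rewrite lebesgue_measure_itv /= lte_fin; case: ltP => // ba.
    by have -> : b = a by [apply/eqP; rewrite eq_le ba ab]; rewrite subrr.
  apply: le_measure; rewrite ?inE.
  - exact: measurable_itv.
  - exact: param_measurable.
  move=> t /=; rewrite in_itv /= => /andP[t1 t2]; split.
    by rewrite (le_trans a0 t1) (le_trans t2 b1).
  apply/disk0_norm; apply: (norm_segment ur vr).
  have [E|ne] := eqVneq a b.
    have -> : t = a by apply/eqP; rewrite eq_le t1 E t2.
    by rewrite -uE; exact: segment_start.
  have ba : 0 < b - a by rewrite subr_gt0 lt_neqAle ne.
  apply/segmentP; exists ((t - a) / (b - a)).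
    by rewrite divr_ge0 ?subr_ge0//= ler_pdivrMr// mul1r lerD2r.
  rewrite uE vE; have -> : p + b *: (q - p) - (p + a *: (q - p)) = (b - a) *: (q - p).
    by apply: eq_pair; rewrite !coordE; ring.
  by rewrite scalerA divfK ?gt_eqF//; apply: eq_pair; rewrite !coordE; ring.
move=> /segmentP[a a01 xE] /segmentP[b b01 yE] xr yr.
have [ab|ba] := leP a b.
  by apply: (sym x y a b) => //; exact: segment_point.
by rewrite eucl_distC; apply: (sym y x b a) => //; [exact: segment_point|exact: ltW].
Qed.

(* The function [min(|x|, r)] is 1-Lipschitz, and constant outside the disk. *)
Lemma length_in_radial r p q x y : 0 <= r -> segment p q x -> segment p q y ->
  (`|Num.min (eucl_norm x) r - Num.min (eucl_norm y) r|%:E <=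
     length_in p q (disk (0, 0)%R r))%E.
Proof.
move=> r0.
have normB u v : eucl_norm u - eucl_norm v <= eucl_dist u v.
  have := eucl_dist_triangle 0 v u; rewrite !eucl_dist0l (eucl_distC v); lra.
suff wl u v : segment p q u -> segment p q v -> eucl_norm v <= eucl_norm u ->
    (`|Num.min (eucl_norm u) r - Num.min (eucl_norm v) r|%:E <=
     length_in p q (disk (0, 0)%R r))%E.
  move=> sx sy; have [h|h] := leP (eucl_norm y) (eucl_norm x); first exact: wl.
  by rewrite distrC; apply: wl => //; exact: ltW.
move=> su sv vu; have [ur|ru] := leP (eucl_norm u) r.
  rewrite (min_idPl (le_trans vu ur)) ger0_norm ?subr_ge0//.
  apply: (le_trans _ (length_in_sub su sv ur (le_trans vu ur))).
  by rewrite lee_fin normB.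
have [rv|vr] := leP r (eucl_norm v).
  by rewrite subrr normr0 length_in_ge0.
pose f (t : R) := dot (v + t *: (u - v)) (v + t *: (u - v)).
have f0 : f 0 = eucl_norm v ^+ 2 by rewrite /f scale0r addr0 eucl_norm_sqr.
have f1 : f 1 = eucl_norm u ^+ 2.
  by rewrite /f scale1r addrC subrK eucl_norm_sqr.
have f01 : f 0 <= r ^+ 2 <= f 1.
  rewrite f0 f1; apply/andP.
  by split; rewrite lerXn2r ?nnegrE ?eucl_norm_ge0//; exact: ltW.
have cf : {within `[0, 1], continuous f}.
  by apply: continuous_subspaceT; exact: line_norm2_continuous.
have f01' := le_trans (proj1 (andP f01)) (proj2 (andP f01)).
have f01m : Num.min (f 0) (f 1) <= r ^+ 2 <= Num.max (f 0) (f 1).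
  by rewrite (min_idPl f01') (max_idPr f01').
(* [z] is the point where the segment from [v] leaves the disk. *)
have [t t01 ft] := IVT ler01 cf f01m.
rewrite in_itv /= in t01; pose z := v + t *: (u - v).
have zr : eucl_norm z = r.
  by apply/eqP; rewrite -(@eqrXn2 _ 2)// ?eucl_norm_ge0// eucl_norm_sqr -ft.
have sz : segment p q z by apply: (segment_sub sv su); exact: segment_point.
rewrite ger0_norm ?subr_ge0 ?(ltW vr)//.
have [h1 h2] : eucl_norm z <= r /\ eucl_norm v <= r by rewrite zr; split => //; exact: ltW.
apply: (le_trans _ (length_in_sub sz sv h1 h2)).
by rewrite lee_fin -zr normB.
Qed.

Lemma ball_area p : area (ball p (1 : R)) = 4%:E.
Proof.
have -> : ball p (1 : R) = ball p.1 (1 : R) `*` ball p.2 (1 : R).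
  by apply/seteqP; split.
rewrite /area product_measure1E; [|exact: measurable_ball|exact: measurable_ball].
transitivity (lebesgue_measure (ball p.1 (1 : R)) * lebesgue_measure (ball p.2 (1 : R)))%E.
  by [].
rewrite !lebesgue_measure_ball// -EFinM; congr EFin; lra.
Qed.

Lemma ball_dist p x : ball p (1 : R) x -> eucl_dist p x <= 2.
Proof.
move=> /ball_plane[h1 h2].
rewrite /eucl_dist -(@ler_pXn2r _ 2)// ?nnegrE ?eucl_norm_ge0// eucl_norm_sqr.
have sq (a b : R) : `|a - b| < 1 -> (b - a) * (b - a) <= 1.
  rewrite distrC => /ltW h; rewrite -expr2 -real_normK ?num_real//.
  by rewrite exprn_ile1.
by have := sq _ _ h1; have := sq _ _ h2; rewrite /dot !coordE; lra.
Qed.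

(** The ball of radius 1 is a square of area 4, too large for a tile of area 1, so the outline meets
    it. *)
Lemma outline_near P p : area (region P) = 1%E -> region P p ->
  exists2 x, outline P x & eucl_dist p x <= 2.
Proof.
move=> a1 rp.
have [x [px ox]] : exists x, ball p 1 x /\ outline P x.
  apply: contrapT => no.
  have sub : ball p (1 : R) `<=` region P.
    move=> q pq; apply/(region_segment (p := p)) => // z pqz oz.
    apply: no; exists z; split => //; move: z pqz {oz}; apply: ball_segment => //.
    exact: ballxx.
  have : (area (ball p (1 : R)) <= area (region P))%E.
    apply: le_area => //; last exact: region_measurable.
    by apply: open_plane_measurable; exact: ball_open.
  by rewrite ball_area a1 lee_fin; lra.
by exists x => //; exact: ball_dist.
Qed.

End Lengths.

Lemma chain_distance (R : realDomainType) (x a b c d e y : R) :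
  y = a \/ y = b \/ y = c \/ y = d \/ y = e ->
  y - x <= `|x - a| + `|a - b| + `|b - c| + `|c - d| + `|d - e|.
Proof.
have le (u v : R) : v - u <= `|u - v| by rewrite distrC ler_norm.
have := le x a; have := le a b; have := le b c; have := le c d; have := le d e.
have := normr_ge0 (x - a); have := normr_ge0 (a - b); have := normr_ge0 (b - c).
have := normr_ge0 (c - d); have := normr_ge0 (d - e).
by move=> h1 h2 h3 h4 h5 h6 h7 h8 h9 h0; case=> [->|[->|[->|[->|->]]]]; lra.
Qed.

(** * Edge length attributed to tiles *)

Section OrientedSides.
Context {R : realType}.
Variables (T : nat -> pentagon R) (sg : nat -> R).
Hypothesis simpleT : forall i, simple_pentagon (T i).
Hypothesis disjointT :
  forall i j, i <> j -> (region (T i))° `&` (region (T j))° = set0.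
Hypothesis areaT : forall i, area (region (T i)) = 1%E.
Hypothesis sgT : forall i, oriented (T i) (sg i).
Implicit Types (i j : nat) (k l : 'I_5).

(** Each side is directed with its tile on the left. Two tiles with a common edge thus receive its
    two orientations, both of which are counted in [perimeter_in]. *)
Definition left_side (ik : nat * 'I_5) : (R * R) * (R * R) :=
  if sg ik.1 == 1 then (T ik.1 ik.2, T ik.1 (ordS ik.2))
  else (T ik.1 (ordS ik.2), T ik.1 ik.2).

Lemma left_side_left i k : let a := (left_side (i, k)).1 in
  let b := (left_side (i, k)).2 in
  exists2 e : R, 0 < e & forall q, ball (a + 2^-1 *: (b - a)) e q ->
    0 < cross (b - a) (q - a) -> ((region (T i))° : set (R * R)) q.
Proof.
have [e e0 he] := oriented_edge (simpleT i) k (sgT i) half01.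
have int q : ~ outline (T i) q /\ region (T i) q -> ((region (T i))° : set (R * R)) q.
  move=> [oq rq]; rewrite /interior /=.
  apply: (@filterS _ _ _ (region (T i) `\` outline (T i))) => [x []//|].
  by apply: open_nbhs_nbhs; split => //; exact: region_inner_open.
rewrite /left_side /=; case: ifPn => [/eqP s1|s1] /=; exists e => // q bq cq;
  apply: int; apply: he => //.
  by rewrite s1 mul1r.
  by move: bq; congr (ball _ _ _); apply: eq_pair; rewrite /edge !coordE; field.
have -> : sg i = -1.
  have [ss _ _] := sgT i; apply/eqP; rewrite -addr_eq0.
  have : (sg i - 1) * (sg i + 1) == 0.
    by apply/eqP; transitivity (sg i * sg i - 1); [ring|rewrite ss subrr].
  by rewrite mulf_eq0 subr_eq0 (negbTE s1).
move: cq; rewrite /edge.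
suff -> : -1 * cross (T i (ordS k) - T i k) (q - T i k) =
  cross (T i k - T i (ordS k)) (q - T i (ordS k)) by [].
by rewrite /cross !coordE; ring.
Qed.

(** Two tiles to the left of the same oriented edge would overlap near its midpoint. *)
Lemma left_side_inj : injective left_side.
Proof.
move=> [i k] [j l] E; have ij : i = j.
  apply: contrapT => ij.
  have [e e0 he] := left_side_left i k; have [e' e'0 he'] := left_side_left j l.
  rewrite -E in he'.
  have m0 : 0 < Num.min e e' by rewrite lt_min e0.
  set a := (left_side (i, k)).1 in he he'; set b := (left_side (i, k)).2 in he he'.
  have ab : b - a != 0.
    have n0 := edge_neq0 (simpleT i) k.
    rewrite /a /b /left_side /=; case: ifP => _ //=.
    by move: n0; rewrite /edge -opprB oppr_eq0.
  have [q bq cq] : exists2 q, ball (a + 2^-1 *: (b - a)) (Num.min e e') q &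
      0 < cross (b - a) (q - a).
    pose n : R * R := (- (b - a).2, (b - a).1).
    have [d d0 hd] := ball_small n m0.
    exists (a + 2^-1 *: (b - a) + (d / 2) *: n).
      by apply: hd; rewrite gtr0_norm ?divr_gt0//; lra.
    have -> : cross (b - a) (a + 2^-1 *: (b - a) + (d / 2) *: n - a) =
      d / 2 * dot (b - a) (b - a) by rewrite /cross /dot /n !coordE /=; ring.
    by rewrite mulr_gt0 ?divr_gt0// dot_gt0.
  have : ((region (T i))° `&` (region (T j))°) q.
    split; [apply: he|apply: he'] => //; apply: le_ball bq; rewrite ge_min lexx ?orbT//.
  by rewrite (disjointT ij).
rewrite -ij in E *; congr (_, _).
have [inj _ _] := simpleT i; apply: inj.
by move: E; rewrite /left_side /=; case: ifP => _ [E1 E2].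
Qed.

Definition tile_length r i : \bar R :=
  (\sum_(k < 5) length_in (left_side (i, k)).1 (left_side (i, k)).2 (disk (0, 0)%R r))%E.

Lemma tile_length_ge r i (D : 'I_5 -> R) :
  (forall k, ((D k)%:E <= length_in (left_side (i, k)).1 (left_side (i, k)).2
     (disk (0, 0)%R r))%E) ->
  ((\sum_k D k)%:E <= tile_length r i)%E.
Proof. by move=> h; rewrite -sumEFin; apply: lee_sum => k _; exact: h. Qed.

Lemma left_side_segment i k :
  segment (left_side (i, k)).1 (left_side (i, k)).2 = side (T i) k.
Proof. by rewrite /left_side /side; case: ifP => _ //=; rewrite segmentC. Qed.

Lemma side_start i k : side (T i) k (T i k).
Proof. exact: segment_start. Qed.

Lemma side_end i k : side (T i) k (T i (ordS k)).
Proof. exact: segment_end. Qed.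

Lemma tile_length_inside r i : (forall k, eucl_norm (T i k) <= r) ->
  ((perimeter (T i))%:E <= tile_length r i)%E.
Proof.
move=> h; apply: tile_length_ge => k; apply: length_in_sub => //.
  by rewrite left_side_segment; exact: side_start.
by rewrite left_side_segment; exact: side_end.
Qed.

(** Along the outline, from a point [x] near [p] to the vertex [T i m], the radius truncated at [r]
    rises from at most [rho + 2] to [r]. This makes a tile that leaves the disk pay for it, whatever
    its diameter. *)
Lemma tile_length_crossing r rho i p m : 0 <= r -> region (T i) p ->
  eucl_norm p <= rho -> r <= eucl_norm (T i m) ->
  ((r - rho - 2)%:E <= tile_length r i)%E.
Proof.
move=> r0 rp prho rm; have [x [k sx] px] := outline_near (areaT i) rp.
pose phi (y : R * R) := Num.min (eucl_norm y) r.
(* The path starts at [x], inside side [k], so only the rest of this side counts. *)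
pose D l := if l == k then `|phi x - phi (T i (ordS k))|
            else `|phi (T i l) - phi (T i (ordS l))|.
apply: (@le_trans _ _ (\sum_l D l)%:E); last first.
  apply: tile_length_ge => l; rewrite /D; case: eqP => [->|_];
    apply: length_in_radial => //; rewrite left_side_segment //;
    solve [exact: side_start|exact: side_end].
have xr : phi x <= rho + 2.
  rewrite /phi ge_min; apply/orP; left.
  have := eucl_dist_triangle 0 p x; rewrite !eucl_dist0l; lra.
have mr : phi (T i m) = r by rewrite /phi; exact/min_idPr.
rewrite lee_fin (sum5 D k) {1}/D eqxx.
have d1 : ordS k == k = false by exact/negbTE/ordS_neq.
have d2 : ordS (ordS k) == k = false by exact/negbTE/ordSS_neq.
have d3 : ordS (ordS (ordS k)) == k = false by case: k {sx d1 d2 D} => -[|[|[|[|[|]]]]].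
have d4 : ordS (ordS (ordS (ordS k))) == k = false.
  by case: k {sx d1 d2 d3 D} => -[|[|[|[|[|]]]]].
rewrite /D d1 d2 d3 d4.
have cases : m = ordS k \/ m = ordS (ordS k) \/ m = ordS (ordS (ordS k)) \/
   m = ordS (ordS (ordS (ordS k))) \/ m = ordS (ordS (ordS (ordS (ordS k)))).
  pose Q l := l = ordS k \/ l = ordS (ordS k) \/ l = ordS (ordS (ordS k)) \/
   l = ordS (ordS (ordS (ordS k))) \/ l = ordS (ordS (ordS (ordS (ordS k)))).
  apply: (@ordS_ind _ Q _ (ordS k) m); last by left.
  move=> l; rewrite /Q; case=> [->|[->|[->|[->|->]]]]; rewrite ?ordS5; tauto.
apply: (@le_trans _ _ (phi (T i m) - phi x)); first by rewrite mr; lra.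
by apply: chain_distance; case: cases => [->|[->|[->|[->|->]]]]; tauto.
Qed.

Lemma total_length r (X : seq nat) : uniq X ->
  (\sum_(i <- X) tile_length r i <= 2%:E * perimeter_in T r)%E.
Proof.
move=> uX; rewrite /perimeter_in muleA -EFinM divff// mul1e.
apply: esum_ge; pose s := [seq (i, k) | i <- X, k <- enum 'I_5].
have us : uniq [seq left_side x | x <- s].
  by rewrite (map_inj_uniq left_side_inj) allpairs_uniq ?enum_uniq// => -[? ?] [? ?].
exists [set` [seq left_side x | x <- s]].
  split; first exact: finite_seq.
  move=> e /= /mapP[[i k] _ ->]; exists i, k.
  by rewrite /left_side /=; case: ifP => _; [left|right].
rewrite -fsbig_seq// big_map big_allpairs_dep /=.
by rewrite le_eqVlt; apply/orP; left; apply/eqP; apply: eq_bigr => i _; rewrite big_enum.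
Qed.

End OrientedSides.

(** * Counting tiles *)

Section Counting.
Context {R : realType}.
Variables (T : nat -> pentagon R) (sg : nat -> R).
Hypothesis simpleT : forall i, simple_pentagon (T i).
Hypothesis coverT : \bigcup_i region (T i) = [set: R * R].
Hypothesis disjointT :
  forall i j, i <> j -> (region (T i))° `&` (region (T j))° = set0.
Hypothesis edgeT : edge_to_edge T.
Hypothesis areaT : forall i, area (region (T i)) = 1%E.
Hypothesis shapeT : forall i, ~ convex_set (region (T i)) \/ sharp T i.
Hypothesis sgT : forall i, oriented (T i) (sg i).
Implicit Types (i j : nat) (k l : 'I_5) (X : seq nat) (v q : (R * R)%type).

Lemma sharp_perimeter i : sharp T i -> 324 / 85 <= perimeter (T i).
Proof.
move=> si; have [ss _ _] := sgT i; apply: (convex_perimeter ss) => //.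
apply: corners_convex => // k.
by have [] := angle_lt_2pi3 (simpleT i) (sgT i) (si k).
Qed.

Lemma blunt_corner i : ~ sharp T i -> exists k, corner (T i) (sg i) k <= 0.
Proof.
move=> ni; have [nc|//] := shapeT i.
exact: (nonconvex_corner (sg i) (simpleT i) nc).
Qed.

Lemma blunt_perimeter i : ~ sharp T i -> 4 <= perimeter (T i).
Proof.
move=> /blunt_corner[k ck]; exact: (reflex_perimeter (simpleT i) (sgT i) ck (areaT i)).
Qed.

Definition touches (rho : R) i := exists2 q, region (T i) q & eucl_norm q <= rho.

Definition inside (rho : R) i := [forall k, eucl_norm (T i k) <= rho].

Lemma insideP rho i : reflect (forall k, eucl_norm (T i k) <= rho) (inside rho i).
Proof. exact: forallP. Qed.

Lemma vertex_touches rho j l : eucl_norm (T j l) <= rho -> touches rho j.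
Proof. by exists (T j l) => //; apply: outline_region; exact: outline_vertex. Qed.

Lemma tile_length_crossing_touches r rho i : 0 <= r -> touches rho i -> ~~ inside r i ->
  ((r - rho - 2)%:E <= tile_length T sg r i)%E.
Proof.
move=> r0 [q rq qr]; rewrite negb_forall => /existsP[k]; rewrite -ltNge => /ltW kr.
exact: tile_length_crossing rq qr kr.
Qed.

Section Bounded.
Variables (r0 c : R).
Hypothesis c0 : 0 <= c.
Hypothesis ratio : forall r, r0 <= r -> (perimeter_in T r <= (c * (pi * r ^+ 2))%:E)%E.

Lemma total_tile_length r X (L : nat -> R) : r0 <= r -> uniq X ->
  (forall i, i \in X -> ((L i)%:E <= tile_length T sg r i)%E) ->
  \sum_(i <- X) L i <= 2 * (c * (pi * r ^+ 2)).
Proof.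
move=> rr uX LX; rewrite -lee_fin -sumEFin.
apply: (@le_trans _ _ (\sum_(i <- X) tile_length T sg r i)%E).
  by rewrite big_seq [leRHS]big_seq; apply: lee_sum => i iX; exact: LX.
apply: (le_trans (total_length simpleT disjointT sgT r uX)).
by rewrite [X in (_ <= X)%E]EFinM lee_pmul2l ?ratio// lte_fin ltr0n.
Qed.

Lemma sum_const (x : R) X : \sum_(i <- X) x = x * (size X)%:R.
Proof. by rewrite big_const_seq count_predT iter_addr addr0 mulr_natr. Qed.

(** Each tile contributes at least 3 within radius [rho + 5]: its perimeter if it stays inside, and
    [5 - 2] by crossing otherwise. *)
Lemma touches_bound rho X : uniq X -> (forall i, i \in X -> touches rho i) -> 0 <= rho ->
  (size X)%:R <= c * (pi * (Num.max r0 (rho + 5)) ^+ 2).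
Proof.
move=> uX hX rho0; set r := Num.max _ _.
have rr0 : r0 <= r by rewrite /r le_max lexx.
have rr1 : rho + 5 <= r by rewrite /r le_max lexx orbT.
have := @total_tile_length r X (fun=> 3) rr0 uX _; rewrite sum_const => h.
have : 3 * (size X)%:R <= 2 * (c * (pi * r ^+ 2)).
  apply: h => i /hX mi; have [ir|ir] := boolP (inside r i).
    have p3 : 3 <= perimeter (T i).
      have [/sharp_perimeter|/blunt_perimeter] := pselect (sharp T i); lra.
    apply: (@le_trans _ _ (perimeter (T i))%:E); first by rewrite lee_fin.
    by apply: tile_length_inside => k; move/insideP: ir.
  apply: le_trans (tile_length_crossing_touches _ mi ir); last lra.
  by rewrite lee_fin; lra.
have := ler0n R (size X); lra.
Qed.

(** Local finiteness: otherwise arbitrarily many tiles would touch the disk, against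
    [touches_bound]. *)
Lemma touches_finite rho : 0 <= rho ->
  exists2 X, uniq X & forall i, touches rho i <-> i \in X.
Proof.
move=> rho0; apply: contrapT => no.
have grow n : exists X, [/\ uniq X, size X = n & forall i, i \in X -> touches rho i].
  elim: n => [|n [X [uX sX mX]]]; first by exists [::].
  have [i [mi iX]] : exists i, touches rho i /\ i \notin X.
    apply: contrapT => ni; apply: no; exists X => // i; split; last exact: mX.
    by move=> mi; apply/negPn/negP => iX; apply: ni; exists i.
  exists (i :: X); split => /=; [by rewrite iX|by rewrite sX|].
  by move=> j; rewrite inE => /predU1P[->//|]; exact: mX.
set B := c * (pi * (Num.max r0 (rho + 5)) ^+ 2).
have [X [uX sX mX]] := grow (Num.truncn B).+1.
have B0 : 0 <= B by rewrite /B mulr_ge0// mulr_ge0 ?pi_ge0// sqr_ge0.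
have := touches_bound uX mX rho0; rewrite sX -/B leNgt => /negP; apply.
exact: truncnS_gt.
Qed.

(** Finitely many tiles come near [v]; they are closed, so those that miss [v] keep away from it. *)
Lemma near_vertex v : exists2 e : R, 0 < e &
  forall j q, region (T j) q -> ball v e q -> region (T j) v.
Proof.
have rho0 : 0 <= eucl_norm v + 2 by rewrite addr_ge0 ?eucl_norm_ge0.
have [X _ hX] := touches_finite rho0.
have [e e0 he] : exists2 e : R, 0 < e & forall j q, j \in X ->
    region (T j) q -> ball v e q -> region (T j) v.
  elim: X {hX} => [|i X [e e0 he]]; first by exists 1.
  have [d d0 hd] : exists2 d : R, 0 < d &
      forall q, region (T i) q -> ball v d q -> region (T i) v.
    have [rv|rv] := pselect (region (T i) v); first by exists 1.
    have /nbhs_ballP[d d0 hd] : nbhs v (~` region (T i)).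
      apply: open_nbhs_nbhs; split => //; apply: closed_openC; exact: region_closed.
    by exists d => // q rq bq; have := hd _ bq.
  exists (Num.min e d); first by rewrite lt_min e0.
  move=> j q; rewrite inE => /predU1P[->|jX] rq bq.
    by apply: (hd q) => //; apply: le_ball bq; rewrite ge_min lexx orbT.
  by apply: (he j q) => //; apply: le_ball bq; rewrite ge_min lexx.
exists (Num.min e 1); first by rewrite lt_min e0 ltr01.
move=> j q rq bq; apply: (he j q) => //; last first.
  by apply: le_ball bq; rewrite ge_min lexx.
apply/hX; exists q => //.
have b1 : ball v 1 q by apply: le_ball bq; rewrite ge_min lexx orbT.
by have := eucl_dist_triangle 0 v q; have := ball_dist b1; rewrite !eucl_dist0l; lra.
Qed.

Lemma blunt_at_vertex i k : sharp T i -> exists2 j, ~ sharp T j & exists l, T j l = T i k.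
Proof.
move=> si; have [e e0 he] := near_vertex (T i k).
apply: (sharp_meets_blunt simpleT coverT disjointT edgeT areaT e0 he).
by split => //; exists k.
Qed.

Lemma area_covered r X : 0 < r -> (forall i, touches r i -> i \in X) ->
  pi * r ^+ 2 <= (size X)%:R.
Proof.
move=> r00 hX; pose U := foldr (fun i A => region (T i) `|` A) set0.
have [mU aU] : measurable (U X : set (measurableTypeR R * measurableTypeR R)) /\
    (area (U X) <= (size X)%:R%:E)%E.
  elim: X {hX} => [|i X [mU aU]] /=.
    by split; [exact: measurable0|rewrite /area measure0].
  split; first by apply: measurableU => //; exact: region_measurable.
  rewrite -natr1 addrC; apply: areaU_le => //; first exact: region_measurable.
  by rewrite areaT.
rewrite -lee_fin; apply: (le_trans (disk_area_ge r00)); apply: le_trans aU.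
apply: le_area => //; first by apply: disk0_measurable; exact: ltW.
move=> q /disk0_norm qr; have : [set: R * R] q by [].
rewrite -coverT => -[i _ ri]; have : i \in X by apply: hX; exists q.
elim: X {hX mU} => //= j X IH; rewrite inE => /predU1P[<-|iX]; first by left.
by right; exact: IH.
Qed.

Definition at_vertex v i := [exists k, T i k == v].

Lemma at_vertexP v i : reflect (exists k, T i k = v) (at_vertex v i).
Proof. by apply: (iffP existsP) => -[k h]; exists k; exact/eqP. Qed.

Lemma sum_at_vertex v i : (\sum_k (T i k == v) = at_vertex v i :> nat)%N.
Proof.
case: (at_vertexP v i) => [[k <-]|no].
  rewrite (bigD1 k)//= eqxx big1// => l lk.
  have [inj _ _] := simpleT i; by rewrite (inj_eq inj) (negbTE lk).
rewrite big1// => k _; case: eqP => // kv; case: no; by exists k.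
Qed.

Lemma sharp_count_vertex v X : uniq X -> (forall i, i \in X -> sharp T i) ->
  (count (at_vertex v) X <= 3)%N.
Proof.
move=> uX sX; rewrite -size_filter leqNgt; apply/negP.
have : uniq ([seq i <- X | at_vertex v i]) by rewrite filter_uniq.
have : forall i, i \in [seq i <- X | at_vertex v i] -> sharp_at T v i.
  move=> i; rewrite mem_filter => /andP[/at_vertexP vi iX].
  by split => //; exact: sX.
case: [seq _ <- X | _] => [|i1 [|i2 [|i3 [|i4 s]]]] // hs us _.
apply: (@no_four_sharp _ T simpleT disjointT areaT v i1 i2 i3 i4).
- have : uniq ([:: i1; i2; i3; i4] ++ s) := us.
  by rewrite cat_uniq => /andP[].
- by apply: hs; rewrite !inE eqxx.
- by apply: hs; rewrite !inE eqxx orbT.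
- by apply: hs; rewrite !inE eqxx !orbT.
- by apply: hs; rewrite !inE eqxx !orbT.
Qed.

Lemma sharp_count_reflex j k X : ~ sharp T j -> corner (T j) (sg j) k <= 0 ->
  uniq X -> (forall i, i \in X -> sharp T i) ->
  (count (at_vertex (T j k)) X <= 1)%N.
Proof.
move=> nj ck uX sX; rewrite -size_filter leqNgt; apply/negP.
have : uniq ([seq i <- X | at_vertex (T j k) i]) by rewrite filter_uniq.
have : forall i, i \in [seq i <- X | at_vertex (T j k) i] -> sharp_at T (T j k) i.
  move=> i; rewrite mem_filter => /andP[/at_vertexP vi iX].
  by split => //; exact: sX.
case: [seq _ <- X | _] => [|i1 [|i2 s]] // hs us _.
have s1 : sharp_at T (T j k) i1 by apply: hs; rewrite !inE eqxx.
have s2 : sharp_at T (T j k) i2 by apply: hs; rewrite !inE eqxx orbT.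
have ne i : sharp_at T (T j k) i -> i != j.
  by move=> [si _]; apply/eqP => ij; apply: nj; rewrite -ij.
apply: (reflex_one_sharp simpleT disjointT areaT (sgT j) erefl ck (ne _ s1) (ne _ s2) _ s1 s2).
by move: us => /=; rewrite inE negb_or => /andP[/andP[]].
Qed.

(** Double counting of the quadruples [(i, k, j, l)] with [T i k = T j l]. *)
Lemma sharp_blunt_count C B : uniq C -> (forall i, i \in C -> sharp T i) ->
  (forall j, j \in B -> ~ sharp T j) ->
  (forall i k, i \in C -> exists2 j, j \in B & exists l, T j l = T i k) ->
  (5 * size C <= 13 * size B)%N.
Proof.
move=> uC sC nB CB.
pose inc i k j l : nat := T i k == T j l.
apply: (@leq_trans (\sum_(i <- C) \sum_k \sum_(j <- B) \sum_l inc i k j l)).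
  have -> : (5 * size C = \sum_(i <- C) 5)%N.
    by rewrite big_const_seq count_predT iter_addn addn0.
  rewrite big_seq [X in (_ <= X)%N]big_seq; apply: leq_sum => i iC.
  apply: (@leq_trans (\sum_(k < 5) 1)%N); first by rewrite sum1_card card_ord.
  apply: leq_sum => k _; have [j jB [l jl]] := CB i k iC.
  rewrite (big_rem j jB) /=; apply: leq_trans (leq_addr _ _).
  by rewrite (bigD1 l)//= /inc jl eqxx.
have -> : (\sum_(i <- C) \sum_k \sum_(j <- B) \sum_l inc i k j l =
    \sum_(j <- B) \sum_l count (at_vertex (T j l)) C)%N.
  under eq_bigr => i _.
    rewrite exchange_big /=; under eq_bigr => j _ do rewrite exchange_big /=.
    over.
  rewrite exchange_big /=; apply: eq_bigr => j _; rewrite exchange_big /=.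
  apply: eq_bigr => l _; rewrite -sum1_count [RHS]big_mkcond /=.
  by apply: eq_bigr => i _; rewrite /inc sum_at_vertex; case: (at_vertex _ _).
have -> : (13 * size B = \sum_(j <- B) 13)%N.
  by rewrite big_const_seq count_predT iter_addn addn0.
rewrite big_seq [X in (_ <= X)%N]big_seq; apply: leq_sum => j /nB nj.
have [k ck] := blunt_corner nj.
rewrite (bigD1 k)//= -[X in (_ <= X)%N]/(1 + 12)%N; apply: leq_add.
  exact: sharp_count_reflex.
apply: (@leq_trans (\sum_(l < 5 | l != k) 3)).
  by apply: leq_sum => l _; exact: sharp_count_vertex.
by rewrite sum_nat_const cardC1 card_ord.
Qed.

End Bounded.

End Counting.

(* Minimizing [324 / 85 * C + 4 * E] over [5 * C <= 13 * E] and [C + E = 1]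
   gives [2956 / 765]. *)
Lemma mean_perimeter_gap (R : realFieldType) (d Q C E M1 M2 : R) : 0 < d * Q ->
  (1 - 4 * d) * Q <= C + E + M1 -> 5 * C <= 13 * (E + M2) ->
  M1 <= 4 * (d * Q) -> M2 <= 4 * (d * Q) ->
  2956 / 765 * Q - 40 * (d * Q) < 324 / 85 * C + 4 * E.
Proof. by lra. Qed.

(** Two annuli of width [d * r] take up a fraction of order [d] of the disk, while their width,
    large by the last inequality, makes the crossing tiles few. *)
Lemma large_radii (R : realFieldType) (r0 d : R) : 0 < d -> d < 1 / 8 ->
  exists r, [/\ r0 <= r - d * r, 0 < r - 2 * (d * r),
    r - 2 * (d * r) <= r - d * r & r - d * r <= r] /\ d^-1 <= d * r - 2.
Proof.
move=> d0 d1; have di : 0 < d^-1 by rewrite invr_gt0.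
pose x : R := `|r0| + 2 + d^-1; have r00 := ler_norm r0; have n0 := normr_ge0 r0.
have x0 : 0 < x by rewrite /x; lra.
have xd : 8 * x <= x / d.
  by rewrite mulrC; apply: ler_wpM2l; [exact: ltW|rewrite -div1r ler_pdivlMr//; lra].
exists (x / d); have -> : d * (x / d) = x by rewrite mulrC divfK// gt_eqF.
move: (x / d) xd => y; rewrite /x => *.
by split; [split|]; lra.
Qed.

(** * Counting in large disks under an assumed bound on the ratio *)

Section Ratio.
Context {R : realType}.
Variables (T : nat -> pentagon R) (sg : nat -> R).
Hypothesis simpleT : forall i, simple_pentagon (T i).
Hypothesis coverT : \bigcup_i region (T i) = [set: R * R].
Hypothesis disjointT :
  forall i j, i <> j -> (region (T i))° `&` (region (T j))° = set0.
Hypothesis edgeT : edge_to_edge T.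
Hypothesis areaT : forall i, area (region (T i)) = 1%E.
Hypothesis shapeT : forall i, ~ convex_set (region (T i)) \/ sharp T i.
Hypothesis sgT : forall i, oriented (T i) (sg i).
Variables (r0 c : R).
Hypothesis c0 : 0 <= c.
Hypothesis ratio : forall r, r0 <= r -> (perimeter_in T r <= (c * (pi * r ^+ 2))%:E)%E.

Lemma count_split (a b : pred nat) (X : seq nat) :
  count a X = (count (predI a b) X + count (predI a (predC b)) X)%N.
Proof.
elim: X => //= i X ->; rewrite addnACA; congr addn.
by case: (a i); case: (b i).
Qed.

Let total := total_tile_length simpleT disjointT sgT ratio.

Lemma crossing_bound rho r (X : seq nat) : 0 <= r -> r0 <= r -> uniq X ->
  (forall i, i \in X -> touches T rho i /\ ~~ inside T r i) ->
  (r - rho - 2) * (size X)%:R <= 2 * (c * (pi * r ^+ 2)).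
Proof.
move=> r00 rr uX hX; rewrite -sum_const; apply: total => // i /hX[mi ii].
exact: tile_length_crossing_touches.
Qed.

(* [C]: sharp tiles near the disk of radius [r1], [E]: blunt tiles near the
   larger disk of radius [r2], [M1] and [M2]: tiles crossing the annuli. *)
Lemma count_estimate r1 r2 r : r0 <= r2 -> 0 < r1 -> r1 <= r2 -> r2 <= r ->
  exists C E M1 M2 : nat, [/\ pi * r1 ^+ 2 <= C%:R + E%:R + M1%:R,
    5 * C%:R <= 13 * (E%:R + M2%:R) :> R,
    324 / 85 * C%:R + 4 * E%:R <= 2 * (c * (pi * r ^+ 2)),
    (r2 - r1 - 2) * M1%:R <= 2 * (c * (pi * r2 ^+ 2)) &
    (r - r2 - 2) * M2%:R <= 2 * (c * (pi * r ^+ 2))].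
Proof.
move=> r02 r10 r12 r2r; have r20 := lt_le_trans r10 r12; have rr0 := lt_le_trans r20 r2r.
have fin := touches_finite simpleT disjointT areaT shapeT sgT c0 ratio.
have [X1 u1 m1] := fin _ (ltW r10); have [X2 u2 m2] := fin _ (ltW r20).
pose S i := `[< sharp T i >].
have SP i : reflect (sharp T i) (S i) by exact: asboolP.
pose C := [seq i <- X1 | S i && inside T r2 i].
pose E := [seq j <- X2 | ~~ S j && inside T r j].
pose M1 := [seq i <- X1 | ~~ inside T r2 i].
pose M2 := [seq j <- X2 | ~~ inside T r j].
pose B := [seq j <- X2 | ~~ S j].
have uC : uniq C by rewrite filter_uniq.
have uE : uniq E by rewrite filter_uniq.
have le_inside a b i : a <= b -> inside T a i -> inside T b i.
  by move=> ab /insideP h; apply/insideP => k; exact: le_trans (h k) ab.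
exists (size C), (size E), (size M1), (size M2); split.
- apply: (le_trans (area_covered coverT areaT r10 (fun i => proj1 (m1 i)))).
  (* The tiles of [X1] that are not inside radius [r2] form [M1]; the others are in [C] or in [E],
     according to their shape. *)
  rewrite -!natrD ler_nat -count_predT.
  rewrite (count_split _ (inside T r2)) (count_split (predI _ _) S).
  apply: leq_add; [apply: leq_add|]; last first.
  + by rewrite size_filter; apply: sub_count => i /andP[].
  + rewrite -size_filter; apply: uniq_leq_size; first by rewrite filter_uniq.
    move=> i; rewrite !mem_filter /= => /andP[/andP[ii nS] iX].
    rewrite nS (le_inside _ _ _ r2r ii) /=; apply/m2.
    by have /insideP h := ii; exact: (vertex_touches (h ord0)).
  + by rewrite size_filter; apply: sub_count => i /= /andP[-> ->].
- have CB : (5 * size C <= 13 * size B)%N.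
    apply: (sharp_blunt_count simpleT disjointT areaT shapeT sgT uC).
    + by move=> i; rewrite mem_filter => /andP[/andP[/SP]].
    + by move=> j; rewrite mem_filter => /andP[/SP].
    move=> i k; rewrite mem_filter => /andP[/andP[/SP si /insideP ii] _].
    have [j nj [l jl]] := blunt_at_vertex simpleT coverT disjointT edgeT areaT
      shapeT sgT c0 ratio k si.
    exists j; last by exists l.
    rewrite mem_filter; apply/andP; split; first exact/SP.
    by apply/m2; apply: (@vertex_touches _ _ _ _ l); rewrite jl.
  have BE : (size B <= size E + size M2)%N.
    rewrite !size_filter (count_split _ (inside T r)) leq_add2l.
    by apply: sub_count => j /andP[].
  by rewrite -natrD -!natrM ler_nat (leq_trans CB)// leq_mul2l BE.
- pose L i : R := if S i then 324 / 85 else 4.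
  have sumC : \sum_(i <- C) L i = 324 / 85 * (size C)%:R.
    rewrite -sum_const; apply: eq_big_seq => i.
    by rewrite mem_filter /L => /andP[/andP[-> _] _].
  have sumE : \sum_(i <- E) L i = 4 * (size E)%:R.
    rewrite -sum_const; apply: eq_big_seq => i.
    by rewrite mem_filter /L => /andP[/andP[/negbTE -> _] _].
  rewrite -sumC -sumE -big_cat /=; apply: total; first exact: le_trans r2r.
    rewrite cat_uniq uC uE andbT; apply/hasPn => j; rewrite !mem_filter.
    by move=> /andP[/andP[/negbTE -> _] _].
  move=> i; rewrite mem_cat => iCE.
  have ir : inside T r i.
    move: iCE; rewrite !mem_filter => /orP[/andP[/andP[_ h] _]|/andP[/andP[_ h] _]] //.
    exact: le_inside h.
  apply: (@le_trans _ _ (perimeter (T i))%:E).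
    rewrite lee_fin /L; case: SP => [si|ni].
      exact: (sharp_perimeter simpleT areaT sgT si).
    exact: (blunt_perimeter simpleT areaT shapeT sgT ni).
  by apply: tile_length_inside; exact/insideP.
- apply: crossing_bound => //; [exact: ltW|by rewrite filter_uniq|].
  by move=> i; rewrite mem_filter => /andP[ii /m1].
- apply: crossing_bound => //; [exact: ltW|exact: le_trans r2r|by rewrite filter_uniq|].
  by move=> i; rewrite mem_filter => /andP[ii /m2].
Qed.

(** [1530] is twice [765]: the length of an edge counts for the two tiles that share it. *)
Lemma ratio_lower_bound : 2956 / 1530 <= c.
Proof.
rewrite leNgt; apply/negP => clt; have c2 : c <= 2 by lra.
(* [d] is scaled to the supposed defect of [c], so that the losses at both annuli, less than
   [40 * d] relative to [Q], do not make up for it. *)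
have [d [d0 d1 dE]] : exists d, [/\ 0 < d, d < 1 / 8 & 2 * c = 2956 / 765 - 40 * d].
  by exists ((2956 / 765 - 2 * c) / 40); split; move: c0; lra.
have [r [[x1 x2 x3 x4] dr]] := large_radii r0 d0 d1.
have [C [E [M1 [M2 [h1 h2 h3 h4 h5]]]]] := count_estimate x1 x2 x3 x4.
set Q := pi * r ^+ 2 in h3 h5.
have r00 : 0 < r := lt_le_trans x2 (le_trans x3 x4).
have Q0 : 0 < Q by rewrite /Q mulr_gt0 ?pi_gt0// exprn_gt0.
have e1 : r - d * r - (r - 2 * (d * r)) - 2 = d * r - 2 by ring.
have e2 : r - (r - d * r) - 2 = d * r - 2 by ring.
rewrite e1 in h4; rewrite e2 in h5.
(* This combines [d^-1 <= d * r - 2] with [c <= 2]. *)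
have bound (M : nat) : (d * r - 2) * M%:R <= 2 * (c * Q) -> M%:R <= 4 * (d * Q).
  move=> h; have -> : 4 * (d * Q) = d * (2 * (2 * Q)) by ring.
  rewrite -[leLHS](mulVKf (lt0r_neq0 d0)); apply: ler_wpM2l; first exact: ltW.
  apply: (@le_trans _ _ (2 * (c * Q))); last first.
    by rewrite ler_pM2l// ler_pM2r.
  by apply: le_trans h; apply: ler_wpM2r.
have b2 := bound _ h5.
have b1 : M1%:R <= 4 * (d * Q).
  apply: bound; apply: le_trans h4 _; apply: ler_wpM2l => //; apply: ler_wpM2l => //.
  apply: ler_wpM2l; first exact: pi_ge0.
  have r1 : 0 <= r - d * r by exact: le_trans (ltW x2) x3.
  by rewrite lerXn2r ?nnegrE// ltW.
have area1 : (1 - 4 * d) * Q <= C%:R + E%:R + M1%:R.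
  apply: le_trans h1; rewrite /Q.
  have -> : pi * (r - 2 * (d * r)) ^+ 2 =
    (1 - 4 * d) * (pi * r ^+ 2) + pi * (4 * (d * r) ^+ 2) by ring.
  by rewrite lerDl mulr_ge0 ?pi_ge0// mulr_ge0// sqr_ge0.
have := mean_perimeter_gap (mulr_gt0 d0 Q0) area1 h2 b1 b2.
have -> : 2956 / 765 * Q - 40 * (d * Q) = 2 * c * Q by rewrite dE; ring.
by rewrite -(mulrA 2) ltNge h3.
Qed.

End Ratio.

Lemma sqrt_lt_ratio {R : realType} (T : nat -> pentagon R) :
  tiling T -> edge_to_edge T -> (forall i, area (region (T i)) = 1%E) ->
  (forall i, ~ convex_set (region (T i)) \/ sharp T i) ->
  ((Num.sqrt (2 + Num.sqrt 3))%:E < perimeter_ratio T)%E.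
Proof.
move=> [simpleT coverT disjointT] edgeT areaT shapeT.
have [sg sgT] := choice (fun i => tile_orientation (simpleT i) (areaT i)).
rewrite ltNge; apply/negP => le_sqrt.
(* A bound on a limit superior holds eventually only with some room, hence a rational between the
   square root and [2956 / 1530]. *)
have : (perimeter_ratio T < (539 / 279)%:E)%E.
  by apply: (le_lt_trans le_sqrt); rewrite lte_fin; exact: sqrt_bound.
rewrite /perimeter_ratio /limf_esup => /ereal_inf_lt[_ [V VF <-]] supV.
(* Radii strictly beyond [M] belong to [V]; radii at least 1 make the divisor positive. *)
have [M [_ MV]] := VF; pose r0 := Num.max (M + 1) 1.
have ratio r : r0 <= r -> (perimeter_in T r <= (539 / 279 * (pi * r ^+ 2))%:E)%E.
  rewrite /r0 ge_max => /andP[Mr r1].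
  have Vr : V r by apply: MV; lra.
  have Q0 : 0 < pi * r ^+ 2 by rewrite mulr_gt0 ?pi_gt0// exprn_gt0//; lra.
  rewrite EFinM -lee_pdivrMr//; apply: le_trans (ltW supV).
  by apply: ereal_sup_ubound; exists r.
have c0 : 0 <= 539 / 279 :> R by lra.
have := ratio_lower_bound simpleT coverT disjointT edgeT areaT shapeT sgT c0 ratio.
lra.
Qed.

Theorem proposition5p5 (R : realType) (T : nat -> pentagon R)
    (T_tiling : tiling T) (T_edge_to_edge : edge_to_edge T)
    (T_unit_area : forall i, area (region (T i)) = 1%E)
    (T_shape : forall i, ~ convex_set (region (T i)) \/
       (forall k, pi / 2 < interior_angle (T i) k < 2 * pi / 3)) :
  (forall P : pentagon R, prismatic P -> area (region P) = 1%E ->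
     ((perimeter P / 2)%:E < perimeter_ratio T)%E) /\
  ((Num.sqrt (2 + Num.sqrt 3))%:E < perimeter_ratio T)%E.
Proof.
have ratio := sqrt_lt_ratio T_tiling T_edge_to_edge T_unit_area T_shape.
split => // P prismP areaP; rewrite (prismatic_perimeter prismP areaP).
by have -> : 2 * Num.sqrt (2 + Num.sqrt 3) / 2 = Num.sqrt (2 + Num.sqrt 3) :> R
  by field.
Qed.
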